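(* For each $m \in \{2, 3, 4, 5, 7, 9, 11\}$ there is a strategy for Domineering on $m \times n$ boards, computable in time polynomial in $n$, which for every $n$ lets the player who can force a win on the empty $m \times n$ board (given who moves first and the board's outcome class) actually win: i.e. there is an algorithm that, given $n$ and any position reached in play from the empty $m\times n$ board with that player to move, outputs in time polynomial in $n$ a legal move, such that always playing the output move guarantees that player wins.
   Context: Domineering on an $m \times n$ board (a rectangle of $m$ rows and $n$ columns of unit cells): two players, Vera and Hepzibah, alternately place dominoes on empty cells; Vera places vertical dominoes (covering two vertically adjacent empty cells), Hepzibah places horizontal dominoes (covering two horizontally adjacent empty cells). A player who cannot move on her turn loses. The strategy is not required to win by the maximum possible margin, only to win. *)

(* Defs.v *)
From mathcomp Require Import all_boot all_order all_algebra.
Set Implicit Arguments. Unset Strict Implicit. Unset Printing Implicit Defensive.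
Import GRing.Theory Num.Theory.

Inductive dir := DLeft | DRight | DStay.

Record TM := {
  tm_state : finType;
  tm_start : tm_state;
  tm_halt  : tm_state -> bool;
  tm_delta : tm_state -> option bool -> tm_state * option bool * dir }.

Record config (M : TM) := Config {
  cf_state : tm_state M;
  cf_tape  : int -> option bool;
  cf_head  : int }.

Definition tm_init (M : TM) (input : seq bool) : config M :=
  @Config M (@tm_start M)
    (fun i : int => match i with
                    | Posz k => if k < size input then Some (nth false input k) else None
                    | Negz _ => None end)
    0%R.

Definition tm_step (M : TM) (c : config M) : config M :=
  if @tm_halt M (cf_state c) then c else
  let: (q', w, d) := @tm_delta M (cf_state c) (cf_tape c (cf_head c)) in
  @Config M q' (fun j => if j == cf_head c then w else cf_tape c j)
    (match d with
     | DLeft => (cf_head c - 1)%R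
     | DRight => (cf_head c + 1)%R
     | DStay => cf_head c end).

Definition tape_output (M : TM) (c : config M) (out : seq bool) : Prop :=
  (forall i, i < size out -> cf_tape c (Posz i) = Some (nth false out i)) /\
  cf_tape c (Posz (size out)) = None.

(* [tm_runs M input t out]: started on [input], M is halted after
   (at most) t steps, with output [out]. *)
Definition tm_runs (M : TM) (input : seq bool) (t : nat) (out : seq bool) : Prop :=
  let c := iter t (@tm_step M) (tm_init M input) in
  @tm_halt M (cf_state c) /\ tape_output c out.

(* A position is the set of occupied cells (row, column).              *)

Inductive player := Vera | Hepzibah.

Definition opp (p : player) : player :=
  match p with Vera => Hepzibah | Hepzibah => Vera end.

Definition board (m n : nat) := {set 'I_m * 'I_n}.

Definition move (m n : nat) (p : player) (B B' : board m n) : Prop :=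
  exists a b : 'I_m * 'I_n,
    [/\ match p with
        | Vera => (a.2 = b.2) /\ (b.1 : nat) = (a.1 : nat).+1
        | Hepzibah => (a.1 = b.1) /\ (b.2 : nat) = (a.2 : nat).+1
        end,
        a \notin B, b \notin B & B' = a |: (b |: B)].

(* [wins p B]: the player p, to move at B, can force a win
   (the player unable to move on her turn loses). *)
Inductive wins (m n : nat) : player -> board m n -> Prop :=
| Wins p (B B' : board m n) :
    move p B B' ->
    (forall B'', move (opp p) B' B'' -> wins p B'') ->
    wins p B.

Definition player_bit (p : player) : bool :=
  match p with Vera => true | Hepzibah => false end.

Definition encode_board (m n : nat) (B : board m n) : seq bool :=
  [seq ((i, j) \in B) | i <- enum 'I_m, j <- enum 'I_n].

(* [strat_win M f p bound B]: with f the player who moved first on the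
   empty board and p to move at B, the machine M, run on input
   (bit of f) :: (encoding of B), halts within [bound] steps and outputs
   the encoding of a position B' obtained from B by a legal move of p,
   and this holds again after every reply of the opponent: i.e. always
   playing the machine's move, p wins. *)
Inductive strat_win (M : TM) (m n : nat) (f p : player) (bound : nat)
  : board m n -> Prop :=
| StratWin (B B' : board m n) (t : nat) :
    t <= bound ->
    tm_runs M (player_bit f :: encode_board B) t (encode_board B') ->
    move p B B' ->
    (forall B'', move (opp p) B' B'' -> strat_win M f p bound B'') ->
    strat_win M f p bound B.

(* Main.v *)
(* Sums of positions are compared with dyadic numbers as in combinatorial game theory. A dissection
   of a board into blocks of consecutive columns only forbids moves to Hepzibah, so the value of
   the board is at most the sum of the values of the blocks. For each of the heights, copies of
   some board have a negative sum, which a table of bounds for subpositions certifies; hence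
   there is a [W] such that Hepzibah wins all boards of width at least [W], moving first or second.

   Boards of width less than [W] are finitely many. On a wider board Hepzibah wins by dissecting
   it into one block of width [W + n %% W] and blocks of width [W], and by answering each move
   of Vera within the same block. The block that she has to answer in is the only one whose
   number of dominoes has the wrong parity, so it can be found from the position alone. *)

From HB Require Import structures.
From Stdlib Require Import ZArith NArith Permutation FMapPositive.
From Stdlib Require Import FunctionalExtensionality ClassicalEpsilon.
From mathcomp Require Import all_boot all_order all_algebra.
From mathcomp Require Import zify.
Require Import Defs.
Set Implicit Arguments.
Unset Strict Implicit.
Unset Printing Implicit Defensive.

(** * Sums of games *)

(** For heights 2, 3, 4 and 5 a single board gets a negative number as its bound. For 7, 9 and 11
    the board of width 2 is instead bounded by a small hot game, and 2, 2 and 4 copies of that game,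
    rather than of the board, are shown to be negative.

    The obstacle for the machine is that the input lists the board row by row without its width [n]:
    the cells of a column lie [n] apart, the control cannot count to [n], and the only symbol that
    does not occur in the encoding is the blank. So [m.+1] blanks serve as pebbles, and the control
    remembers what they cover. Their common distance is increased by one until the last pebble
    leaves the board. The distance is then [n], the first [m] pebbles lie in column 0, and a counter
    in the control holds [n %% W]. This takes [n] sweeps of linear length, so the whole run is
    quadratic in [n].

    The answers on narrow boards and within blocks are finite tables in the control. The theorem
    asks only for the existence of a machine, so these tables are taken by choice and never
    computed. *)

Lemma oppK : involutive opp. Proof. by case. Qed.

Section Sums.

Variables (C : Type) (cmove : player -> C -> C -> Prop).

Definition pmove p (l l' : seq C) := exists l1 c c' l2,
  [/\ l = l1 ++ c :: l2, cmove p c c' & l' = l1 ++ c' :: l2].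

(** With Vera as Left, [snd_win Hepzibah l] says that the sum is at most 0, and [snd_win Vera l]
    that it is at least 0. Being inductive, the predicates contain the termination of play along the
    strategy, so most proofs about them need no measure. *)
Inductive snd_win (p : player) : seq C -> Prop :=
| SndWin l : (forall l', pmove (opp p) l l' -> fst_win p l') -> snd_win p l
with fst_win (p : player) : seq C -> Prop :=
| FstWin l l' : pmove p l l' -> snd_win p l' -> fst_win p l.

Scheme snd_win_mind := Minimality for snd_win Sort Prop
  with fst_win_mind := Minimality for fst_win Sort Prop.

Lemma pmove_catP p l1 l2 l : pmove p (l1 ++ l2) l ->
  (exists2 l1', pmove p l1 l1' & l = l1' ++ l2) \/
  (exists2 l2', pmove p l2 l2' & l = l1 ++ l2').
Proof.
case=> a [c [c' [b [E m ->]]]]; elim: l1 a E => [|x l1 IH] [|y a] /= E.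
- by right; exists (c' :: b) => //; exists [::], c, c', b.
- by right; exists (y :: a ++ c' :: b) => //; exists (y :: a), c, c', b.
- case: E m => <- <- m; left; exists (c' :: l1) => //.
  by exists [::], x, c', l1.
- case: E => <- E; case: (IH a E) => [] [l' [a' [d [d' [b' [E1 m' E2]]]]] El'].
  + left; exists (x :: l'); last by rewrite /= El'.
    by exists (x :: a'), d, d', b'; rewrite E1 E2.
  + by right; exists l'; [exists a', d, d', b' | rewrite /= El'].
Qed.

Lemma pmove_catl p l1 l1' l2 : pmove p l1 l1' -> pmove p (l1 ++ l2) (l1' ++ l2).
Proof. by case=> a [c [c' [b [-> m ->]]]]; exists a, c, c', (b ++ l2); rewrite -!catA. Qed.

Lemma pmove_catr p l1 l2 l2' : pmove p l2 l2' -> pmove p (l1 ++ l2) (l1 ++ l2').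
Proof. by case=> a [c [c' [b [-> m ->]]]]; exists (l1 ++ a), c, c', b; rewrite -!catA. Qed.

Lemma pmove_consP p c l2 l : pmove p (c :: l2) l ->
  (exists2 c', cmove p c c' & l = c' :: l2) \/
  (exists2 l2', pmove p l2 l2' & l = c :: l2').
Proof.
case/(@pmove_catP p [:: c]) => [] [l' h ->]; last by right; exists l'.
case: h => [[|x a]] [d [d' [b [E m ->]]]]; last by case: a E.
by case: E m => <- <- m; left; exists d'.
Qed.

Lemma pmove_cons p c c' l : cmove p c c' -> pmove p (c :: l) (c' :: l).
Proof. by exists [::], c, c', l. Qed.

Lemma pmove_tail p c l l' : pmove p l l' -> pmove p (c :: l) (c :: l').
Proof. exact: (@pmove_catr p [:: c]). Qed.

Lemma pmove_nil p l : ~ pmove p [::] l.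
Proof. by case=> -[|? ?] [? [? [? []]]]. Qed.

Lemma snd_winE p l : snd_win p l -> forall l', pmove (opp p) l l' -> fst_win p l'.
Proof. by case. Qed.

Lemma pmove_perm p l m m' : Permutation l m -> pmove p m m' ->
  exists2 l', pmove p l l' & Permutation l' m'.
Proof.
move=> lm [a [c [c' [b [E mv ->]]]]].
have /(@List.in_split _ c l)[l1 [l2 El]] : List.In c l.
  apply: (Permutation_in _ (Permutation_sym lm)).
  by rewrite E; apply: List.in_or_app; right; left.
exists (l1 ++ c' :: l2); first by exists l1, c, c', l2.
have h : Permutation (l1 ++ l2) (a ++ b).
  by rewrite El E in lm; exact: (Permutation_app_inv _ _ _ _ c lm).
exact: Permutation_elt.
Qed.

Lemma snd_win_perm p l m : Permutation l m -> snd_win p l -> snd_win p m.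
Proof.
move=> lm h; move: l h m lm.
apply: (snd_win_mind (p := p)
  (P := fun l => forall m, Permutation l m -> snd_win p m)
  (P0 := fun l => forall m, Permutation l m -> fst_win p m)).
- move=> l _ IH m lm; split=> m' /(pmove_perm lm) [l' mv h].
  exact: IH mv _ h.
- move=> l l' mv _ IH m lm.
  have [m' mv' h] := pmove_perm (Permutation_sym lm) mv.
  by apply: FstWin mv' _; apply: IH; apply: Permutation_sym.
Qed.

(** The winner answers in the summand in which the opponent has just moved. Either summand may be
    the one that changes, hence the nested inductions. *)
Lemma snd_win_cat p l1 l2 : snd_win p l1 -> snd_win p l2 -> snd_win p (l1 ++ l2).
Proof.
move=> h1; move: l1 h1 l2.
apply: (snd_win_mind (p := p)
  (P := fun l1 => forall l2, snd_win p l2 -> snd_win p (l1 ++ l2))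
  (P0 := fun l1 => forall l2, snd_win p l2 -> fst_win p (l1 ++ l2))).
- move=> l1 _ IH1.
  apply: (snd_win_mind (p := p)
    (P := fun l2 => snd_win p (l1 ++ l2)) (P0 := fun l2 => fst_win p (l1 ++ l2))).
  + move=> l2 h2 IH2; split=> l' /pmove_catP[] [l'' mv ->]; last exact: IH2.
    exact: IH1 mv _ (SndWin h2).
  + by move=> l2 l2' mv _; apply: FstWin; apply: pmove_catr.
- move=> l1 l1' mv _ IH l2 h2.
  by apply: FstWin (pmove_catl _ mv) _; apply: IH.
Qed.

Lemma fst_win_cat p l1 l2 : fst_win p l1 -> snd_win p l2 -> fst_win p (l1 ++ l2).
Proof.
case=> {}l1 l1' mv h1 h2.
by apply: FstWin (pmove_catl _ mv) _; apply: snd_win_cat.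
Qed.

Lemma fst_win_perm p l m : Permutation l m -> fst_win p l -> fst_win p m.
Proof.
move=> lm h; case: h lm => {}l l' mv h lm.
have [m' mv' h'] := pmove_perm (Permutation_sym lm) mv.
by apply: FstWin mv' _; apply: snd_win_perm h; apply: Permutation_sym.
Qed.

(* If the opponent of p, moving second, wins z, then z cannot help p. *)
Lemma snd_win_cut_gen p m : snd_win p m -> forall l z, l ++ z = m ->
  (snd_win (opp p) z -> snd_win p l) /\ (fst_win (opp p) z -> fst_win p l).
Proof.
move: m; apply: (snd_win_mind (p := p)
  (P0 := fun m => forall l z, l ++ z = m -> snd_win (opp p) z -> fst_win p l)).
- move=> m _ IH l z E; split=> hz.
    split=> l' mv; apply: (IH (l' ++ z)) => //.
    by rewrite -E; apply: pmove_catl.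
  case: hz E => {}z z' mv hz E; apply: (IH (l ++ z')) hz => //.
  by rewrite -E; apply: pmove_catr.
- move=> m m' mv _ IH l z E hz; rewrite -E in mv.
  (* If the winning move of [p] lies in [z], the opponent, who wins [z] moving second, has a reply
     in [z]. The second conjunct makes this reply, so play in [z] goes on until [p] moves in [l]. *)
  case/pmove_catP: mv => [] [l' mv E'].
    by apply: FstWin mv _; apply: (IH _ z _).1.
  apply: (IH _ l' _).2 => //.
  by apply: (snd_winE hz); rewrite oppK.
Qed.

(** Read for Hepzibah: [l + z <= 0] and [z >= 0] give [l <= 0]. This makes the order of games
    transitive, and it is used to remove sums of value zero such as [x - x]. *)
Lemma snd_win_cut p l z : snd_win p (l ++ z) -> snd_win (opp p) z -> snd_win p l.
Proof. by move=> h; apply: (snd_win_cut_gen h _).1. Qed.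

Lemma fst_win_cut p l z : fst_win p (l ++ z) -> snd_win (opp p) z -> fst_win p l.
Proof.
move E: (l ++ z) => m h; case: h E => {}m m' mv h E hz; rewrite -E in mv.
case/pmove_catP: mv => [] [l' mv E'].
  by apply: FstWin mv _; apply: (@snd_win_cut _ _ z); rewrite -?E'.
apply: (snd_win_cut_gen h (z := l') _).2 => //.
by apply: (snd_winE hz); rewrite oppK.
Qed.

End Sums.

(** * Boards and numbers *)

Delimit Scope Z_scope with coqZ.

Inductive gm := Gm of seq gm & seq gm.

Definition opts (p : player) (g : gm) := let: Gm l r := g in if p is Vera then l else r.

(** A board is the set of its empty cells, as the bits of a number. The cell below cell [k] is
    [k + 1], the one to its right is [k + S]. Binary numbers keep the checking of the tables by
    computation fast. *)
Inductive piece := Board of N | Tree of gm.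

Section Pieces.

Variable S : N.

Definition stp (p : player) : N := if p is Vera then 1%num else S.

Definition clear2 (e k l : N) := N.clearbit (N.clearbit e k) l.

Definition cmove (p : player) (c c' : piece) : Prop :=
  match c with
  | Board e => exists k, [/\ N.testbit e k, N.testbit e (N.add k (stp p))
                        & c' = Board (clear2 e k (N.add k (stp p)))]
  | Tree g => exists2 g', List.In g' (opts p g) & c' = Tree g'
  end.

Local Notation swin := (snd_win cmove).
Local Notation fwin := (fst_win cmove).

Lemma clear2E e k l i :
  N.testbit (clear2 e k l) i = [&& N.testbit e i, ~~ N.eqb k i & ~~ N.eqb l i].
Proof. by rewrite /clear2 !N.clearbit_eqb -!andbA. Qed.

(** Disjoint, and no vertical domino has one cell in each part. Horizontal contact is allowed, since
    cutting there takes moves from Hepzibah only. *)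
Definition vsep (a b : N) :=
  [&& N.eqb (N.land a b) 0, N.eqb (N.land (N.shiftr a 1) b) 0
    & N.eqb (N.land (N.shiftr b 1) a) 0].

Lemma vsepP a b : reflect
  (forall i, [/\ ~~ (N.testbit a i && N.testbit b i),
                 ~~ (N.testbit a (N.add i 1) && N.testbit b i)
               & ~~ (N.testbit b (N.add i 1) && N.testbit a i)]) (vsep a b).
Proof.
apply: (iffP and3P) => [[/N.eqb_eq h1 /N.eqb_eq h2 /N.eqb_eq h3] i | h].
  by rewrite -!N.shiftr_spec' -!N.land_spec h1 h2 h3 N.bits_0.
by split; apply/N.eqb_eq/N.bits_inj => i; rewrite N.land_spec N.bits_0 ?N.shiftr_spec';
  apply/negbTE; case: (h i).
Qed.

Lemma vsepC a b : vsep a b = vsep b a.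
Proof. by rewrite /vsep [N.land b a]N.land_comm [in RHS](andbC (N.eqb (N.land _ a) _)). Qed.

Lemma vsep_clear2 a b k l : vsep a b -> vsep (clear2 a k l) b.
Proof.
move/vsepP=> h; apply/vsepP => i; rewrite !clear2E.
case: (h i) => h1 h2 h3; split; [apply: contra h1 | apply: contra h2 | apply: contra h3];
  by [case/andP=> /andP[-> _] -> | case/andP=> -> /andP[-> _]].
Qed.

Lemma clear2_lor a b k l : vsep a b -> N.testbit a k -> N.testbit a l ->
  clear2 (N.lor a b) k l = N.lor (clear2 a k l) b.
Proof.
move=> /vsepP h ak al; apply: N.bits_inj => i.
rewrite clear2E !N.lor_spec clear2E.
case: N.eqb_spec => [<-|_]; first by case: (h k); rewrite ak /= => /negbTE ->.
case: N.eqb_spec => [<-|_]; first by case: (h l); rewrite al /= => /negbTE ->.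
by rewrite !andbT.
Qed.

Lemma cmove_lor a b c : vsep a b -> cmove Vera (Board (N.lor a b)) c ->
  (exists2 a', cmove Vera (Board a) (Board a') & vsep a' b /\ c = Board (N.lor a' b)) \/
  (exists2 b', cmove Vera (Board b) (Board b') & vsep a b' /\ c = Board (N.lor a b')).
Proof.
move=> h [k [/=]]; rewrite !N.lor_spec => hk hk1 ->.
case: (vsepP _ _ h k) => h1 h2 h3.
case ak: (N.testbit a k) hk h1 h2 h3 => /=.
  move=> _ _ _; rewrite andbT => h3; rewrite (negbTE h3) orbF in hk1.
  left; exists (clear2 a k (N.add k 1)); first by exists k.
  by split; [exact: vsep_clear2 | rewrite clear2_lor].
move=> bk _; rewrite bk andbT => h2 _; rewrite (negbTE h2) /= in hk1.
right; exists (clear2 b k (N.add k 1)); first by exists k.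
rewrite vsepC in h; split; first by rewrite vsepC; exact: vsep_clear2.
by rewrite N.lor_comm clear2_lor // N.lor_comm.
Qed.

(* Merging boards only adds moves for Hepzibah. *)
Lemma snd_win_lor a b l : vsep a b ->
  swin Hepzibah (Board a :: Board b :: l) -> swin Hepzibah (Board (N.lor a b) :: l).
Proof.
move E: (_ :: _ :: l) => m h hm; move: m hm a b l E h.
apply: (snd_win_mind (p := Hepzibah)
  (P := fun m => forall a b l, Board a :: Board b :: l = m -> vsep a b ->
     swin Hepzibah (Board (N.lor a b) :: l))
  (P0 := fun m => forall a b l, Board a :: Board b :: l = m -> vsep a b ->
     fwin Hepzibah (Board (N.lor a b) :: l))).
- move=> m _ IH a b l E h; rewrite -{m}E in IH.
  split=> l' mv0; case: (pmove_consP mv0) => [] [c' mv ->] {mv0}.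
    case: (cmove_lor h mv) => [] [x mx [hx ->]].
      by apply: (IH (Board x :: Board b :: l)) => //; apply: pmove_cons.
    by apply: (IH (Board a :: Board x :: l)) => //; apply/pmove_tail/pmove_cons.
  by apply: (IH (Board a :: Board b :: c')) => //; do 2 apply: pmove_tail.
- move=> m m' mv _ IH a b l E h; rewrite -{m}E in mv.
  case: (pmove_consP mv) => {mv} [[c [k [ak ak' ->]] E] | [m1 mv E1]].
    have v := vsep_clear2 k (N.add k S) h.
    apply: (FstWin _ (IH _ _ _ (esym E) v)); apply: pmove_cons.
    exists k; rewrite !N.lor_spec ak ak' clear2_lor //.
  case: (pmove_consP mv) E1 => {mv} [[c [k [ak ak' ->]]] -> E| [l' mv -> E]].
    have v : vsep a (clear2 b k (N.add k S)).
      by rewrite vsepC; apply: vsep_clear2; rewrite vsepC.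
    apply: (FstWin _ (IH _ _ _ (esym E) v)); apply: pmove_cons.
    exists k; rewrite !N.lor_spec ak ak' !orbT; split=> //.
    by rewrite N.lor_comm -clear2_lor ?(N.lor_comm a) // vsepC.
  by apply: (FstWin _ (IH _ _ _ (esym E) h)); apply: pmove_tail.
Qed.

Lemma shift_clear2 e s k l :
  N.shiftl (clear2 e k l) s = clear2 (N.shiftl e s) (N.add k s) (N.add l s).
Proof.
apply: N.bits_inj => i; rewrite clear2E.
have [h|h] : (i < s)%num \/ (s <= i)%num by lia.
  by rewrite !N.shiftl_spec_low.
rewrite !N.shiftl_spec_high' // clear2E.
have -> x : N.eqb (N.add x s) i = N.eqb x (N.sub i s) by apply/idP/idP; lia.
by have -> x : N.eqb (N.add x s) i = N.eqb x (N.sub i s) by apply/idP/idP; lia.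
Qed.

Lemma testbit_shiftlD e s k : N.testbit (N.shiftl e s) (N.add k s) = N.testbit e k.
Proof. by rewrite N.shiftl_spec_high' ?N.add_sub //; lia. Qed.

Lemma cmove_shift p e s c : cmove p (Board (N.shiftl e s)) c ->
  exists2 e', cmove p (Board e) (Board e') & c = Board (N.shiftl e' s).
Proof.
case=> k [hk hk' ->].
have sk : (s <= k)%num.
  by case: (N.le_gt_cases s k) => // h; rewrite N.shiftl_spec_low in hk.
exists (clear2 e (N.sub k s) (N.add (N.sub k s) (stp p))); last first.
  by rewrite shift_clear2; congr (Board (clear2 _ _ _)); lia.
exists (N.sub k s); split=> //; first by rewrite -(testbit_shiftlD _ s) N.sub_add.
rewrite -(testbit_shiftlD _ s); move: hk'; congr (is_true (N.testbit _ _)); lia.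
Qed.

Lemma snd_win_shift p s e l : swin p (Board e :: l) -> swin p (Board (N.shiftl e s) :: l).
Proof.
move E: (_ :: l) => m hm; move: m hm e l E.
apply: (snd_win_mind (p := p)
  (P := fun m => forall e l, Board e :: l = m -> swin p (Board (N.shiftl e s) :: l))
  (P0 := fun m => forall e l, Board e :: l = m -> fwin p (Board (N.shiftl e s) :: l))).
- move=> m _ IH e l E; rewrite -{m}E in IH.
  split=> l' mv0; case: (pmove_consP mv0) => [] [c' mv ->] {mv0}.
    case: (cmove_shift mv) => x mx ->.
    by apply: (IH (Board x :: l)) => //; apply: pmove_cons.
  by apply: (IH (Board e :: c')) => //; apply: pmove_tail.
- move=> m m' mv _ IH e l E; rewrite -{m}E in mv.
  case: (pmove_consP mv) => {mv} [[c [k [ak ak' ->]] E] | [l' mv E]].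
    apply: (FstWin _ (IH _ _ (esym E))); apply: pmove_cons.
    exists (N.add k s); rewrite shift_clear2.
    have -> : N.add (N.add k s) (stp p) = N.add (N.add k (stp p)) s by lia.
    by rewrite !testbit_shiftlD.
  by apply: (FstWin _ (IH _ _ (esym E))); apply: pmove_tail.
Qed.

(* [num k z] is the canonical form of [z / 2 ^ k]. *)

Definition zero := Gm [::] [::].

Definition num0 (z : Z) : gm :=
  match z with
  | Z0 => zero
  | Zpos p => Pos.iter (fun g => Gm [:: g] [::]) zero p
  | Zneg p => Pos.iter (fun g => Gm [::] [:: g]) zero p
  end.

Fixpoint num (k : nat) (z : Z) : gm :=
  if k is k'.+1 then
    if Z.even z then num k' (Z.div2 z)
    else Gm [:: num k' (Z.div2 z)] [:: num k' (Z.div2 z + 1)%coqZ]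
  else num0 z.

(** The sign is chosen so that [p] wants the value to be small: moving second, [p] wins a sum of
    numbers whose signed total is at most 0. *)
Definition sgn (p : player) (z : Z) : Z := if p is Vera then Z.opp z else z.

(** The depth of the tree [num k z], that is, the birthday of the number. *)
Fixpoint rank (k : nat) (z : Z) : nat :=
  if k is k'.+1 then
    if Z.even z then rank k' (Z.div2 z)
    else (maxn (rank k' (Z.div2 z)) (rank k' (Z.div2 z + 1)%coqZ)).+1
  else Z.abs_nat z.

Lemma num_double k z : num k.+1 (2 * z) = num k z /\ rank k.+1 (2 * z) = rank k z.
Proof.
have [e d] : Z.even (2 * z) = true /\ Z.div2 (2 * z) = z by case: z.
by split; [rewrite -[num _ _]/(if _ then num k (Z.div2 (2 * z)) else _)
          | rewrite -[rank _ _]/(if _ then rank k (Z.div2 (2 * z)) else _)]; rewrite e d.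
Qed.

Lemma num0S z : (0 <= z)%coqZ -> num0 (z + 1) = Gm [:: num0 z] [::].
Proof.
case: z => [|p|p] // _; rewrite /num0.
have -> : (Z.pos p + 1)%coqZ = Z.pos (Pos.succ p) by lia.
by rewrite Pos.iter_succ.
Qed.

Lemma num0P z : (z <= 0)%coqZ -> num0 (z - 1) = Gm [::] [:: num0 z].
Proof.
case: z => [|p|p] // _; rewrite /num0.
have -> : (Z.neg p - 1)%coqZ = Z.neg (Pos.succ p) by lia.
by rewrite Pos.iter_succ.
Qed.

(** Numbers are cold: whoever moves in one makes it worse for herself. An odd numerator has its two
    even neighbours as options, and an even numerator is halved together with the denominator. *)
Lemma num_opts k z p g : List.In g (opts p (num k z)) ->
  exists z', [/\ g = num k z', (sgn p z < sgn p z')%coqZ & rank k z' < rank k z].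
Proof.
elim: k z => [|k IH] z.
  have [h|[h|h]] : (z = 0 \/ 0 < z \/ z < 0)%coqZ by lia.
  - by rewrite h; case: p.
  - have E := @num0S (z - 1) ltac:(lia).
    rewrite (_ : (z - 1 + 1)%coqZ = z) in E; last lia.
    rewrite [num 0 z]E; case: p => //= -[] // <-.
    by exists (z - 1)%coqZ; split=> //; rewrite /sgn /rank; lia.
  - have E := @num0P (z + 1) ltac:(lia).
    rewrite (_ : (z + 1 - 1)%coqZ = z) in E; last lia.
    rewrite [num 0 z]E; case: p => //= -[] // <-.
    by exists (z + 1)%coqZ; split=> //; rewrite /sgn /rank; lia.
have [ev|ev] := boolP (Z.even z).
  have E : z = (2 * Z.div2 z)%coqZ by apply: Zeven_div2; rewrite -Zeven_bool_iff.
  rewrite E (num_double _ _).1 (num_double _ _).2 => /IH[z' [-> h r]].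
  exists (2 * z')%coqZ; rewrite (num_double _ _).1 (num_double _ _).2.
  by split=> //; move: h; rewrite /sgn; case: (p); lia.
have E : z = (2 * Z.div2 z + 1)%coqZ.
  by apply: Zodd_div2; rewrite -Zodd_bool_iff -Z.negb_even.
rewrite /= (negbTE ev); set y := Z.div2 z in E *.
case: p {IH} => /= -[] // <-; [exists (2 * y)%coqZ | exists (2 * (y + 1))%coqZ];
  rewrite -/(num k.+1 _) -/(rank k.+1 _) (num_double _ _).1 (num_double _ _).2; split=> //;
  rewrite /sgn; lia.
Qed.

Definition zsum (l : seq Z) : Z := foldr Z.add 0%coqZ l.
Lemma zsum_cons z l : zsum (z :: l) = (z + zsum l)%coqZ. Proof. by []. Qed.

Definition rsum k (l : seq Z) : nat := sumn (map (rank k) l).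
Definition nums k (l : seq Z) : seq piece := map (fun z => Tree (num k z)) l.

Lemma nums_move p k l m : pmove cmove p (nums k l) m ->
  exists l', [/\ m = nums k l', (sgn p (zsum l) < sgn p (zsum l'))%coqZ & rsum k l' < rsum k l].
Proof.
elim: l m => [|z l IH] m; first by move/pmove_nil.
move=> mv; case: (@pmove_consP _ _ p (Tree (num k z)) (nums k l) m mv) => {mv}.
  case=> c [g /num_opts[z' [-> h r]] ->] ->.
  by exists (z' :: l); rewrite /rsum /= ltn_add2r; split=> //; move: h; rewrite /sgn; case: (p); lia.
case=> l2 /IH[l' [-> h r]] ->.
by exists (z :: l'); rewrite /rsum /= ltn_add2l; split=> //; move: h; rewrite /sgn; case: (p); lia.
Qed.

(** The numbers in which [p] can move at the least possible cost, a single unit of [2 ^- k]. *)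
Definition tempo (p : player) (k : nat) (z : Z) :=
  if k is 0 then Z.ltb (sgn p z) 0 else Z.odd z.

Lemma tempo_opt p k z : tempo p k z ->
  List.In (num k (z + sgn p 1)) (opts p (num k z)) /\ rank k (z + sgn p 1) < rank k z.
Proof.
case: k => [|k]; rewrite /tempo.
  move=> h; split; last by move: h; rewrite /sgn /rank; case: p; lia.
  case: p h => h; rewrite /sgn /num in h *.
    have := @num0S (z - 1) ltac:(lia).
    by rewrite (_ : (z - 1 + 1)%coqZ = z) => [-> |]; [left | lia].
  have := @num0P (z + 1) ltac:(lia).
  by rewrite (_ : (z + 1 - 1)%coqZ = z) => [-> |]; [left | lia].
rewrite -Z.negb_even => ev.
have E : z = (2 * Z.div2 z + 1)%coqZ.
  by apply: Zodd_div2; rewrite -Zodd_bool_iff -Z.negb_even.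
have -> : opts p (num k.+1 z) = [:: num k (if p is Vera then Z.div2 z else Z.div2 z + 1)%coqZ].
  by rewrite /= (negbTE ev); case: (p).
have -> : rank k.+1 z = (maxn (rank k (Z.div2 z)) (rank k (Z.div2 z + 1)%coqZ)).+1.
  by rewrite /= (negbTE ev).
set y := Z.div2 z in E *.
have -> : (z + sgn p 1 = 2 * (if p is Vera then y else y + 1))%coqZ.
  by rewrite /sgn; case: p; lia.
rewrite (num_double _ _).1 (num_double _ _).2.
by case: p; split=> /=; [left | lia | left | lia].
Qed.

Lemma has_split (T : Type) (a : pred T) s : has a s ->
  exists s1 x s2, s = s1 ++ x :: s2 /\ a x.
Proof.
elim: s => //= x s IH; case ax: (a x) => /=; first by exists [::], x, s.
by case/IH=> s1 [y [s2 [-> ay]]]; exists (x :: s1), y, s2.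
Qed.

Lemma zsum_cat l m : zsum (l ++ m) = (zsum l + zsum m)%coqZ.
Proof. by elim: l => //= z l ->; lia. Qed.

Lemma zsum_opp l : zsum (map Z.opp l) = Z.opp (zsum l).
Proof. by elim: l => // z l IH; rewrite map_cons !zsum_cons IH; lia. Qed.

Lemma all_even_double l : ~~ has Z.odd l -> l = map (Z.mul 2) (map Z.div2 l).
Proof.
elim: l => //= z l IH; rewrite negb_or -Z.negb_even negbK => /andP[ev /IH <-].
by congr (_ :: _); apply: Zeven_div2; rewrite -Zeven_bool_iff.
Qed.

Lemma nums_double k l : nums k.+1 (map (Z.mul 2) l) = nums k l /\
  (rsum k.+1 (map (Z.mul 2) l) = rsum k l /\ zsum (map (Z.mul 2) l) = (2 * zsum l)%coqZ).
Proof.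
split; last split.
- by rewrite /nums -map_comp; apply: eq_map => z; rewrite /comp (num_double _ _).1.
- by rewrite /rsum -map_comp; congr sumn; apply: eq_map => z; rewrite -(num_double _ _).2.
- by elim: l => // z l IH; rewrite map_cons !zsum_cons IH; lia.
Qed.

(* The component with the largest denominator can be moved in without overshooting. *)
Lemma nums_tempo p k l : (sgn p (zsum l) < 0)%coqZ ->
  exists l', [/\ pmove cmove p (nums k l) (nums k l'), (sgn p (zsum l') <= 0)%coqZ
               & rsum k l' < rsum k l].
Proof.
elim: k l => [|k IH] l h.
- have /has_split[a [z [b [E tz]]]] : has (tempo p 0) l.
    elim: l h => [|z l IHl]; first by case: p.
    rewrite zsum_cons => h; rewrite [has _ _]/=; case: Z.ltb_spec => //= hz; apply: IHl.
    by move: h hz; rewrite /sgn; case: (p); lia.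
  have [o r] := tempo_opt tz; exists (a ++ (z + sgn p 1)%coqZ :: b); split.
  + rewrite E /nums !map_cat /=; apply/pmove_catr/pmove_cons.
    by exists (num 0 (z + sgn p 1)).
  + rewrite E !zsum_cat !zsum_cons in h *.
    by move: h; rewrite /sgn; case: (p); lia.
  + by rewrite E /rsum !map_cat !sumn_cat /= ltn_add2l ltn_add2r.
(* A move in a component with odd numerator changes the total by one unit, which leaves a negative
   integer at most 0. If all numerators are even, the numbers are multiples of the next coarser
   unit. *)
case: (boolP (has Z.odd l)) => [/has_split[a [z [b [E tz]]]] | /all_even_double E].
  have [o r] := @tempo_opt p k.+1 z tz; exists (a ++ (z + sgn p 1)%coqZ :: b); split.
  + rewrite E /nums !map_cat [map _ (_ :: _)]map_cons; apply/pmove_catr/pmove_cons.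
    by exists (num k.+1 (z + sgn p 1)).
  + rewrite E !zsum_cat !zsum_cons in h *.
    by move: h; rewrite /sgn; case: (p); lia.
  + by rewrite E /rsum !map_cat !sumn_cat /= ltn_add2l ltn_add2r.
have [e1 [e2 e3]] := nums_double k (map Z.div2 l).
rewrite -E in e1 e2 e3.
have [|l' [mv h' r]] := IH (map Z.div2 l).
  by move: h; rewrite e3 /sgn; case: (p); lia.
have [f1 [f2 f3]] := nums_double k l'.
exists (map (Z.mul 2) l'); rewrite e1 e2 f1 f2 f3; split=> //.
by move: h'; rewrite /sgn; case: (p); lia.
Qed.

(** Any move of the opponent makes the signed total strictly negative, and [nums_tempo] answers it
    without leaving the range of totals at most 0. *)
Lemma nums_snd_win p k l : (sgn p (zsum l) <= 0)%coqZ -> swin p (nums k l).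
Proof.
have [n] := ubnP (rsum k l); elim: n => // n IH in l * => hn h.
split=> m /nums_move[l' [-> h' r]].
have [|l2 [mv h2 r2]] := @nums_tempo p k l'.
  by move: h h'; rewrite /sgn; case: (p) => /=; lia.
by apply: (FstWin mv); apply: IH h2; lia.
Qed.

End Pieces.

(* Values of games are measured in units of [2 ^- prec]. *)
Definition prec := 5.

(** A canonical number has at most one option for Vera; here it is computed in the same unit,
    without the tree. Certificates need it for Vera's move in the number that is added to a
    position. *)
Fixpoint vera_opt (k : nat) (z : Z) : option Z :=
  if k is k'.+1 then
    if Z.even z then omap (Z.mul 2) (vera_opt k' (Z.div2 z)) else Some (z - 1)%coqZ
  else if Z.ltb 0 z then Some (z - 1)%coqZ else None.

Lemma vera_optP k z g : List.In g (opts Vera (num k z)) ->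
  exists2 z', vera_opt k z = Some z' & g = num k z'.
Proof.
elim: k z => [|k IH] z.
  rewrite [vera_opt _ _]/=; case: Z.ltb_spec => h.
    have := @num0S (z - 1) ltac:(lia).
    rewrite (_ : (z - 1 + 1)%coqZ = z) => [|]; last lia.
    by rewrite -[num 0 z]/(num0 z) => -> /= [] // <-; exists (z - 1)%coqZ.
  have [z0|z0] : (z = 0 \/ z + 1 <= 0)%coqZ by lia.
    by rewrite z0.
  have := num0P z0; rewrite (_ : (z + 1 - 1)%coqZ = z) => [|]; last lia.
  by rewrite -[num 0 z]/(num0 z) => ->.
rewrite [vera_opt _ _]/=; have [ev|ev] := boolP (Z.even z).
  have E : z = (2 * Z.div2 z)%coqZ by apply: Zeven_div2; rewrite -Zeven_bool_iff.
  rewrite {1}E (num_double _ _).1 => /IH[z' -> ->].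
  by exists (2 * z')%coqZ => //; rewrite (num_double _ _).1.
have E : z = (2 * Z.div2 z + 1)%coqZ.
  by apply: Zodd_div2; rewrite -Zodd_bool_iff -Z.negb_even.
have -> : opts Vera (num k.+1 z) = [:: num k (Z.div2 z)] by rewrite /= (negbTE ev).
case=> // <-; exists (z - 1)%coqZ => //; set y := Z.div2 z in E *.
by rewrite (_ : z - 1 = 2 * y)%coqZ; [rewrite (num_double _ _).1 | lia].
Qed.

(* Binary trees, standing for the hot games that boards are compared with. *)
Inductive tk := TN of Z | TS of tk & tk.

Fixpoint tk_eqb (s t : tk) : bool :=
  match s, t with
  | TN x, TN y => Z.eqb x y
  | TS a b, TS c d => tk_eqb a c && tk_eqb b d
  | _, _ => false
  end.

Fixpoint tks_eqb (s t : seq tk) : bool :=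
  match s, t with
  | [::], [::] => true
  | x :: s', y :: t' => tk_eqb x y && tks_eqb s' t'
  | _, _ => false
  end.

Lemma tk_eqbP s t : tk_eqb s t -> s = t.
Proof.
elim: s t => [x|a IHa b IHb] [y|c d] //=; first by move/Z.eqb_eq=> ->.
by case/andP=> /IHa -> /IHb ->.
Qed.

Lemma tks_eqbP s t : tks_eqb s t -> s = t.
Proof. by elim: s t => [|x s IH] [|y t] //= /andP[/tk_eqbP -> /IH ->]. Qed.

Fixpoint tree (t : tk) : gm :=
  match t with
  | TN z => num prec z
  | TS l r => Gm [:: tree l] [:: tree r]
  end.

Fixpoint tk_size (t : tk) : nat := if t is TS l r then (tk_size l + tk_size r).+1 else 0.

Definition trees (ts : seq tk) : seq piece := map (fun t => Tree (tree t)) ts.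

(** * Upper bounds of positions by dyadic numbers *)

Section Bounds.

Variable S : N.

Local Notation swin := (snd_win (cmove S)).
Local Notation fwin := (fst_win (cmove S)).
Local Notation pmove := (pmove (cmove S)).

(** The inequality [l <= x] in units of [2 ^- prec], expressed as [l - x <= 0]. *)
Definition bounded (l : seq piece) (x : Z) := swin Hepzibah (l ++ nums prec [:: - x]%coqZ).

Lemma bounded_perm l m x : Permutation l m -> bounded l x -> bounded m x.
Proof. by move=> h; apply: snd_win_perm; apply: Permutation_app_tail. Qed.

Lemma swin_bounded l zs x : swin Hepzibah (l ++ nums prec zs) -> (- zsum zs <= x)%coqZ ->
  bounded l x.
Proof.
move=> h hx; apply: (@snd_win_cut _ _ _ _ (nums prec (zs ++ map Z.opp zs))); last first.
  apply: nums_snd_win; rewrite -[sgn _ _]/(Z.opp _) zsum_cat zsum_opp; lia.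
have h2 : swin Hepzibah (nums prec ([:: - x]%coqZ ++ map Z.opp zs)).
  by apply: nums_snd_win; rewrite -[sgn _ _]/(zsum _) zsum_cat zsum_opp zsum_cons /=; lia.
apply: snd_win_perm (snd_win_cat h h2).
rewrite /nums !map_cat -!catA; apply: Permutation_app_head.
exact: (Permutation_app_swap_app (nums prec zs) (nums prec [:: - x]%coqZ)).
Qed.

(** Since [y - x] is negative, Hepzibah wins this sum of two numbers moving first; added to [l - y],
    which she wins moving second, it gives [l - x] after [y] and [- y] are cancelled. *)
Lemma bounded_fst_win l x y : bounded l y -> (y < x)%coqZ ->
  fwin Hepzibah (l ++ nums prec [:: - x]%coqZ).
Proof.
move=> h hx.
have [|l' [mv h' _]] := @nums_tempo S Hepzibah prec [:: y; (- x)%coqZ].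
  by rewrite /sgn /zsum /=; lia.
apply: (@fst_win_cut _ _ _ _ (nums prec [:: (- y)%coqZ; y])); last first.
  by apply: nums_snd_win; rewrite /sgn /zsum /=; lia.
have w := FstWin mv (nums_snd_win _ prec h').
apply: fst_win_perm (fst_win_cat w h).
refine (Permutation_trans (Permutation_app_comm (nums prec [:: y; - x]%coqZ) _) _).
rewrite -[List.app _ _]/(_ ++ _) -!catA; apply: Permutation_app_head.
exact: (Permutation_app_comm (nums prec [:: - y; y]%coqZ) (nums prec [:: - x]%coqZ)).
Qed.

Lemma bounded_le l x y : bounded l x -> (x <= y)%coqZ -> bounded l y.
Proof. by move=> h hy; apply: swin_bounded h _; rewrite /zsum /=; lia. Qed.

Lemma bounded_cat l m x y : bounded l x -> bounded m y -> bounded (l ++ m) (x + y).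
Proof.
move=> h1 h2; apply: (@swin_bounded _ [:: - x; - y]%coqZ); last by rewrite /zsum /=; lia.
apply: snd_win_perm (snd_win_cat h1 h2).
rewrite -!catA; apply: Permutation_app_head.
exact: (Permutation_app_swap_app (nums prec [:: - x]%coqZ) m (nums prec [:: - y]%coqZ)).
Qed.

Lemma bounded_num l x z : bounded l x -> bounded (Tree (num prec z) :: l) (z + x).
Proof.
apply: (@bounded_cat [:: Tree (num prec z)]).
by apply: (@nums_snd_win _ _ _ [:: z; - z]%coqZ); rewrite /sgn /zsum /=; lia.
Qed.

Lemma bounded_lor a b l x : vsep a b -> bounded (Board a :: Board b :: l) x ->
  bounded (Board (N.lor a b) :: l) x.
Proof. exact: snd_win_lor. Qed.

Lemma bounded_shift s e l x : bounded (Board e :: l) x -> bounded (Board (N.shiftl e s) :: l) x.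
Proof. exact: snd_win_shift. Qed.

(** Reversing the numbering, [k] to [L - k], is a half turn of the board; it respects both kinds of
    adjacency for every [S]. The condition [k <= L] keeps the truncated subtraction exact. *)
Definition mirror (L e e' : N) := forall k, N.testbit e k -> (k <= L)%num /\ N.testbit e' (N.sub L k).

Definition mirrored (L e e' : N) := mirror L e e' /\ mirror L e' e.

Lemma mirror_clear2 L e e' k l : (k <= L)%num -> (l <= L)%num -> mirrored L e e' ->
  mirrored L (clear2 e k l) (clear2 e' (N.sub L l) (N.sub L k)).
Proof.
move=> hk hl [h1 h2]; split=> i; rewrite !clear2E => /and3P[h ki li].
  have [iL h'] := h1 i h; split=> //; apply/and3P; split=> //; lia.
have [iL h'] := h2 i h; split=> //; apply/and3P; split=> //; lia.
Qed.

Lemma mirrored_sym L e e' : mirrored L e e' -> mirrored L e' e.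
Proof. by case. Qed.

Lemma cmove_mirror p L e e' c : mirrored L e e' -> cmove S p (Board e) c ->
  exists2 f, cmove S p (Board e') (Board f) & exists2 d, c = Board d & mirrored L d f.
Proof.
move=> m [k [hk hk' ->]].
have [kL h1] := m.1 _ hk; have [kL' h2] := m.1 _ hk'.
(* The half turn exchanges the two ends of a domino, so the image starts at the image of the second
   cell. *)
exists (clear2 e' (N.sub L (N.add k (stp S p))) (N.sub L k)).
  exists (N.sub L (N.add k (stp S p))); split=> //; last by congr (Board (clear2 _ _ _)); lia.
  by move: h1; congr (is_true (N.testbit _ _)); lia.
by exists (clear2 e k (N.add k (stp S p))) => //; apply: mirror_clear2.
Qed.

Lemma snd_win_mirror p L e e' l : mirrored L e e' -> swin p (Board e :: l) -> swin p (Board e' :: l).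
Proof.
move=> + hm; move E: (_ :: l) hm => m hm; move: m hm e e' l E.
apply: (snd_win_mind (p := p)
  (P := fun m => forall e e' l, Board e :: l = m -> mirrored L e e' -> swin p (Board e' :: l))
  (P0 := fun m => forall e e' l, Board e :: l = m -> mirrored L e e' -> fwin p (Board e' :: l))).
- move=> m _ IH e e' l E h; rewrite -{m}E in IH.
  split=> l' mv0; case: (pmove_consP mv0) => [] [c' mv ->] {mv0}.
    have [f mf [d -> hd]] := cmove_mirror (mirrored_sym h) mv.
    by apply: (IH (Board f :: l) _ _ _ _ erefl (mirrored_sym hd)); apply: pmove_cons.
  by apply: (IH (Board e :: c') _ _ _ _ erefl h); apply: pmove_tail.
- move=> m m' mv _ IH e e' l E h; rewrite -{m}E in mv.
  case: (pmove_consP mv) => {mv} [[c mv E] | [l' mv E]].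
    have [f mf [d hc hd]] := cmove_mirror h mv; rewrite hc in E.
    by apply: (FstWin _ (IH _ _ _ (esym E) hd)); apply: pmove_cons.
  by apply: (FstWin _ (IH _ _ _ (esym E) h)); apply: pmove_tail.
Qed.

(** Vera has no vertical domino to place, so Hepzibah wins moving second without placing one
    herself. *)
Lemma bounded_barren e : N.land e (N.shiftr e 1) = 0%num -> bounded [:: Board e] 0.
Proof.
move=> h; apply: (@snd_win_cat _ _ _ [:: Board e]); last exact: (@nums_snd_win _ _ _ [:: 0%coqZ]).
split=> l' mv; case: (pmove_consP mv) => [[c' [k [/= h1 h2 _]] _]|[l2 /pmove_nil]] //.
suff : N.testbit 0 k by [].
by rewrite -h N.land_spec N.shiftr_spec' h1 h2.
Qed.

End Bounds.

(** * Certificates *)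

(* A bound for a position, to be derived from bounds for smaller positions. *)
Record entry := Entry { en_board : N; en_trees : seq tk; en_bound : Z }.

Definition table := PositiveMap.t (seq (seq tk * Z)).

(** The key is the successor of the board, because keys are positive and the empty set of cells
    occurs as a board. *)
Definition add_entry (T : table) (e : entry) : table :=
  let k := N.succ_pos (en_board e) in
  let l := if PositiveMap.find k T is Some l then l else [::] in
  PositiveMap.add k ((en_trees e, en_bound e) :: l) T.

Definition table_of (es : seq entry) : table := foldl add_entry (PositiveMap.empty _) es.

Fixpoint assoc_tks (ts : seq tk) (l : seq (seq tk * Z)) : option Z :=
  if l is (us, x) :: l' then if tks_eqb us ts then Some x else assoc_tks ts l' else None.

Fixpoint odd_part (p : positive) : positive * N :=
  if p is xO q then let: (r, s) := odd_part q in (r, N.succ s) else (p, 0%num).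

(** The canonical translate, with cell 0 empty, together with the translation. *)
Definition normalize (e : N) : N * N :=
  if e is Npos p then let: (q, s) := odd_part p in (Npos q, s) else (0%num, 0%num).

Fixpoint rev_pos (p : positive) (acc : N) : N :=
  match p with
  | xH => N.succ_double acc
  | xO q => rev_pos q (N.double acc)
  | xI q => rev_pos q (N.succ_double acc)
  end.

Definition rev_bits (e : N) : N := if e is Npos p then rev_pos p 0 else 0%num.

Section Check.

Variable S : N.
Variable T : table.

Definition find_entry (e : N) (ts : seq tk) : option Z :=
  if PositiveMap.find (N.succ_pos e) T is Some l then assoc_tks ts l else None.

(** One entry serves all translates of a position and of its half turn. Boards without a move for
    Vera need no entry. *)
Definition lookup (e : N) (ts : seq tk) : option Z :=
  let e' := (normalize e).1 in
  if find_entry e' ts is Some x then Some x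
  else if find_entry (rev_bits e') ts is Some x then Some x
  else if nilp ts && N.eqb (N.land e (N.shiftr e 1)) 0 then Some 0%coqZ else None.

Definition neighbours (e : N) : N :=
  N.lor (N.lor (N.shiftl e 1) (N.shiftr e 1)) (N.lor (N.shiftl e S) (N.shiftr e S)).

Fixpoint flood (fuel : nat) (c e : N) : N :=
  if fuel is n.+1 then
    let c' := N.land e (N.lor c (neighbours c)) in
    if N.eqb c c' then c else flood n c' e
  else c.

Definition oadd (a b : option Z) := if (a, b) is (Some x, Some y) then Some (x + y)%coqZ else None.
Definition omin (a b : option Z) :=
  match a, b with Some x, Some y => Some (Z.min x y) | Some x, None => Some x | None, _ => b end.

(* Any subset of [e] would be sound: [bounds_comps] checks that it is separated from the rest. *)
Definition component (e : N) : N := N.land e (flood 100 (N.shiftl 1 (normalize e).2) e).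

(* Bounds for the board alone and for the board together with the trees [ts]. *)
Fixpoint bounds_comps (fuel : nat) (e : N) (ts : seq tk) : option Z * option Z :=
  if N.eqb e 0 then (Some 0%coqZ, lookup 0 ts) else
  if fuel is n.+1 then
    let c := component e in
    let r := N.ldiff e c in
    if vsep c r then
      let: (p, q) := bounds_comps n r ts in
      let b := lookup c [::] in
      (oadd b p, omin (oadd b q) (oadd (lookup c ts) p))
    else (None, None)
  else (None, None).

Definition numeric (t : tk) : bool := if t is TN _ then true else false.
Definition value (t : tk) : Z := if t is TN z then z else 0%coqZ.

(** Trees that have been played down to numbers contribute their exact value; only the remaining hot
    ones take part in the look-up. *)
Definition bound (e : N) (ts : seq tk) : option Z :=
  let hot := filter (predC numeric) ts in
  let z := zsum (map value ts) in
  let: (p, q) := bounds_comps 100 e hot in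
  oadd (Some z) (if hot is [::] then p else q).

Definition at_most (e : N) (ts : seq tk) (x : Z) : bool :=
  if bound e ts is Some y then Z.leb y x else false.

Fixpoint bits_from (i : N) (p : positive) : seq N :=
  match p with
  | xH => [:: i]
  | xO q => bits_from (N.succ i) q
  | xI q => i :: bits_from (N.succ i) q
  end.

Definition bits (e : N) : seq N := if e is Npos p then bits_from 0 p else [::].

Definition moves (p : player) (e : N) (ts : seq tk) : seq (N * seq tk) :=
  [seq (clear2 e k (N.add k (stp S p)), ts) | k <- bits (N.land e (N.shiftr e (stp S p)))] ++
  flatten [seq (if nth (TN 0) ts i is TS l r
                then [:: (e, set_nth (TN 0) ts i (if p is Vera then l else r))] else [::])
          | i <- iota 0 (size ts)].

(* Unlike [has], [find] stops at the first success under call by value. *)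
Definition search (A : Type) (a : pred A) (s : seq A) : bool := find a s < size s.

Definition reaches (e : N) (ts : seq tk) (x : Z) : bool :=
  search (fun m => at_most m.1 m.2 x) (moves Hepzibah e ts).

(** Bounds a board by the sum of two parts, as [snd_win_lor] allows. Both parts must be nonempty:
    their measure is then smaller than that of [e], so that an entry cannot justify itself. *)
Definition splits (e : N) (x : Z) : bool :=
  search (fun k => let a := N.land e (N.ones k) in let b := N.ldiff e a in
    if [&& ~~ N.eqb a 0, ~~ N.eqb b 0 & vsep a b] then
      if oadd (bound a [::]) (bound b [::]) is Some y then Z.leb y x else false
    else false) (bits e).

(* Hepzibah needs no answer to a move of Vera that makes the bound smaller. If the bound is
   not a nonnegative integer, then Vera can also move in the number added to the position. *)
Definition check_entry (en : entry) : bool :=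
  let: Entry e ts x := en in
  if nilp ts && splits e x then true else
  [&& all (fun t => ~~ numeric t) ts,
      all (fun m => if at_most m.1 m.2 (x - 1) then true else reaches m.1 m.2 x) (moves Vera e ts) &
      if vera_opt prec (- x)%coqZ is Some z then reaches e ts (- z)%coqZ else true].

End Check.

Definition check (S : N) (es : seq entry) : bool :=
  let T := table_of es in all (check_entry S T) es.

Lemma find_table_of es k ts x :
  (if PositiveMap.find k (table_of es) is Some l then assoc_tks ts l else None) = Some x ->
  exists2 e, N.succ_pos e = k & List.In (Entry e ts x) es.
Proof.
rewrite /table_of -[es]revK foldl_rev.
elim: (rev es) => [|[e us y] r IH] /=; first by rewrite PositiveMap.gempty.
have mono e' : N.succ_pos e' = k -> List.In (Entry e' ts x) (rev r) ->
  exists2 e0, N.succ_pos e0 = k & List.In (Entry e0 ts x) (rev (Entry e us y :: r)).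
  by move=> h1 h2; exists e' => //; rewrite rev_cons -cats1; apply: List.in_or_app; left.
rewrite /add_entry /=; have [Ek|ne] := Pos.eq_dec (N.succ_pos e) k; last first.
  by rewrite PositiveMap.gso; [case/IH=> e'; apply: mono | apply/nesym].
move: mono IH; rewrite -{}Ek => mono IH.
rewrite PositiveMap.gss /=; case: ifP => [/tks_eqbP <- [<-] | _].
  by exists e => //; rewrite rev_cons -cats1; apply: List.in_or_app; right; left.
by case: PositiveMap.find IH => [l|] //= IH /IH[e']; apply: mono.
Qed.

Lemma odd_partP p : let: (q, s) := odd_part p in Npos p = N.shiftl (Npos q) s.
Proof.
elim: p => // p; rewrite [odd_part _~0]/=; case: odd_part => q s E.
by rewrite N.shiftl_mul_pow2 N.pow_succ_r' N.mul_shuffle3 -N.shiftl_mul_pow2 -E.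
Qed.

Lemma normalizeP e : e = N.shiftl (normalize e).1 (normalize e).2.
Proof. by case: e => // p; have := odd_partP p; rewrite /=; case: odd_part. Qed.

Lemma testbit_rev_pos p acc k :
  N.testbit (rev_pos p acc) k =
  if N.ltb k (Npos (Pos.size p)) then N.testbit (Npos p) (N.pos (Pos.size p) - 1 - k)
  else N.testbit acc (k - N.pos (Pos.size p)).
Proof.
have tS a b (i : N) : N.testbit (if b then N.succ_double a else N.double a) i =
    if N.eqb i 0 then b else N.testbit a (N.pred i).
  case: N.eqb_spec => [->|i0].
    by case: b; rewrite ?N.succ_double_spec ?N.double_spec ?N.testbit_odd_0 ?N.testbit_even_0.
  have {1}-> : i = N.succ (N.pred i) by lia.
  by case: b; rewrite ?N.succ_double_spec ?N.double_spec ?N.testbit_odd_succ ?N.testbit_even_succ //; lia.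
have step (q : positive) b a0 j : (forall acc k, N.testbit (rev_pos q acc) k =
    if N.ltb k (Npos (Pos.size q)) then N.testbit (Npos q) (N.pos (Pos.size q) - 1 - k)
    else N.testbit acc (k - N.pos (Pos.size q))) ->
    N.testbit (rev_pos q (if b then N.succ_double a0 else N.double a0)) j =
    if N.ltb j (N.succ (Npos (Pos.size q))) then
      N.testbit (if b then N.succ_double (Npos q) else N.double (Npos q)) (N.pos (Pos.size q) - j)
    else N.testbit a0 (j - N.succ (N.pos (Pos.size q))).
  move=> IH; rewrite IH !tS.
  do ![case: N.ltb_spec => ? | case: N.eqb_spec => ?] => //; try lia; congr (N.testbit _ _); lia.
have E (q : positive) : N.sub (N.pos (Pos.succ q)) 1 = N.pos q by lia.
elim: p acc k => [p IH|p IH|] acc k.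
- by rewrite -[Pos.size _]/(Pos.succ (Pos.size p)) E; exact: (step p true acc k IH).
- by rewrite -[Pos.size _]/(Pos.succ (Pos.size p)) E; exact: (step p false acc k IH).
- by rewrite -[rev_pos _ _]/(N.succ_double acc) (tS acc true); case: k => [|[k|k|]].
Qed.

Lemma testbit_size p k : N.testbit (Npos p) k -> (k < N.pos (Pos.size p))%num.
Proof.
move=> h; case: (N.le_gt_cases (N.pos (Pos.size p)) k) => // le.
rewrite N.bits_above_log2 // in h.
have := N.size_log2 (Npos p) ltac:(by []); rewrite /N.size; lia.
Qed.

Lemma mirrored_rev e : e <> 0%num -> exists L, mirrored L (rev_bits e) e.
Proof.
case: e => // p _; exists (N.pos (Pos.size p) - 1)%num; split=> k.
  rewrite /rev_bits testbit_rev_pos N.bits_0; case: N.ltb_spec => // h h'.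
  by split; first lia.
move/[dup] => h /testbit_size hk; rewrite /rev_bits testbit_rev_pos.
split; first lia.
case: N.ltb_spec => [_|]; last lia.
by move: h; congr (is_true (N.testbit _ _)); lia.
Qed.

Definition tks_size (ts : seq tk) : nat := sumn (map tk_size ts).

Lemma in_bits_from p i k :
  List.In k (bits_from i p) <-> (i <= k)%num /\ N.testbit (Npos p) (N.sub k i).
Proof.
elim: p i => [p IH|p IH|] i.
- rewrite [bits_from _ _]/=; split=> [[<-|/IH[h b]]|[h b]].
  + by rewrite N.sub_diag; split; [lia|].
  + split; first lia.
    rewrite (_ : N.sub k i = N.succ (N.sub k (N.succ i))); last lia.
    by rewrite -[N.pos p~1]/(N.succ_double (Npos p)) N.succ_double_spec N.testbit_odd_succ //; lia.
  + have [<-|ne] := N.eq_dec i k; [by left | right].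
    apply/IH; split; first lia.
    rewrite (_ : N.sub k i = N.succ (N.sub k (N.succ i))) in b; last lia.
    by rewrite -[N.pos p~1]/(N.succ_double (Npos p)) N.succ_double_spec N.testbit_odd_succ // in b; lia.
- rewrite [bits_from _ _]/=; split=> [/IH[h b]|[h b]].
  + split; first lia.
    rewrite (_ : N.sub k i = N.succ (N.sub k (N.succ i))); last lia.
    by rewrite -[N.pos p~0]/(N.double (Npos p)) N.double_spec N.testbit_even_succ //; lia.
  + have [E|ne] := N.eq_dec i k; first by rewrite E N.sub_diag in b.
    apply/IH; split; first lia.
    rewrite (_ : N.sub k i = N.succ (N.sub k (N.succ i))) in b; last lia.
    by rewrite -[N.pos p~0]/(N.double (Npos p)) N.double_spec N.testbit_even_succ // in b; lia.
- rewrite /=; split=> [[<-|//]|[h b]]; first by rewrite N.sub_diag; split; [lia|].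
  by left; case E: (N.sub k i) b => [|[]] //; lia.
Qed.

Lemma in_bits e k : List.In k (bits e) <-> N.testbit e k.
Proof.
case: e => [|p] /=; first by split.
rewrite in_bits_from N.sub_0_r; split=> [[]//|h]; split=> //; lia.
Qed.

Lemma NoDup_bits e : List.NoDup (bits e).
Proof.
case: e => [|p] /=; first exact: List.NoDup_nil.
elim: p 0%num => [p IH|p IH|] i /=; [|exact: IH|].
  by apply: List.NoDup_cons => // /in_bits_from[]; lia.
by apply: List.NoDup_cons; [case | exact: List.NoDup_nil].
Qed.

Definition popcount (e : N) : nat := size (bits e).

Lemma popcount_inj (g : N -> N) a b :
  (forall k, N.testbit a k -> N.testbit b (g k)) ->
  (forall k l, N.testbit a k -> N.testbit a l -> g k = g l -> k = l) ->
  popcount a <= popcount b.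
Proof.
move=> sub inj; rewrite /popcount -(size_map g); apply/leP.
apply: List.NoDup_incl_length.
  elim: (bits a) (fun k => (in_bits a k).1) (NoDup_bits a) => [|k l IH] hl nd; first exact: List.NoDup_nil.
  inversion nd as [|x y nk nl E]; apply: List.NoDup_cons; last by apply: IH => // j hj; apply: hl; right.
  move=> /List.in_map_iff[j [E2 hj]]; apply: nk.
  by rewrite -(inj j k) //; apply: hl; [right | left].
by move=> _ /List.in_map_iff[k [<- /in_bits h]]; apply/in_bits/sub.
Qed.

Lemma popcount_sub a b : (forall k, N.testbit a k -> N.testbit b k) -> popcount a <= popcount b.
Proof. by move=> h; apply: (@popcount_inj id). Qed.

Lemma popcount_lt a b i : (forall k, N.testbit a k -> N.testbit b k) ->
  N.testbit b i -> ~~ N.testbit a i -> popcount a < popcount b.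
Proof.
move=> sub bi ai; apply/leP; apply: (List.NoDup_incl_length (l := i :: bits a)).
  by apply: List.NoDup_cons (NoDup_bits a); rewrite in_bits; apply/negP.
by move=> k [<-|/in_bits /sub]; rewrite in_bits.
Qed.

Lemma popcount_clear2 e k l : N.testbit e k -> popcount (clear2 e k l) < popcount e.
Proof.
move=> h; apply: popcount_lt h _ => [i|]; first by rewrite clear2E => /andP[].
by rewrite clear2E N.eqb_refl /= andbF.
Qed.

(** It decreases with every move on the board or in a tree and with every proper cut. The induction
    on it allows entries to rest on each other in any order in the table. *)
Definition measure (e : N) (ts : seq tk) : nat := popcount e + tks_size ts.

(** * Soundness of the certificates *)

Section Soundness.

Variables (S : N) (es : seq entry) (n : nat).

Local Notation T := (table_of es).
Local Notation bounded := (bounded S).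

(** The induction hypothesis of [check_sound]. The lemmas that assume [measure < n] look up the
    position itself; those that assume [measure <= n] first make a move or a cut. *)
Hypothesis table_ok : forall e ts x, List.In (Entry e ts x) es -> measure e ts < n ->
  bounded (Board e :: trees ts) x.

Lemma find_entryP e ts x : find_entry T e ts = Some x -> measure e ts < n ->
  bounded (Board e :: trees ts) x.
Proof.
move=> /find_table_of[e' E /table_ok].
by have -> // : e' = e by have := f_equal Npos E; rewrite !N.succ_pos_spec; lia.
Qed.

Lemma popcount_normalize e : popcount (normalize e).1 <= popcount e.
Proof.
apply: (@popcount_inj (fun k => N.add k (normalize e).2)) => [k|k l _ _]; last lia.
by move=> h; rewrite [X in N.testbit X _](normalizeP e) testbit_shiftlD.
Qed.

Lemma popcount_mirror L a b : mirror L a b -> popcount a <= popcount b.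
Proof.
move=> m; apply: (@popcount_inj (fun k => N.sub L k)) => [k /m[]//|k l /m[h _] /m[h' _]]; lia.
Qed.

Lemma lookupP e ts x : lookup T e ts = Some x -> measure e ts < n ->
  bounded (Board e :: trees ts) x.
Proof.
rewrite /lookup => h m; rewrite [e]normalizeP.
have le := popcount_normalize e.
case E: find_entry h => [y|].
  case=> <-; apply: bounded_shift; apply: (find_entryP E).
  by move: m; rewrite /measure; lia.
case E': find_entry => [y|].
  case=> <-; apply: bounded_shift.
  have [e0|ne] := N.eq_dec (normalize e).1 0.
    by move: E'; rewrite e0 -[rev_bits 0]/0%num -e0 E.
  have [L mir] := mirrored_rev ne.
  apply: (snd_win_mirror mir).
  apply: (find_entryP E'); move: m; rewrite /measure.
  by have := popcount_mirror mir.1; lia.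
rewrite -normalizeP; case: ifP => // /andP[/nilP -> /N.eqb_eq h] [<-].
exact: bounded_barren.
Qed.

Lemma componentE e : component S e = N.land e (flood S 100 (N.shiftl 1 (normalize e).2) e).
Proof. by []. Qed.

Local Opaque component.

Lemma bounds_compsP f e ts p q : bounds_comps S T f e ts = (p, q) -> measure e ts < n ->
  (forall x, p = Some x -> bounded [:: Board e] x) /\
  (forall x, q = Some x -> bounded (Board e :: trees ts) x).
Proof.
elim: f e p q => [|f IHf] e p q /=; case: N.eqb_spec => [-> [<- <-] m|_] //.
- split=> [x [<-]|x h]; first exact: bounded_barren.
  exact: lookupP h m.
- by case=> <- <-.
- split=> [x [<-]|x h]; first exact: bounded_barren.
  exact: lookupP h m.
set c := component _ e; set r := N.ldiff e c.
case: ifP => [sep|_ [<- <-] //].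
case E: bounds_comps => [p' q'] [<- <-] m.
have ce : popcount c <= popcount e by apply: popcount_sub => k; rewrite /c componentE N.land_spec => /andP[].
have re : popcount r <= popcount e by apply: popcount_sub => k; rewrite N.ldiff_spec => /andP[].
have lor : e = N.lor c r.
  apply: N.bits_inj => i; rewrite N.lor_spec N.ldiff_spec.
  rewrite /c componentE N.land_spec; move: (N.testbit (flood _ _ _ _) i) => b.
  by case: (N.testbit e i); case: b.
have mr : measure r ts < n by move: m; rewrite /measure; lia.
have mc : measure c ts < n by move: m; rewrite /measure; lia.
have mc0 : measure c [::] < n by move: m; rewrite /measure /tks_size /=; lia.
have [h1 h2] := IHf _ _ _ E mr.
rewrite lor; split=> x.
  case El: (lookup T c [::]) => [y|] //; case: p' E h1 => [z|] // E h1 [<-].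
  apply: bounded_lor sep _; apply: (@bounded_cat S [:: Board c]) (h1 _ erefl).
  exact: (lookupP El mc0).
have A y z : lookup T c [::] = Some y -> q' = Some z ->
    bounded (Board (N.lor c r) :: trees ts) (y + z).
  move=> El Eq; apply: bounded_lor sep _; apply: (@bounded_cat S [:: Board c]) (h2 _ Eq).
  exact: (lookupP El mc0).
have B y z : lookup T c ts = Some y -> p' = Some z ->
    bounded (Board (N.lor c r) :: trees ts) (y + z).
  move=> El Eq; apply: bounded_lor sep _.
  apply: (bounded_perm (l := (Board c :: trees ts) ++ [:: Board r])).
    exact: (perm_skip _ (Permutation_sym (Permutation_cons_append (trees ts) (Board r)))).
  by apply: bounded_cat (lookupP El mc) (h1 _ Eq).
case: (lookup T c [::]) A => [y|] A; case: (lookup T c ts) B => [y'|] B;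
  case: q' A {E h2} => [z|] A; case: p' B {h1} => [z'|] B //= [<-];
  try exact: A; try exact: B.
case: (Z.min_spec (y + z) (y' + z')) => [[_ ->]|[_ ->]]; [exact: A | exact: B].
Qed.

Lemma boundP e ts x : bound S T e ts = Some x -> measure e ts < n ->
  bounded (Board e :: trees ts) x.
Proof.
rewrite /bound; set hot := filter _ _; case E: bounds_comps => [p q] h m.
have mh : measure e hot < n.
  apply: leq_ltn_trans m; rewrite /measure leq_add2l /tks_size /hot.
  by elim: (ts) => //= t s; case: t => [z|l r] /=; rewrite ?leq_add2l.
have [h1 h2] := bounds_compsP E mh.
have {h1 h2 h} [y hx hy] : exists2 y, x = (zsum (map value ts) + y)%coqZ & bounded (Board e :: trees hot) y.
  case: (hot) h h1 h2 => [|t s] h h1 h2.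
    by case: p {E} h h1 => // y [<-] h1; exists y => //; apply: h1.
  by case: q {E} h h2 => // y [<-] h2; exists y => //; apply: h2.
rewrite {}hx; move: hy; rewrite -(cat1s (Board e) (trees hot)) -(cat1s (Board e) (trees ts)) /hot.
elim: (ts) [:: Board e] y => [|t s IHs] l y; first by rewrite Z.add_0_l.
case: t => [z|a b] /=; last first.
  by rewrite -[_ :: trees [seq _ <- _ | _]]cat1s -[_ :: trees s]cat1s !catA => /IHs.
move/IHs => h'; rewrite -Z.add_assoc.
by apply: (bounded_perm (Permutation_middle _ _ _)); apply: bounded_num.
Qed.

Lemma nth_TS_lt ts i l r : nth (TN 0) ts i = TS l r -> i < size ts.
Proof. by case: (ltnP i (size ts)) => // h; rewrite nth_default. Qed.

Lemma pmove_trees p ts i l r : nth (TN 0) ts i = TS l r ->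
  pmove (cmove S) p (trees ts) (trees (set_nth (TN 0) ts i (if p is Vera then l else r))).
Proof.
elim: ts i => [|t ts IH] [|i] //= E; last by apply: pmove_tail; apply: IH.
by apply: pmove_cons; rewrite E; eexists; last reflexivity; case: (p); left.
Qed.

Lemma pmove_treesP p ts m : all (predC numeric) ts -> pmove (cmove S) p (trees ts) m ->
  exists i l r, nth (TN 0) ts i = TS l r /\
    m = trees (set_nth (TN 0) ts i (if p is Vera then l else r)).
Proof.
elim: ts m => [|t ts IH] m /=; first by move=> _ /pmove_nil.
move=> /andP[nt /IH{}IH] mv.
case: (@pmove_consP _ _ _ (Tree (tree t)) (trees ts) m mv) => [[c [g hg ->] ->]|[l2 /IH[i [l [r [E ->]]]] ->]].
  case: t nt hg {mv} => // l r _ hg; exists 0, l, r; split=> //=; congr (Tree _ :: _).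
  by case: p hg {IH} => /= -[].
by exists i.+1, l, r.
Qed.

Lemma tks_size_set ts i l r p : nth (TN 0) ts i = TS l r ->
  tks_size (set_nth (TN 0) ts i (if p is Vera then l else r)) < tks_size ts.
Proof.
rewrite /tks_size; elim: ts i => [|t ts IH] [|i] //= E.
  by rewrite E ltn_add2r /=; case: (p); lia.
by rewrite ltn_add2l; apply: IH.
Qed.

Local Notation fwin := (fst_win (cmove S)).

Lemma at_mostP e ts x : at_most S T e ts x -> measure e ts < n ->
  bounded (Board e :: trees ts) x.
Proof.
rewrite /at_most; case E: bound => [y|] // /Z.leb_le hy m.
exact: bounded_le (boundP E m) hy.
Qed.

Lemma in_moves p e ts m : List.In m (moves S p e ts) ->
  measure m.1 m.2 < measure e ts /\
  pmove (cmove S) p (Board e :: trees ts) (Board m.1 :: trees m.2).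
Proof.
move=> h; case: (List.in_app_or _ _ _ h) => {h} [/List.in_map_iff[k [<- /in_bits]]|].
  rewrite N.land_spec N.shiftr_spec' => /andP[h1 h2]; split; last by apply: pmove_cons; exists k.
  by rewrite /measure ltn_add2r; apply: popcount_clear2.
case/List.in_concat=> l [/List.in_map_iff[i [<- _]]].
case E: (nth _ ts i) => [|a b] //= -[] // <-; split; last exact/pmove_tail/pmove_trees.
by rewrite /measure ltn_add2l; apply: tks_size_set.
Qed.

Lemma reachesP e ts x : reaches S T e ts x -> measure e ts <= n ->
  fwin Hepzibah (Board e :: trees ts ++ nums prec [:: - x]%coqZ).
Proof.
rewrite /reaches /search -has_find => h m.
suff [e' [ts' [h1 h2]]] : exists e' ts', List.In (e', ts') (moves S Hepzibah e ts) /\ at_most S T e' ts' x.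
  have [m' mv] := in_moves h1.
  by apply: FstWin (at_mostP h2 (leq_trans m' m)); exact: (pmove_catl _ mv).
elim: (moves _ _ _ _) h => //= -[e' ts'] l IHl /orP[h|/IHl[e2 [ts2 [h1 h2]]]].
  by exists e', ts'; split=> //; left.
by exists e2, ts2; split=> //; right.
Qed.

Lemma splitsP e x : splits S T e x -> measure e [::] <= n -> bounded [:: Board e] x.
Proof.
rewrite /splits /search -has_find => /hasP[k _]; set a := N.land e _; set b := N.ldiff e a.
case: ifP => // /and3P[a0 b0 sep].
case Ea: (bound _ _ a _) => [y|] //.
case Eb: (bound _ _ b _) => [z|] // /Z.leb_le hx m.
have lor : e = N.lor a b.
  apply: N.bits_inj => i; rewrite N.lor_spec N.ldiff_spec.
  by rewrite /a N.land_spec; case: (N.testbit e i) => //=; case: (N.testbit _ i).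
have ex c : ~~ N.eqb c 0 -> exists i, N.testbit c i.
  by move/N.eqb_spec => hc; exists (N.log2 c); exact: N.bit_log2.
have sa i : N.testbit a i -> N.testbit e i by rewrite N.land_spec => /andP[].
have sb i : N.testbit b i -> N.testbit e i by rewrite N.ldiff_spec => /andP[].
have dis i : ~~ (N.testbit a i && N.testbit b i) by case: (vsepP _ _ sep i).
have ma : measure a [::] < n.
  have [i bi] := ex _ b0; apply: leq_trans m; rewrite /measure ltn_add2r.
  by apply: popcount_lt sa (sb _ bi) _; move: (dis i); rewrite bi andbT.
have mb : measure b [::] < n.
  have [i ai] := ex _ a0; apply: leq_trans m; rewrite /measure ltn_add2r.
  by apply: popcount_lt sb (sa _ ai) _; move: (dis i); rewrite ai.
apply: bounded_le hx; rewrite {}lor; apply: bounded_lor sep _.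
apply: (@bounded_cat S [:: Board a]); [exact: (boundP Ea) | exact: (boundP Eb)].
Qed.

Lemma check_entryP e ts x : check_entry S T (Entry e ts x) -> measure e ts <= n ->
  bounded (Board e :: trees ts) x.
Proof.
rewrite /check_entry; case: ifP => [/andP[/nilP ->] h _|_ /and3P[nt ans tempo] m]; first exact: splitsP.
have answer e' ts' : List.In (e', ts') (moves S Vera e ts) ->
    fwin Hepzibah (Board e' :: trees ts' ++ nums prec [:: - x]%coqZ).
  move=> hin; have [m' _] := in_moves hin; have m2 := leq_trans m' m.
  have : if at_most S T e' ts' (x - 1) then true else reaches S T e' ts' x.
    elim: (moves _ _ _ _) ans hin => //= ? l IHl /andP[h1 h2] [E|/(IHl h2)//].
    by rewrite E in h1.
  case: ifP => [h _|_ h]; last exact: reachesP h (ltnW m2).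
  (* Bounds are integers, so a bound of at most [x - 1] is strictly below [x], and this alone gives
     Hepzibah a winning answer. *)
  by apply: (bounded_fst_win (at_mostP h m2)); lia.
split=> m' mv.
case: (pmove_consP mv) => [[c [k [hk hk' ->]] ->]|[l2 mv2 ->]].
  apply: answer; apply: List.in_or_app; left; apply/List.in_map_iff; exists k; split=> //.
  by apply/in_bits; rewrite N.land_spec N.shiftr_spec' hk.
case: (pmove_catP mv2) => [[l3 /(pmove_treesP nt)[i [l [r [E ->]]]] ->]|[l3 mv3 ->]].
  apply: answer; apply: List.in_or_app; right; apply/List.in_concat.
  exists [:: (e, set_nth (TN 0) ts i l)]; split; last by left.
  apply/List.in_map_iff; exists i; rewrite E; split=> //.
  by apply/List.in_seq; split; [lia | have := nth_TS_lt E; lia].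
(* Vera has moved in the added number, from [- x] to some [z]; the answer must bring the rest to at
   most [- z]. *)
case: (@pmove_consP _ _ _ (Tree (num prec (- x))) [::] _ mv3) => [[c [g hg ->] ->]|[? /pmove_nil]] //.
have [z Ez ->] := vera_optP hg.
by rewrite Ez in tempo; have := reachesP tempo m; rewrite /nums /= Z.opp_involutive.
Qed.

End Soundness.

Theorem check_sound S es e ts x : check S es -> List.In (Entry e ts x) es ->
  bounded S (Board e :: trees ts) x.
Proof.
move=> ok; have [n] := ubnP (measure e ts); elim: n e ts x => // n IH e ts x m hin.
apply: (check_entryP (n := n)); last by exact: m.
  by move=> e' ts' x' hin' m'; apply: IH hin'.
suff main l : all (check_entry S (table_of es)) l ->
    List.In (Entry e ts x) l -> check_entry S (table_of es) (Entry e ts x) by exact: main hin.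
by elim: l => // e' l IHl /andP[ok1 /IHl ok2] [E|//]; rewrite -E.
Qed.

(** * The certificates for the seven heights *)

Section Tables.

Local Open Scope N_scope.

Let R (e : N) (x : Z) := Entry e [::] x.
Let Q (e : N) ts (x : Z) := Entry e ts x.

(** [x7], [x9] and [x11] are upper bounds for the boards of width 2 and heights 7, 9 and 11. In
    units of 1/32, [x7] is the switch [{1/2 | -3/2}]. The games [y7], [y9] and [y11] are their
    negatives, and the other letters name the hot games that are reached from these. *)
Definition x7 := TS (TN 16) (TN (-48)).
Definition y7 := TS (TN 48) (TN (-16)).
Definition a9 := TS (TN 48) (TN 0).
Definition b9 := TS (TN (-16)) (TN (-80)).
Definition x9 := TS a9 b9.
Definition c9 := TS (TN 80) (TN 16).
Definition d9 := TS (TN 0) (TN (-48)).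
Definition y9 := TS c9 d9.
Definition a11 := TS (TN 16) (TN (-32)).
Definition b11 := TS (TN (-48)) (TN (-112)).
Definition c11 := TS a11 b11.
Definition x11 := TS (TN 32) c11.
Definition d11 := TS (TN 112) (TN 48).
Definition e11 := TS (TN 32) (TN (-16)).
Definition f11 := TS d11 e11.
Definition y11 := TS f11 (TN (-32)).

(* Found by computer search. *)
Definition table2 := [::
R 0x3 32;R 0x9 (-32);R 0x49 (-32);R 0x1b 33;R 0x4b (-16);R 0x93 (-16);R 0x249 (-64);R 0x25b 1;
R 0x49b 1;R 0x64b 0;R 0x24c9 (-48);R 0x6db 0;R 0x12db 17;R 0x24db 17;R 0x9369 (-47);R 0x126c9 (-47);
R 0x36db 16;R 0x96db (-32);R 0x126db (-32);R 0x49b69 (-31);R 0x1b6db 32;R 0x4b6db (-16);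
R 0x936db (-16);R 0x24db69 (-80);R 0x25b6db (-15);R 0x49b6db (-15);R 0x12db693 (-64);R 0x6db6db 0;
R 0x12db6db 1;R 0x24db6db 1;R 0x36db6db 16;R 0x96db6db (-48);R 0x126db6db (-48);R 0x4b6db6db (-32);
R 0x25b6db6db (-15);R 0x6db6db6db (-16)].

Definition table3 := [::
R 0x3 32;R 0x11 (-32);R 0x7 32;R 0x111 (-32);R 0x113 (-16);R 0x223 (-16);R 0x1111 (-64);
R 0x1117 (-16);R 0x4447 (-16);R 0x1557 (-56);R 0x4557 (-56);R 0x5577 (-47);R 0x7777 (-48)].

Definition table5 := [::
R 0x3 32;R 0x41 (-32);R 0x7 32;R 0x47 16;R 0x107 16;R 0x1f 64;R 0x1c7 17;R 0x7df (-16)].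

Definition table7 := [::
Q 0x0 [::x7] 17;Q 0x0 [::x7;x7] (-32);Q 0x0 [::y7] 49;R 0x3 32;R 0x101 (-32);R 0x7 32;R 0x103 1;
R 0x203 1;R 0xf 64;R 0x107 16;R 0x407 16;R 0x1f 64;R 0x11f 48;R 0x1c7 48;R 0x41f 48;R 0x707 17;
R 0x101f 48;R 0x1c07 48;R 0x7f 96;Q 0x71f [::y7] 32;Q 0x131f [::y7] 32;Q 0x191f [::y7] 32;
Q 0x1c1f [::y7] 32;R 0x1f1f (-16);Q 0x7f7f [::y7] 0].

Definition table9 := [::
Q 0x0 [::b9] (-15);Q 0x0 [::b9;a9] (-16);Q 0x0 [::a9] 49;Q 0x0 [::x9] 0;Q 0x0 [::b9;x9] (-31);
Q 0x0 [::d9] 1;Q 0x0 [::a9;b9] (-16);Q 0x0 [::x9;x9] (-16);Q 0x0 [::y9] 16;R 0x3 32;R 0x401 (-32);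
R 0x7 32;R 0x403 1;Q 0x403 [::d9] 0;R 0x803 1;Q 0x803 [::d9] 0;R 0xf 64;R 0x407 16;R 0xc03 33;
R 0x1007 16;R 0x1f 64;R 0x40f 33;R 0xc07 33;R 0x1807 33;R 0x200f 33;R 0x3f 96;R 0x41f 48;R 0x707 48;
R 0x101f 48;R 0x1c07 17;R 0x401f 48;R 0x7007 48;R 0x7f 96;R 0x47f 80;R 0x71f 80;R 0x107f 80;
Q 0x1c1f [::c9] 64;R 0x407f 80;Q 0x4c1f [::c9] 64;Q 0x641f [::c9] 64;Q 0x701f [::c9] 64;
R 0x1007f 80;R 0x1c01f 80;R 0x1ff 128;Q 0x1f1f [::d9] 32;Q 0x4f1f [::d9] 32;Q 0x647f [::d9] 32;
Q 0x707f [::d9] 32;R 0x7c1f (-16);R 0x1247f 16;Q 0x1307f [::d9] 32;Q 0x13c79 [::d9] 32;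
Q 0x1e41f [::d9] 32;Q 0x1e44f [::d9] 32;Q 0x1f01f [::d9] 32;Q 0x7c7f [::y9] 32;Q 0x13c7f [::y9] 32;
Q 0x1e47f [::y9] 32;Q 0x1f07f [::y9] 32;Q 0x1fc7f [::c9] 32;Q 0x7fdff [::y9] 0].

Definition table11 := [::
Q 0x0 [::b11] (-47);Q 0x0 [::b11;b11] (-160);Q 0x0 [::b11;a11;c11] (-128);Q 0x0 [::b11;x11] (-80);
Q 0x0 [::b11;c11] (-95);Q 0x0 [::b11;x11;x11] (-63);Q 0x0 [::b11;c11;x11] (-128);
Q 0x0 [::c11;x11] (-15);Q 0x0 [::x11;x11;x11] 17;Q 0x0 [::b11;x11;x11;x11] (-96);Q 0x0 [::a11] 17;
Q 0x0 [::a11;b11] (-80);Q 0x0 [::c11] (-32);Q 0x0 [::a11;c11] (-15);Q 0x0 [::a11;b11;x11] (-63);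
Q 0x0 [::a11;a11] (-16);Q 0x0 [::a11;a11;b11] (-63);Q 0x0 [::a11;a11;a11] 1;
Q 0x0 [::a11;a11;a11;a11] (-32);Q 0x0 [::a11;a11;a11;c11] (-31);Q 0x0 [::a11;a11;c11] (-48);
Q 0x0 [::a11;a11;c11;x11] (-31);Q 0x0 [::a11;c11;x11] (-48);Q 0x0 [::a11;c11;x11;x11] (-31);
Q 0x0 [::e11] 33;Q 0x0 [::c11;x11;x11] (-48);Q 0x0 [::c11;x11;x11;x11] (-31);
Q 0x0 [::x11;x11;x11;x11] (-16);Q 0x0 [::f11] 48;Q 0x0 [::y11] 33;R 0x3 32;R 0x1001 (-32);R 0x7 32;
R 0x1003 1;Q 0x1003 [::e11] 32;Q 0x1003 [::y11] 32;R 0x2003 1;Q 0x2003 [::e11] 32;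
Q 0x2003 [::y11] 32;R 0xf 64;R 0x1007 16;R 0x3003 33;R 0x4007 16;R 0x1f 64;R 0x3007 33;R 0x6007 33;
R 0x3f 96;R 0x101f 48;R 0x1c07 48;R 0x401f 48;R 0x7007 17;Q 0x7007 [::y11] (-16);R 0x900f 0;
Q 0xc00f [::y11] 48;R 0x1001f 48;R 0x1c007 48;R 0x7f 96;R 0x700f 32;R 0xe00f 32;R 0xff 128;
R 0x107f 80;R 0x1c1f 80;R 0x407f 80;Q 0x701f [::d11] 96;Q 0x701f [::y11] 32;R 0x9c0f 32;
R 0x1007f 80;Q 0x1301f [::d11] 96;Q 0x1901f [::d11] 96;Q 0x1c01f [::d11] 96;R 0x3900f 32;
R 0x4007f 80;R 0x7001f 80;R 0x1ff 128;Q 0x7c1f [::e11] 64;Q 0x7c1f [::y11] 64;Q 0x13c1f [::e11] 64;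
Q 0x13c1f [::y11] 64;Q 0x1907f [::e11] 64;Q 0x1907f [::y11] 64;Q 0x19c1f [::y11] 64;
Q 0x1c07f [::e11] 64;Q 0x1c07f [::y11] 64;R 0x1f01f (-16);R 0x4907f 16;Q 0x4c07f [::e11] 64;
Q 0x4c07f [::y11] 64;Q 0x4f079 [::e11] 64;Q 0x4f079 [::y11] 64;Q 0x6107f [::y11] 64;
Q 0x6407f [::y11] 64;Q 0x7007f [::y11] 64;Q 0x7301f [::y11] 64;Q 0x7901f [::e11] 64;
Q 0x7901f [::y11] 64;Q 0x7904f [::e11] 64;Q 0x7904f [::y11] 64;Q 0x7c01f [::e11] 64;
Q 0x7c01f [::y11] 64;R 0x7ff 160;Q 0x1f07f [::f11] 64;Q 0x4f07f [::f11] 64;Q 0x7907f [::f11] 64;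
Q 0x7c07f [::f11] 64;R 0x1091ff 48;R 0x1211ff 48;R 0x1fc7f 64;R 0x4fc7f 64;R 0x791ff 64;
R 0x7c1ff 64;Q 0x7f07f [::d11] 64;R 0x1391ff 49;R 0x13c1ff 64;R 0x13f1f9 64;R 0x1f907f 64;
R 0x1f913f 64;R 0x1fc07f 64;Q 0x7f1ff [::y11] 32;Q 0x13f1ff [::y11] 32;Q 0x19f1ff [::y11] 32;
Q 0x1cf1ff [::y11] 32;Q 0x1e71ff [::y11] 32;Q 0x1f31ff [::y11] 32;Q 0x1f91ff [::y11] 32;
Q 0x1fc1ff [::y11] 32;Q 0x1ff1ff [::f11] 32;Q 0x7ff7ff [::y11] 0].

Definition table4 := [::
R 0x3 32;R 0x21 (-32);R 0x7 32;R 0x23 1;R 0x43 1;R 0x421 (-32);R 0xf 64;R 0x27 16;R 0x63 33;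
R 0x87 16;R 0x231 1;R 0x423 (-16);R 0x431 1;R 0x843 (-16);R 0x8421 (-64);R 0x4f 33;R 0x67 33;
R 0x8f 33;R 0xc7 33;R 0x139 0;R 0x427 0;R 0x439 16;R 0x463 33;R 0x623 0;R 0x847 (-16);R 0x863 33;
R 0xc23 0;R 0x1087 0;R 0x10e1 0;R 0x1843 0;R 0x4231 (-31);R 0x8423 (-31);R 0x8431 (-31);
R 0x8461 (-31);R 0x10843 (-31);R 0x10861 (-31);R 0x108421 (-64);R 0x6f 65;R 0xbd 0;R 0xe7 17;
R 0x12f 0;R 0x13b 17;R 0x18f 65;R 0x42f 16;R 0x43b 33;R 0x4a7 (-24);R 0x84f 16;R 0xc27 24;
R 0x108f 16;R 0x10a7 (-24);R 0x1887 24;R 0x210f 16;R 0x2139 (-24);R 0x3087 24;R 0x8427 (-16);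
R 0x8439 (-16);R 0x8463 1;R 0x84e1 (-16);R 0x8631 0;R 0x10863 1;R 0x108e1 (-31);R 0x18423 0;
R 0x21087 (-16);R 0x210e1 (-24);R 0x84621 (-48);R 0x108423 (-48);R 0x108621 (-48);R 0x210843 (-48);
R 0x2108421 (-96);R 0x16f 32;R 0x1af 32;R 0x4bd 0;R 0x52f (-8);R 0x10bd (-8);R 0x1c27 32;
R 0x212f (-8);R 0x21e9 0;R 0x4627 17;R 0x842f 1;R 0x8539 (-32);R 0x8729 (-32);R 0x8c63 32;
R 0x10c63 32;R 0x4210f 1;R 0x421e1 (-8);R 0x108427 (-32);R 0x108463 1;R 0x108631 (-15);
R 0x108721 (-32);R 0x108c23 (-32);R 0x108c61 (-15);R 0x210863 1;R 0x210c43 (-32);R 0x210c61 (-15);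
R 0x308423 (-32);R 0x421087 (-32);R 0x2108423 (-63);R 0x2108431 (-63);R 0x2108621 (-63);
R 0x2108c21 (-63);R 0x4210843 (-63);R 0x42108421 (-96);R 0x1ef 1;R 0x2f7 1;R 0x5af 17;R 0x9cf 32;
R 0xd2f 16;R 0x10ef 32;R 0x16a7 (-16);R 0x1c2f 56;R 0x1c8f 56;R 0x252f (-32);R 0x25e9 0;
R 0x294f (-32);R 0x312f 16;R 0x318f 97;R 0x84e7 (-15);R 0x852f (-32);R 0x85b9 (-15);R 0x85e9 (-32);
R 0x872d (-15);R 0x8739 1;R 0x1086f 33;R 0x184e3 32;R 0x1884f 32;R 0x18873 32;R 0x18c63 0;
R 0x2118f 33;R 0x217a1 (-32);R 0x31887 49;R 0x4212f (-32);R 0x421e9 (-32);R 0x6210f 32;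
R 0x847a1 (-16);R 0x108639 (-15);R 0x108c63 17;R 0x108ce1 (-15);R 0x109c23 (-8);R 0x210c63 17;
R 0x210e43 (-8);R 0x84210f (-16);R 0x2108439 (-48);R 0x21084e1 (-48);R 0x2108631 (-32);
R 0x2108721 (-48);R 0x2108c61 (-32);R 0x210c621 (-47);R 0x4210863 (-31);R 0x8421087 (-48);
R 0x42108423 (-80);R 0x84210843 (-80);R 0x842108421 (-128);R 0x2d2f 0;R 0x352f 0;R 0x392f 28;
R 0x85eb 0;R 0x85ed 0;R 0x8c6f 64;R 0x9cad (-31);R 0x217a5 (-40);R 0x421ed 0;R 0x4294f (-47);
R 0x4318f 64;R 0x43c27 28;R 0x43d29 (-40);R 0x85e23 0;R 0xc2723 0;R 0x30842f 0;R 0x318463 0;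
R 0x4217a1 (-40);R 0x2108c63 0;R 0x210bc21 (-31);R 0x210c631 (-16);R 0x2118c23 (-16);
R 0x2118c61 (-16);R 0x4210c63 0;R 0x4218c43 (-16);R 0x4218c61 (-16);R 0x6210863 0;
R 0x1084210f (-31);R 0x42108463 (-31);R 0x42108631 (-47);R 0x4210c621 (-47);R 0x42118c21 (-47);
R 0x42308423 (-64);R 0x84210863 (-31);R 0x84210c43 (-64);R 0x84310843 (-64);R 0x842108621 (-95);
R 0x842108c21 (-95);R 0x84210c421 (-95);R 0x1084210843 (-95);R 0xdef 32;R 0x1cef 57;R 0x25ef 1;
R 0x2ded 0;R 0x31ef 32;R 0x3d2f 32;R 0x85ef (-31);R 0x8ded (-31);R 0xa56f (-15);R 0xb52f (-16);
R 0x16a73 (-15);R 0x18c6f 32;R 0x18ce7 (-16);R 0x18e73 (-31);R 0x25ea5 (-64);R 0x276a5 (-47);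
R 0x318e7 (-16);R 0x421ef (-31);R 0x425af (-15);R 0x429cf 0;R 0x42d2f (-16);R 0x4a52f (-64);
R 0x4a5e9 (-64);R 0x4bca5 (-64);R 0x6318f 32;R 0x108c6f 49;R 0x108de9 (-16);R 0x210d2f (-16);
R 0x210f4b (-16);R 0x25e843 (-16);R 0x30852f (-16);R 0x3184e3 0;R 0x318c63 16;R 0x4231e9 (-16);
R 0x4297a1 (-64);R 0x8425e9 (-32);R 0x84294f (-64);R 0x84312f (-16);R 0x978423 (-16);
R 0xc4212f (-16);R 0xc6210f 49;R 0x210852f (-64);R 0x21085e9 (-64);R 0x210872d (-47);
R 0x21097a1 (-64);R 0x210c7a1 (-15);R 0x210f4a1 (-64);R 0x210f621 (-15);R 0x4218c63 (-32);
R 0x4218e43 (-7);R 0x6308463 (-32);R 0x84210e7 (-47);R 0x8431887 1;R 0x1084212f (-64);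
R 0x108421e9 (-64);R 0x1084bc21 (-64);R 0x1086210f 0;R 0x84210c63 (-15);R 0x21084210f (-48);
R 0x842108439 (-80);R 0x842108631 (-64);R 0x842108c61 (-64);R 0x84210c621 (-79);R 0x842118c21 (-79);
R 0x84218c421 (-64);R 0x1084210863 (-63);R 0x1084218843 (-64);R 0x1084218c21 (-79);
R 0x2108421087 (-80);R 0x8def 1;R 0xbd2f 24;R 0xbd6b 25;R 0x139eb (-16);R 0x16f63 1;R 0x42ded (-32);
R 0x431ef 1;R 0x439ed 1;R 0x43d2f 24;R 0x43dad 25;R 0x4a5af (-32);R 0x10bd2b (-36);R 0x118c6f 32;
R 0x118ce7 (-16);R 0x14a7a5 (-79);R 0x21ce63 (-16);R 0x3184e7 (-16);R 0x42f139 1;R 0x843d2b (-32);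
R 0x84bd29 (-72);R 0x86318f 32;R 0x21085ed (-32);R 0x2108c6f 32;R 0x2109cad (-63);R 0x210b539 (-63);
R 0x218c639 (-16);R 0x21cc631 (-16);R 0x2318c27 24;R 0x2318c63 1;R 0x4318c63 1;R 0x611884f 16;
R 0x6308c63 1;R 0x108421ed (-32);R 0x1084294f (-79);R 0x1084318f 32;R 0x1084394b (-63);
R 0x10843d29 (-72);R 0x1886210f 16;R 0x42118c63 (-32);R 0x42308c63 1;R 0x46308463 (-32);
R 0x84218c63 (-32);R 0x84310c63 1;R 0xc6108463 (-32);R 0x842108c63 (-32);R 0x84210c631 (-48);
R 0x84218c621 (-48);R 0x842318c21 (-48);R 0x84310c621 (-48);R 0x843188621 (-48);R 0x846108463 (-32);
R 0x846308423 (-48);R 0x846308461 (-48);R 0x1084210c63 (-32);R 0x1084218863 (-32);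
R 0x1084218c43 (-48);R 0x1086118c21 (-48);R 0x1086210863 (-32);R 0x1086310843 (-48);
R 0x421084210f (-63);R 0x4210843c21 (-72);R 0x10842108631 (-79);R 0x21084210863 (-63);
R 0x210842108621 (-127);R 0x21084210c421 (-127);R 0x210842188421 (-127);R 0x3def 48;R 0xb5ef 0;
R 0x12f7b 1;R 0x18def 33;R 0x19cef 1;R 0x1a5ef 1;R 0x1ad6f (-16);R 0x1ad7b (-16);R 0x2d6e7 (-48);
R 0x42def 0;R 0x4a5ef (-63);R 0x4ad6f 1;R 0x4bd2f 0;R 0x4bdad 1;R 0x4bde3 1;R 0x4bde9 (-63);
R 0x529ef (-63);R 0x52b7b (-63);R 0x5ad2f 1;R 0x5ade3 (-16);R 0x625ef 1;R 0x631ef 33;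
R 0x635af (-16);R 0x639cf 1;R 0x63d2f 49;R 0x6b52f 1;R 0x7a52f 0;R 0xc673b 1;R 0xce17b 1;
R 0xce56b (-56);R 0x10bd2f 0;R 0x129d2f (-32);R 0x12f6a5 (-48);R 0x18c6e7 0;R 0x210def (-15);
R 0x210f7b (-15);R 0x252f4b (-48);R 0x3085ef (-15);R 0x31392f 16;R 0x3184ef 1;R 0x318c6f 48;
R 0x423d2f (-8);R 0x42b5b9 (-31);R 0x42f7a1 (-63);R 0x46b539 (-32);R 0x8425ef (-31);
R 0x8431ef (-15);R 0x843d2f 0;R 0x84b5e9 (-48);R 0x85392f (-32);R 0x85bc63 (-16);R 0x85ec63 (-16);
R 0x94bd23 (-48);R 0x94bd29 (-96);R 0xc421ef (-15);R 0xc6318f 48;R 0xc721e3 1;R 0x21085ef (-63);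
R 0x2109de9 (-63);R 0x210b52f (-48);R 0x210f7a1 (-63);R 0x2118c6f 0;R 0x2118ce7 (-48);
R 0x2118d2f (-15);R 0x2118de9 (-15);R 0x211bda1 (-63);R 0x214bd29 (-96);R 0x214bda1 (-32);
R 0x2178c63 0;R 0x217a529 (-96);R 0x21ce631 (-32);R 0x2718c63 1;R 0x2738463 (-32);R 0x4218c6f 0;
R 0x421ce63 (-48);R 0x421ec63 0;R 0x4398c63 1;R 0x439c863 (-32);R 0x4bd0863 1;R 0x630852f 1;
R 0x6318c27 16;R 0x6318c63 32;R 0x108421ef (-63);R 0x10842d2f (-48);R 0x108439e9 (-63);
R 0x1084bd29 (-96);R 0x108529e9 (-96);R 0x1086312f (-15);R 0x1086318f 0;R 0x108631e9 (-15);
R 0x1086b4e1 (-31);R 0x10878c63 (-16);R 0x1087a529 (-96);R 0x1087bc21 (-63);R 0x10bd2843 (-48);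
R 0x10c694e1 (-32);R 0x4212f621 (-48);R 0x42318c63 (-16);R 0x84318c63 (-16);R 0x843d2843 (-48);
R 0xc4218c63 (-16);R 0xc6108c63 (-16);R 0xc6210c63 (-16);R 0x1084216a7 (-80);R 0x1084297a1 (-96);
R 0x84210f4a1 (-96);R 0x84214bc21 (-96);R 0x8421cc621 (-31);R 0x842318463 (-63);R 0x842718c21 (-31);
R 0x84310c631 (-32);R 0x84318c621 (-80);R 0x846118c61 (-32);R 0x846308463 (-64);R 0x863108631 (-63);
R 0x1084218c63 (-64);R 0x10c6310843 (-32);R 0x21084210e7 (-79);R 0x421084212f (-96);
R 0x42108421e9 (-96);R 0x421087a421 (-96);R 0x21084210c63 (-47);R 0x210842108631 (-96);
R 0x21084210c621 (-111);R 0x21084218c421 (-96);R 0x5bd2f 32;R 0x6bd2f 32;R 0x11ad6f (-16);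
R 0x210bd6b (-7);R 0x217a5e1 (-8);R 0x2318ce7 (-15);R 0x10843dad (-7);R 0x1087a5e1 (-8);
R 0x1087bc61 (-31);R 0x10c6318f 33;R 0x42118c6f 0;R 0x4211bca5 (-63);R 0x463184e3 1;R 0xc2108c6f 33;
R 0x1084217ad (-47);R 0x1084e56a1 (-95);R 0x210863d29 (-63);R 0x217a10863 (-7);R 0x31084318f 33;
R 0x842108c6f 0;R 0x842318c63 (-31);R 0x84272b421 (-95);R 0x84318c631 (-31);R 0x84630842f (-16);
R 0x8c6108c63 (-16);R 0x1084318c63 (-31);R 0x1086218c63 (-31);R 0x1086318863 (-31);
R 0x10c6310863 (-31);R 0x1884218c63 (-31);R 0x421084318f 0;R 0x4210843d29 (-104);
R 0x10846308463 (-64);R 0x108c2108c63 (-31);R 0x108c6108463 (-64);R 0x21084218c621 (-80);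
R 0x421084210c63 (-64);R 0x1084210843c21 (-104);R 0x39def 18;R 0x4bdef 1;R 0x5adef 2;R 0x739ef 18;
R 0x7a5ef 1;R 0x10bdef 16;R 0x14adef (-47);R 0x25ee73 1;R 0x273d2f 32;R 0x423def 16;
R 0x42b5ef (-47);R 0x4ad6e7 (-48);R 0x85ed6b (-48);R 0x211ad6f (-48);R 0x216f4ad (-16);
R 0x217ad63 (-48);R 0x421bd2f 16;R 0x63085ef 2;R 0x630b52f 17;R 0x6318c6f 64;R 0x6318ce7 17;
R 0x6318e73 2;R 0xc6318e7 17;R 0x10863dad (-48);R 0x1087ad63 (-48);R 0x1087bda1 (-32);
R 0x10b78c63 16;R 0x4218f7a1 (-47);R 0x421ef621 (-47);R 0x42f18c63 16;R 0x84318c6f 16;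
R 0x843d8c63 16;R 0xa53d2843 (-80);R 0xc2118c6f 16;R 0xc6108c6f 32;R 0x10842f7a1 (-95);
R 0x1084e56b1 (-64);R 0x1084ed6a1 (-63);R 0x108c6318f 16;R 0x108c637a1 (-48);R 0x210c4bd29 (-80);
R 0x210c784e3 (-31);R 0x210c7bc21 (-47);R 0x210f18c63 16;R 0x318c63087 24;R 0x8421097ad (-64);
R 0x84210f7a1 (-95);R 0x84217bc21 (-95);R 0x84318c7a1 (-36);R 0x84318f4a1 (-47);R 0x843d8c621 (-36);
R 0x84630852f (-47);R 0x8463085e9 (-47);R 0x1084bd8843 (-32);R 0x1086318c63 0;R 0x18c2118c63 1;
R 0x18c4218c63 1;R 0x4210842d2f (-80);R 0x421086318f (-32);R 0x421087bc21 (-95);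
R 0x4210e52c61 (-64);R 0x4210e5ac21 (-63);R 0x4212f18c21 (-47);R 0x4218c63c21 (-48);
R 0x21084318c63 (-48);R 0x2108421097a1 (-128);R 0x21084210c7a1 (-79);R 0x21084210f4a1 (-128);
R 0x21084210f621 (-79);R 0x2108c6108c61 (-95);R 0x211842118c61 (-64);R 0x95aded (-31);
R 0x252f4bd (-40);R 0x1085ed6b (-48);R 0x10f4bd29 (-40);R 0x2109cad63 (-30);R 0x2109cec63 (-32);
R 0x846118c6f 1;R 0x8c6108c6f 32;R 0x18c2108c6f 32;R 0x4210843d2f (-40);R 0x421085bda1 (-96);
R 0x4210e52c63 (-30);R 0x421886318f 1;R 0x4318c63087 17;R 0x631084318f 32;R 0x21084318c631 (-63);
R 0x2108c6108c63 (-48);R 0x108421084318f (-32);R 0x7bdef 2;R 0x34bdef 17;R 0xa56f7b (-16);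
R 0xc4bdef 17;R 0xf1ad6f 48;R 0xf48def 17;R 0xf4a5ef (-31);R 0xf4b1ef 17;R 0xf5ac6f 48;
R 0x295bde3 (-16);R 0x421bdef 32;R 0x425af7b (-16);R 0x4a5ad7b (-80);R 0x4bdce63 (-16);
R 0x631bd6b 17;R 0x6339d2f (-16);R 0x672b58f 8;R 0x108dee73 (-15);R 0x10a5ee73 (-31);
R 0x10ad6f63 (-15);R 0x10b7ad63 (-16);R 0x10bdee43 (-7);R 0x10e7b5a9 (-30);R 0x1295ade3 (-80);
R 0x421ef7a1 (-16);R 0x42379ce3 (-15);R 0x42979ce3 (-31);R 0x42f79c23 (-7);R 0x8425ee73 (-31);
R 0x8431ee73 (-15);R 0x843dee43 (-7);R 0xa53d2723 (-48);R 0xa53d2873 (-46);R 0x1087bde21 (-16);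
R 0x108d6b7a1 (-80);R 0x108de9729 (-48);R 0x108f4bd29 (-72);R 0x10a56b7a1 (-63);R 0x10a5ed6a1 (-63);
R 0x10ad697a1 (-63);R 0x10b5a97a1 (-63);R 0x210979ce3 (-31);R 0x210c79ce3 (-15);R 0x210f79c23 (-7);
R 0x2118ce17b (-15);R 0x2119c2f4b 1;R 0x252f484e3 (-39);R 0x84210f7ad (-64);R 0x84214bdad (-63);
R 0x84217a5ad (-63);R 0x84217b5a9 (-63);R 0x84256b7a1 (-63);R 0x8425ed6a1 (-63);
R 0x842d4bd29 (-112);R 0x842d697a1 (-63);R 0x8431ad7a1 (-80);R 0x8435a97a1 (-63);
R 0x8435af4a1 (-68);R 0x843d2b5a1 (-63);R 0x843d2d6a1 (-63);R 0x843dad4a1 (-63);R 0x843dad621 (-80);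
R 0x84610bd2f (-16);R 0x8463085ef (-46);R 0x846318c6f 32;R 0x84634bd29 (-79);R 0x84637a529 (-79);
R 0x84670a52f (-47);R 0x84670bd23 1;R 0x1086390f4b 1;R 0x1087bd0e21 (-62);R 0x108e17a5a1 (-47);
R 0x1297a58843 (-64);R 0x18c2118c6f 33;R 0x421084bdad (-63);R 0x42108625ef (-63);
R 0x42108631ef (-31);R 0x4210863dad (-80);R 0x421087a5ad (-63);R 0x421087b5a9 (-63);
R 0x421087bda1 (-64);R 0x4210b4bca5 (-112);R 0x4210b4bd29 (-112);R 0x4210b4bda1 (-48);
R 0x4212b5bc21 (-68);R 0x4212f09da1 (-47);R 0x4212f5ac21 (-63);R 0x4218c4bd29 (-79);
R 0x4218d6bc21 (-80);R 0x4218e4252f (-47);R 0x4218e4312f (-7);R 0x4218e43d23 1;R 0x4218e43d29 (-47);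
R 0x421ad4bc21 (-63);R 0x4a52f18423 (-64);R 0x4a5e918423 (-64);R 0x6318c63087 40;
R 0x2108425ec621 (-79);R 0x421086318c63 (-32);R 0x108421086312f (-79);R 0x108421086318f (-64);
R 0x2f4bd2f 24;R 0x2f7392f 29;R 0x10c7bdad 2;R 0x1af42d2f 16;R 0x217b9c863 0;R 0x84273b5a9 (-80);
R 0x842f4bd29 (-72);R 0x1087b9c863 0;R 0x4210f4bd29 (-72);R 0x2108421e97a1 (-72);R 0x2108c6108c6f 0;
R 0x210c6390c631 (-15);R 0x2118c2108c6f 0;R 0x1084210843d2f (-72);R 0x1084210c7bc21 (-95);
R 0x1084210f4bc21 (-72);R 0x108621086318f (-31);R 0x108631084318f 0;R 0x37bdef 33;R 0x97bdef 2;
R 0xc7bdef 33;R 0xf78def 33;R 0xf7a5ef 2;R 0x217bdef (-30);R 0x5aded6b (-15);R 0x6339def (-15);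
R 0x635adef (-31);R 0x637bd2f 33;R 0x6738def (-30);R 0x673bd2f 1;R 0x6f5ad2f (-16);
R 0x1087bdef (-30);R 0x10b4bdef (-15);R 0x10b6b5ef (-14);R 0x10b7b5af 0;R 0x12f1bd6b (-16);
R 0x12f5ac6f 0;R 0x12f63dad (-16);R 0x12f6b58f 0;R 0x16a725ef (-30);R 0x16a731ef (-14);
R 0x16b7392f (-48);R 0x16b7ad63 (-15);R 0x18c6b5ef (-31);R 0x18c7bd2f 33;R 0x18e73d2f 1;
R 0x18f6b52f (-16);R 0x18f6b58f 49;R 0x1e14adef 1;R 0x1e35ad2f 0;R 0x1e91ad6f (-16);
R 0x1e95a1ef (-15);R 0x1e95ac6f 0;R 0x1e9635af (-16);R 0x1e9685ef (-15);R 0x10ad6f7a1 (-62);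
R 0x10bd2f6a5 (-48);R 0x10bde9729 (-63);R 0x210c7bd2f (-15);R 0x210f4bd2f 0;R 0x214e4bd2f (-32);
R 0x252979ce3 (-63);R 0x84217bdad (-62);R 0x84277a5ad (-62);R 0x842d4bdad (-47);R 0x842d6f7a1 (-62);
R 0x843d2f6a5 (-48);R 0x843de9729 (-63);R 0x846339d2f (-48);R 0x846339de9 (-48);R 0x846f4bd29 (-48);
R 0x846f5ad29 (-112);R 0x852b5bd29 (-100);R 0x852f4bd29 (-96);R 0x852f6b529 (-100);
R 0x856b4bd29 (-100);R 0x856b7a529 (-100);R 0x85b5a97a1 (-51);R 0x85b90f7a1 (-46);
R 0x85e95ad29 (-100);R 0x94a5e9729 (-96);R 0x1084bdce63 (-48);R 0x2118f4bd29 (-48);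
R 0x421084bdef (-63);R 0x421087bd2f (-63);R 0x421087bd6b (-62);R 0x421087bdad (-62);
R 0x4210b4bdad (-47);R 0x4210b6b52f (-47);R 0x4210b7a56b (-36);R 0x4210b7bda1 (-33);
R 0x4210e7a5ad (-62);R 0x4210e7b5a9 (-62);R 0x4212b5bd29 (-100);R 0x4212f4bd29 (-96);
R 0x4212f6b529 (-100);R 0x4214a7a52f (-96);R 0x4214a7a5e3 (-47);R 0x4214a7a5e9 (-96);
R 0x4216b7bc21 (-62);R 0x4218e43d2f 17;R 0x4218f6b529 (-112);R 0x421ad4bd29 (-100);
R 0x421ad7a529 (-100);R 0x421e95ad29 (-100);R 0x421e97ad21 (-48);R 0x421ef4ad21 (-94);
R 0x108c6738c63 (-14);R 0x84210979ce3 (-63);R 0x2108425ad7a1 (-100);R 0x2108425ec7a1 (-36);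
R 0x210c6318c7a1 0;R 0x2118c2118c6f (-15);R 0x10842108631ef (-63);R 0x1084210863d2f (-48);
R 0x1084210863dad (-112);R 0x108421086b52f (-100);R 0x1084212b5bc21 (-100);R 0x1084212f1bc21 (-36);
R 0x1084218c6318f 0;R 0x237bdef 2;R 0x10c7bdef 2;R 0x10f4bdef 25;R 0x10f6b5ef 26;R 0x16b78ded 16;
R 0x16f1bd6b 16;R 0x1af5ac6f 32;R 0x1af6b58f 32;R 0x235adce63 (-16);R 0x842f4bd2f (-8);
R 0x4210c7bdad (-30);R 0x5bd884318f 33;R 0x2118ce718c61 (-16);R 0x217a1086318f (-8);
R 0x630842318c6f 32;R 0x631842118c6f 32;R 0x1084210c631ef (-31);R 0x1084318c6318f 32;
R 0x108631886318f 16;R 0x673bdef 2;R 0x697bdef 2;R 0x6b5bdef (-15);R 0x6f5adef (-15);R 0x12f4bdef 1;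
R 0x12f78def 2;R 0x12f7a5ef (-62);R 0x12f7b1ef 2;R 0x12f7bd2f 1;R 0x16b739ef (-47);
R 0x16b78def (-15);R 0x16b7a5ef 2;R 0x16b7bd2f 2;R 0x18c7bdef 34;R 0x18d6bdef (-15);
R 0x18f6b5ef (-15);R 0x1ad7b1ef (-15);R 0x1e35adef 1;R 0x1e94bdef 1;R 0x1e95adef 2;R 0x1e97a5ef 1;
R 0x1e97bd2f 1;R 0x1eb58def (-15);R 0x1ec6b5ef 1;R 0x1ed6b1ef (-15);R 0x8437bdef (-14);
R 0xc217bdef (-14);R 0xc613bdef 2;R 0xc631bdef 48;R 0xc6f6b52f 1;R 0xce71bd2f 1;R 0xce77a52f (-31);
R 0x10bdef6a5 (-46);R 0x10bdef7a1 (-62);R 0x210f7bd2f 1;R 0x252f5ac6f (-32);R 0x252f6b58f (-32);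
R 0x31087bdef (-14);R 0x318c63def 48;R 0x3c294b5ef (-31);R 0x6339dad63 (-48);R 0x84217bdef (-62);
R 0x843def6a5 (-46);R 0x843def7a1 (-62);R 0x84631bdef 1;R 0x846339def (-47);R 0x84637bd2f 1;
R 0x84673bd2f (-31);R 0x846b5bdad (-47);R 0x846f5ad2f (-48);R 0x852f6b5ad (-96);R 0x856b7bd29 (-96);
R 0x85bdad7a1 (-32);R 0x94bd2f6a5 (-80);R 0x94bde9729 (-95);R 0x108529ef7b (-32);
R 0x1297a5ce63 (-80);R 0x139eb4a50f (-47);R 0x18c217bd2f 2;R 0x18c6309def 17;R 0x18c63385ef 2;
R 0x21deb4a50f 0;R 0x25297a5ea5 (-128);R 0x421087bdef (-62);R 0x4210b7b5af (-32);
R 0x4212f7bda1 (-37);R 0x4214a7a5ef (-95);R 0x4214a7bde3 (-32);R 0x4216b7bd29 (-96);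
R 0x4218c63def 1;R 0x4218d6bdad (-47);R 0x4218e73d2f (-31);R 0x4218f6b52f (-48);R 0x4218f6b58f 17;
R 0x4218f7a52f (-47);R 0x4218f7bd29 (-47);R 0x421e95ade3 (-48);R 0x421ef7ad21 (-46);
R 0x421ef7bc21 (-62);R 0x425af4bd29 (-80);R 0x42dad4bca5 (-79);R 0x42dc87bca5 (-78);
R 0x4a52f39c63 (-80);R 0x4a5e939c63 (-80);R 0x4a5e94bd29 (-128);R 0x529ec6318f 16;R 0x6318c721ef 2;
R 0x78c63085ef 1;R 0x78c630b52f 16;R 0x7a5a118c6f 16;R 0x7b18c421ef 1;R 0x210842d6f7a1 (-96);
R 0x2118ce718c63 (-48);R 0x8421097a5ea5 (-128);R 0x108421084bdef (-95);R 0x10842108739ef (-78);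
R 0x108421087bd6b (-96);R 0x1084210b6b52f (-79);R 0x1084212f39c63 (-80);R 0x1084216a7252f (-112);
R 0x108421ce6318f (-15);R 0x1087a5086318f (-32);R 0x1e1084210bd2f (-16);R 0x2319cef7b 16;
R 0x6309cef7b 16;R 0x8c6738def (-29);R 0x8c673a5ef (-31);R 0x8c673bd2f 2;R 0x8c673bde3 16;
R 0x8c673bde9 (-15);R 0x12f7b9c863 (-15);R 0x1846339def (-14);R 0x18c2738def 16;
R 0x18c273a5ef (-31);R 0x18c273b1ef 16;R 0x18c273bd2f 16;R 0x18c273bde3 16;R 0x2318c6318c6f 33;
R 0x6308c6318c6f 33;R 0x1085a9c86318f (-31);R 0xe77bdef 19;R 0x12f7bdef 2;R 0x16b7bdef 3;
R 0x1ce7bdef 19;R 0x1e97bdef 2;R 0x1ef4bdef 2;R 0x97bdee73 2;R 0xc277bdef 26;R 0xc6f5adef 17;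
R 0xce77a5ef 2;R 0x10bdef7ad (-36);R 0x25ef6b58f 1;R 0x25ef79ce3 2;R 0x295bdef4b (-31);
R 0x318f6b5ef 17;R 0x31ce7a5ef 2;R 0x6339def4b (-15);R 0x635adee73 (-31);R 0x843def7ad (-36);
R 0x846f5adef (-47);R 0x852f7bdad (-36);R 0x85bdef7a1 (-36);R 0x85e97bdad (-30);R 0x85ef4bdad (-30);
R 0x85ef6b52f (-30);R 0x85ef7a5ad (-30);R 0x85ef7b5a9 (-30);R 0x85ef7bd29 (-100);
R 0x94a5ef7ad (-69);R 0x94bd2f7ad (-69);R 0x94bde97ad (-69);R 0x94bdef6a5 (-79);R 0xa5697bd2f (-62);
R 0xa56f4bd2f (-20);R 0xa56f63d2f (-31);R 0xa56f78d2f (-31);R 0xa56f7a52f (-79);R 0xa56f7b12f (-31);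
R 0xa56f7bd23 (-31);R 0xb52f5ac6f (-16);R 0xb52f6b58f (-16);R 0xb52f6b5ad (-80);
R 0x1297bdce63 (-79);R 0x16b7a5ce63 (-15);R 0x1897bdce63 (-15);R 0x18c6339def 18;
R 0x18c6b5ee73 (-31);R 0x18c6f5ad2f 17;R 0x18ce74bd2f (-16);R 0x18ce77a52f (-16);
R 0x4212f7bdad (-36);R 0x4218f6b5ef (-47);R 0x421e97bdad (-30);R 0x421ef4bdad (-30);
R 0x421ef6b52f (-30);R 0x421ef7a5ad (-30);R 0x421ef7b5a9 (-30);R 0x421ef7bd29 (-100);
R 0x421ef7bda1 (-36);R 0x42d2f6b5ad (-80);R 0x42de97bca5 (-69);R 0x42ded6b5a9 (-69);
R 0x42def4bca5 (-69);R 0x6318c739ef 18;R 0x78c631ad6f 16;R 0x7ad6318c6f 16;R 0x2178c6318c6f 28;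
R 0x217b18c6318f 16;R 0x217bc2118c6f (-31);R 0x217bd086318f (-31);R 0x421085aded6b (-79);
R 0x1084210b7b5af (-64);R 0x1084212f5ac6f (-64);R 0x1084212f6b58f (-64);R 0x1084216a725ef (-94);
R 0x1084216b7ad63 (-79);R 0x1084218c7bd2f (-31);R 0x1084218f6b52f (-80);R 0x108421ce5ac6f (-47);
R 0x10863dad4bc21 (-80);R 0x10878c6318c6f 16;R 0x1087b18c6318f 28;R 0x1087bc2118c6f (-31);
R 0x1087bd086318f (-31);R 0x8c673bdef 3;R 0x18c273bdef 32;R 0x431ef6b58f 1;R 0x43d2f5ac6f 24;
R 0x43d2f6b58f 24;R 0x43dad5ac6f 25;R 0x43dad6b58f 25;R 0x46339ded6b (-32);R 0x4a5af4bd2f (-32);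
R 0xc6139ded6b (-32);R 0x118ce77ad63 (-32);R 0x3184e77ad63 (-32);R 0x42f7b9cc631 (-46);
R 0x210f7b9cc631 (-46);R 0x6309cec6318f 32;R 0x631b9c86318f 32;R 0x1084210c7bdef (-62);
R 0x1084210f4bdef (-39);R 0x1084210f6b5ef (-38);R 0x1086310c7bdad (-14);R 0x16b78c2108c6f 16;
R 0x1ef7bdef 3;R 0x252f7bdef (-30);R 0x25ef4bdef (-15);R 0x2d7bded6b (-16);R 0x85ef7bdad (-29);
R 0xa56f7bd2f (-16);R 0xb4e17bdef (-13);R 0xb56b4bdef (-14);R 0xb5ad6f7ad (-65);R 0xb5eb58def (-15);
R 0xb5ed6b1ef (-15);R 0xb5ef7ad63 (-16);R 0x10b7bded6b (-16);R 0x1297bded6b (-79);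
R 0x12f7bdce63 (-15);R 0x16b7bdce63 (-14);R 0x18c6f5adef 18;R 0x18ce74bdef (-15);
R 0x18ce77a5ef (-15);R 0x18ce77bd2f (-15);R 0x19cef5ac6f 1;R 0x19cef6b58f 1;R 0x1bd6b5ac6f (-16);
R 0x1bd6b6b58f (-16);R 0x217bdef6a5 (-78);R 0x421ef7bdad (-29);R 0x429cf7bd2f 1;
R 0x42dad4bdef (-14);R 0x42dad7bd2f (-14);R 0x42dc87bdef (-13);R 0x42deb58def (-15);
R 0x42ded6b1ef (-15);R 0x42def6b5ad (-65);R 0x42def7ad63 (-16);R 0x4a52f7bd6b (-68);
R 0x4a56b4bdef (-68);R 0x4a56b7a5ef (-68);R 0x4a56b7bd2f (-68);R 0x4a56b7bde9 (-68);
R 0x4a5e97bd6b (-68);R 0x4a5e97bdad (-68);R 0x4a5eb58def (-79);R 0x4a5ed6b1ef (-79);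
R 0x4a5ef1bd6b (-79);R 0x4a5ef63dad (-79);R 0x4a5ef7ad63 (-79);R 0x4ad6f6b5ad (-68);
R 0x631ef5ac6f 33;R 0x631ef6b58f 33;R 0x63dad5ac6f (-16);R 0x63dad6b58f (-16);R 0x856bdef7a1 (-78);
R 0xc673a5ed6b (-32);R 0x1087bdef6a5 (-78);R 0x319ce97ad63 (-32);R 0x421ef7bd6a1 (-78);
R 0x46339ded6b1 (-32);R 0x85ef7398c63 (-14);R 0x8d6b7b9c863 (-32);R 0x210b5a5ef7a1 (-68);
R 0x217ad6318c6f (-16);R 0x217b5ac6318f (-16);R 0x217bce718c63 (-14);R 0x218d6bdce631 (-32);
R 0x4210e7bdad63 (-47);R 0x421ef7398c63 (-14);R 0x431ad7b9c863 (-32);R 0x630852f6b58f 1;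
R 0x63085e95ac6f 1;R 0x63085e96b58f 1;R 0x1084212f7bd6b (-68);R 0x1084216b7bd2f (-68);
R 0x1084218c7bdef (-30);R 0x1084218f6b5ef (-79);R 0x10842d2f5ac6f (-48);R 0x10842d2f6b58f (-48);
R 0x108439ef5ac63 (-47);R 0x1085ad2f7bc21 (-68);R 0x1086312f5ac6f (-15);R 0x1086312f6b58f (-15);
R 0x108631e95ac6f (-15);R 0x108631e96b58f (-15);R 0x1087a5084bdef (-63);R 0x1087ad6318c6f (-16);
R 0x1087b5ac6318f (-16);R 0x1087bce718c63 (-14);R 0x12b5bc2118c6f 1;R 0x12b5bd884318f 2;
R 0x16b4bc2118c6f 1;R 0x16b4bd086318f 1;R 0x16b7a42118c6f 1;R 0x16b7a5086318f 1;
R 0x1e10842f7392f 30;R 0x1e108c217bd2f 1;R 0x8c673bdad63 (-30);R 0x2318c277bdad 26;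
R 0x2318ce17bdad (-14);R 0x2318ce74bdad (-14);R 0x2319cef5ac63 (-30);R 0x1084294f4bdef (-78);
R 0x108431ef6b58f (-31);R 0x10843d2f5ac6f (-8);R 0x10843d2f6b58f (-8);R 0x10843dad5ac6f (-7);
R 0x10843dad6b58f (-7);R 0x1086214a7bdef (-93);R 0x10c631c87bdad (-14);R 0x25ef7bdef 3;
R 0x85ef7bdef (-29);R 0xb52f7bdef (-14);R 0xb56b7bdef (-13);R 0x18ce77bdef (-14);
R 0x19ce37bdef (-29);R 0x19cef4bdef 2;R 0x19cef7bd2f 2;R 0x1bd6b7bd2f (-15);R 0x421ef7bdef (-29);
R 0x42dad7bdef (-13);R 0x4a56b7bdef (-64);R 0x5a9c97bdef (-29);R 0x5ad6b7bd6b (-64);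
R 0x5ad6b7bdad (-64);R 0x5ade37bdad (-14);R 0x631ce7bdef (-14);R 0x631ef7bd2f 34;
R 0x63dad7bd2f (-15);R 0x6b5ec7a5ef (-15);R 0x7a46b5bdef (-15);R 0x7a5687bdef (-14);
R 0x7a56b78def (-15);R 0x7a58d6bdef (-15);R 0x7a5a17bdef (-14);R 0x7a5ad7b1ef (-15);
R 0x7a5ef1ad6f (-15);R 0x7a5ef635af (-15);R 0x14adef4bdad (-46);R 0x14adef6b52f (-46);
R 0x339de95ac6f 1;R 0x339de96b58f 1;R 0x42b5ef4bdad (-46);R 0x211bd6b5ac6f (-48);
R 0x211bd6b6b58f (-48);R 0x2139def6a50f (-14);R 0x214ad6f5ac6f (-36);R 0x214ad6f6b58f (-36);
R 0x215ad2f5ac6f (-36);R 0x215ad2f6b58f (-36);R 0x215ade95ac6f (-36);R 0x215ade96b58f (-36);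
R 0x215adef7a5a1 (-46);R 0x217a56b5ac6f (-36);R 0x217a56b6b58f (-36);R 0x421e95aded6b (-47);
R 0x5ade97398c63 18;R 0x5adef4398c63 3;R 0x5adef7218c63 18;R 0x630b52f5ac6f 17;R 0x630b52f6b58f 17;
R 0x1084216b7bdef (-64);R 0x10842dad7bd2f (-46);R 0x1084ad6f1bd6b (-47);R 0x1084ad6f5ac6f (-36);
R 0x1084ad6f63dad (-47);R 0x1084ad6f6b58f (-36);R 0x1085a9c97bd2f (-62);R 0x1085ad2f1bd6b (-47);
R 0x1085ad2f63dad (-47);R 0x1085adeb58d2f (-47);R 0x1085aded6b12f (-47);R 0x1085adef0b52f (-46);
R 0x108631ef5ac6f 1;R 0x108631ef6b58f 1;R 0x10863dad5ac6f (-48);R 0x10863dad6b58f (-48);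
R 0x1086b52f5ac6f (-36);R 0x1086b52f6b58f (-36);R 0x1086b5e95ac6f (-36);R 0x1086b5e96b58f (-36);
R 0x1086b5ef7a5a1 (-46);R 0x1087a50b6b5ef (-46);R 0x1087a56a725ef (-62);R 0x1087a56a731ef (-46);
R 0x1087a56b1bd6b (-47);R 0x1087a56b5ac6f (-36);R 0x1087a56b63dad (-47);R 0x1087a56b6b58f (-36);
R 0x1087a56b7392f (-80);R 0x1087a56b7ad63 (-47);R 0x1087a56b7b5a9 (-63);R 0x16b7a4e718c63 18;
R 0x16b7a5686318f 17;R 0x16b7a5a118c6f 17;R 0x16b7bc2118c6f 2;R 0x16b7bc2718c63 3;
R 0x16b7bd086318f 2;R 0x1e108c6f6b52f 17;R 0x1e108ce71bd2f 17;R 0x1e108ce77a52f (-15);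
R 0x1e14a5af42d2f (-15);R 0x8def7bdef 3;R 0x431ef7bdef 3;R 0x43dad7bdef 27;R 0x2318ce77bdad (-13);
R 0x2319cef5ac6f 2;R 0x2319cef6b58f 2;R 0x6309cef5ac6f 32;R 0x6309cef6b58f 32;
R 0x10a53d2f5ac6f (-47);R 0x10a53d2f6b58f (-47);R 0xb5ef7bdef (-4);R 0x19cef7bdef 3;
R 0x1ad6f7bdef (-14);R 0x1bd6b7bdef (-14);R 0x42def7bdef (-4);R 0x4a5ef7bdef (-68);R 0x4bde37bdef 3;
R 0x4bdec7bdef 3;R 0x5adce7bdef (-46);R 0x625ef7bdef 3;R 0x635af7bdef (-14);R 0x63dad7bdef (-14);
R 0x6b5ec7bdef (-14);R 0x7ad637bdef (-14);R 0x7b5ac7bdef (-14);R 0x7bc6b5bdef (-14);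
R 0x7bc6f5adef (-14);R 0x7bd6b78def (-14);R 0x7bd8d6bdef (-14);R 0x14adef7bdad (-45);
R 0x319cec7bdef 3;R 0x42b5ef7bdad (-45);R 0x215adef5ac6f (-32);R 0x215adef6b58f (-32);
R 0x4216b7bded6b (-46);R 0x5adef7398c63 19;R 0x630852f7bdef 3;R 0x63085ef7bd2f 3;
R 0x631bd6b5ac6f 17;R 0x631bd6b6b58f 17;R 0x6339d2f5ac6f (-16);R 0x6339d2f6b58f (-16);
R 0x697bdeb4a50f (-15);R 0x108421ef7bdef (-61);R 0x10842d2f7bdef (-46);R 0x10842dad7bdef (-45);
R 0x108439e97bdef (-61);R 0x1085a9c97bdef (-61);R 0x1085ade37bdad (-46);R 0x1085adeb58def (-46);
R 0x1085aded6b1ef (-46);R 0x1085adef1bd6b (-46);R 0x1085adef5ac6f (-32);R 0x1085adef63dad (-46);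
R 0x1085adef6b58f (-32);R 0x1085adef7ad63 (-46);R 0x1086312f7bdef (-13);R 0x108631ef7bd2f 2;
R 0x10863dad7bd2f (-47);R 0x1087a56b739ef (-79);R 0x10b6b52f5ac6f (-15);R 0x10b6b52f6b58f (-15);
R 0x10b721ef5ac6f (-14);R 0x10b721ef6b58f (-14);R 0x16a7252f5ac6f (-48);R 0x16a7252f6b58f (-48);
R 0x16a725e95ac6f (-31);R 0x16a725e96b58f (-31);R 0x16b7ad6318c6f 17;R 0x16b7b5ac6318f 17;
R 0x16b7bce718c63 19;R 0x1897bdeb4a50f (-15);R 0x1e14a5a97bd2f (-61);R 0x1e14a5af4bd2f (-4);
R 0x1e14ad2b5bd2f (-16);R 0x1e14adeb58d2f (-16);R 0x1e14aded6b12f (-16);R 0x1e14adef42d2f (-15);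
R 0x1e318c217bdef 2;R 0x1e42b52d6bd2f (-16);R 0x1e42b5ef0b52f (-15);R 0x8c673bdef7b 17;
R 0x2318ce77bdef (-13);R 0x2319ce37bdef (-28);R 0x2319ce97bdef (-30);R 0x2319cec7bdef 3;
R 0x2319cef4bdef 3;R 0x2319cef78def 17;R 0x2319cef7a5ef (-14);R 0x2319cef7b1ef 17;
R 0x2319cef7bd2f 3;R 0x2319cef7bde3 17;R 0x2319cef7bde9 (-14);R 0x6339c237bdef (-14);
R 0x108431ef7bdef (-29);R 0x10843dad7bdef (-5);R 0x10c631ce7bdef (-13);R 0x309def7bdef 27;
R 0x35ad6b7bdef (-46);R 0xc6b5ad7bdef (-46);R 0x18ce74bdef7b 17;R 0x18ce77bdef4b (-14);
R 0x2139def7bdad (-12);R 0x217bdef5ac6f (-36);R 0x217bdef6b58f (-36);R 0x4212f7bdef7b 2;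
R 0x4bdef7a5ce63 (-15);R 0x4bdef7bdc863 3;R 0x625ef7bdce63 (-14);R 0x6309def7a5ef 3;
R 0x630b52f7bdef 19;R 0x6318ce77bdef 19;R 0x631bd6b7bd2f 18;R 0x6339d297bdef (-78);
R 0x6339d2f4bdef (-15);R 0x6339d2f78def (-14);R 0x6339d2f7a5ef (-78);R 0x6339d2f7b1ef (-14);
R 0x6339d2f7bd2f (-15);R 0x6339d2f7bde3 17;R 0x6339de97bd2f (-15);R 0x6339def4bd2f (-15);
R 0x6339def7a52f (-15);R 0x1084ad6f7bdef (-36);R 0x1084bd2f7bdef (-30);R 0x1084bde37bdef (-29);
R 0x1084bdec7bdef (-29);R 0x1084bdef4bdef (-30);R 0x1084bdef78def 2;R 0x1084bdef7b1ef 2;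
R 0x1084bdef7bd2f (-30);R 0x1084bdef7bde3 2;R 0x1085ad2f7bdef (-36);R 0x1085adef7bd2f (-36);
R 0x108625ef7bdef (-29);R 0x10863dad7bdef (-46);R 0x1086b5ec7bdef (-46);R 0x1087a56b7bdef (-36);
R 0x1087bdef5ac6f (-36);R 0x1087bdef6b58f (-36);R 0x10b7b5af5ac6f 0;R 0x10b7b5af6b58f 0;
R 0x16a725ef5ac6f (-30);R 0x16a725ef6b58f (-30);R 0x18c631ce7bdef 19;R 0x1e14a5af7bd2f 0;
R 0x1e318c6f5adef 17;R 0x1ec6318f6b5ef 17;R 0x2319cef7bdef 4;R 0x10a53d2f7bdef (-45);
R 0x5ade97bded6b (-14);R 0x631bd6b7bdef 19;R 0x6339d2f7bdef (-14);R 0x6339def7bd2f (-14);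
R 0x6b5bdef5ac6f (-15);R 0x6b5bdef6b58f (-15);R 0x1084bdef7bdef (-29);R 0x1085adef7bdef (-32);
R 0x10b6b52f7bdef (-13);R 0x10b6b5ef7bd2f (-13);R 0x10b721ef7bdef (-12);R 0x12b5bc6f5adef (-14);
R 0x12b5bd8f6b5ef (-14);R 0x12b5bdef1bd6b (-14);R 0x12b5bdef5ac6f (-4);R 0x12b5bdef63dad (-14);
R 0x12b5bdef6b58f (-4);R 0x12f7bdef49cad (-29);R 0x16a7252f7bdef (-46);R 0x16a725e97bdef (-29);
R 0x16a725ef4bdef (-31);R 0x16a725ef7a5ef (-29);R 0x16a725ef7bd2f (-29);R 0x16b4bc6f5adef (-14);
R 0x16b4bd8f6b5ef (-14);R 0x16b4bdef1bd6b (-14);R 0x16b4bdef5ac6f (-4);R 0x16b4bdef63dad (-14);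
R 0x16b4bdef6b58f (-4);R 0x16b78de97bdad (-14);R 0x16b78def4bdad (-14);R 0x16b78def5ac6f (-15);
R 0x16b78def6b58f (-15);R 0x16b7a46f5adef (-14);R 0x16b7a5687bdef (-13);R 0x16b7a58f6b5ef (-14);
R 0x16b7a5a17bdef (-13);R 0x16b7a5eb58def (-14);R 0x16b7a5ed6b1ef (-14);R 0x16b7a5ef1bd6b (-14);
R 0x16b7a5ef5ac6f (-4);R 0x16b7a5ef6b58f (-4);R 0x16b7a5ef7ad63 (-14);R 0x16b7ad637bd2f (-14);
R 0x16b7b5ac7bd2f (-14);R 0x16b7bc6f5ad2f (-14);R 0x16b7bd2f1bd6b (-14);R 0x16b7bd2f5ac6f (-4);
R 0x16b7bd2f6b58f (-4);R 0x16b7bd8f6b52f (-14);R 0x16b7bde95ac6f (-4);R 0x16b7bde96b58f (-4);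
R 0x16b7bdeb58d2f (-14);R 0x16b7bded6b12f (-14);R 0x16b7bdef0b52f (-13);R 0x16b7bdef42d2f (-13);
R 0x18d6bdef5ac6f (-15);R 0x18d6bdef6b58f (-15);R 0x1ad7b1ef5ac6f (-15);R 0x1ad7b1ef6b58f (-15);
R 0x1e14adef7bd2f (-4);R 0x1e35adeb58def (-15);R 0x1e35aded6b1ef (-15);R 0x1e42b5ef7bd2f (-4);
R 0x1ec6b5eb58def (-15);R 0x1ec6b5ed6b1ef (-15);R 0x5adef7bded6b (-13);R 0x10b6b5ef7bdef (-12);
R 0x12f7bdef39dad (-46);R 0x16a725ef7bdef (-28);R 0x16a731ef7bdef (-12);R 0x16b739e97bdef (-46);
R 0x16b739ef4bdef (-46);R 0x16b739ef7a5ef (-46);R 0x16b78def7bdad (-13);R 0x16b7ad637bdef (-13);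
R 0x16b7b5ac7bdef (-13);R 0x16b7bc6f5adef (-13);R 0x16b7bd8f6b5ef (-13);R 0x16b7bdeb58def (-13);
R 0x16b7bded6b1ef (-13);R 0x16b7bdef1bd6b (-13);R 0x16b7bdef5ac6f 0;R 0x16b7bdef6b58f 0;
R 0x16b7bdef7ad63 (-13);R 0x6b5bdef7bdef (-13);R 0x12b5bdef7bdef (-4);R 0x16b4bdef7bdef (-4);
R 0x16b78def7bdef (-13);R 0x16b7a5ef7bdef (-4);R 0x16b7bd2f7bdef (-4);R 0x16b7bdef7bd2f (-4);
R 0x18d6bdef7bdef (-13);R 0x1ad7b1ef7bdef (-13);R 0x1e35adef7bdef (-4);R 0x1ec6b5ef7bdef (-4);
R 0x1ef1ad6f7bdef (-13);R 0x1ef635af7bdef (-13);R 0x1ef7ad637bdef (-13);R 0x1ef7b5ac7bdef (-13);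
R 0x16b7bdef7bdef 0;R 0x1ef7bdef7bdef (-4)].

End Tables.

Lemma table2_ok : check 3 table2. Proof. by vm_compute. Qed.
Lemma table3_ok : check 4 table3. Proof. by vm_compute. Qed.
Lemma table4_ok : check 5 table4. Proof. by vm_compute. Qed.
Lemma table5_ok : check 6 table5. Proof. by vm_compute. Qed.
Lemma table7_ok : check 8 table7. Proof. by vm_compute. Qed.
Lemma table9_ok : check 10 table9. Proof. by vm_compute. Qed.
Lemma table11_ok : check 12 table11. Proof. by vm_compute. Qed.

(** * Rectangles *)

(* In a list of cells [true] means occupied, in a set of bits [1] means empty. *)
Fixpoint mask (l : seq bool) : N :=
  match l with
  | [::] => 0%num
  | b :: l' => if b then N.double (mask l') else N.succ_double (mask l')
  end.

Lemma testbit_mask l k : N.testbit (mask l) k = ~~ nth true l (N.to_nat k).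
Proof.
elim: l k => [|b l IH] k; first by rewrite nth_nil.
have [->|k0] := N.eq_dec k 0.
  by rewrite /=; case: b; rewrite ?N.succ_double_spec ?N.double_spec ?N.testbit_odd_0 ?N.testbit_even_0.
have -> : k = N.succ (N.pred k) by lia.
rewrite N2Nat.inj_succ /= -IH.
by case: b; rewrite ?N.succ_double_spec ?N.double_spec ?N.testbit_odd_succ ?N.testbit_even_succ //; lia.
Qed.

Lemma mask_cat l1 l2 :
  mask (l1 ++ l2) = N.lor (mask l1) (N.shiftl (mask l2) (N.of_nat (size l1))).
Proof.
apply: N.bits_inj => k; rewrite N.lor_spec !testbit_mask nth_cat.
case: ltnP => h; first by rewrite N.shiftl_spec_low ?orbF //; lia.
rewrite [nth true l1 _]nth_default // N.shiftl_spec_high' ?testbit_mask; last lia.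
by congr (~~ nth _ _ _); lia.
Qed.

(** The last cell of [l1] is occupied, so no vertical domino can cross from [l1] into [l2]. *)
Lemma vsep_mask l1 l2 : last true l1 ->
  vsep (mask l1) (N.shiftl (mask l2) (N.of_nat (size l1))).
Proof.
move=> l1t; apply/vsepP => k.
have low i : (i < N.of_nat (size l1))%num ->
  N.testbit (N.shiftl (mask l2) (N.of_nat (size l1))) i = false.
  exact: N.shiftl_spec_low.
have high i : (N.of_nat (size l1) <= i)%num -> N.testbit (mask l1) i = false.
  by move=> h; rewrite testbit_mask nth_default //; lia.
have [h|h] := N.le_gt_cases (N.of_nat (size l1)) k.
  have h' : (N.of_nat (size l1) <= N.add k 1)%num by lia.
  by rewrite (high k h) (high _ h') !andbF.
rewrite (low k h) !andbF; split=> //.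
have [h'|h'] := N.le_gt_cases (N.of_nat (size l1)) (N.add k 1); last by rewrite low.
have -> : N.testbit (mask l1) k = false; last by rewrite andbF.
have -> : k = N.of_nat (size l1).-1 by lia.
by rewrite testbit_mask Nat2N.id nth_last l1t.
Qed.

(* Each column is followed by an occupied cell, so that consecutive numbers are
   vertically adjacent cells. *)
Definition cells (s : seq (seq bool)) : seq bool := flatten [seq rcons c true | c <- s].

Definition rect (m n : nat) : seq (seq bool) := nseq n (nseq m false).

Lemma cells_cat s t : cells (s ++ t) = cells s ++ cells t.
Proof. by rewrite /cells map_cat flatten_cat. Qed.

Lemma last_cells s : last true (cells s).
Proof.
elim/last_ind: s => // s c _; rewrite -cats1 cells_cat last_cat.
by rewrite /cells /= cats0 last_rcons.
Qed.

(** * Negative bounds for all wide rectangles *)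

Section Rectangles.

Variable m : nat.

Local Notation S := (N.of_nat m.+1).
Local Notation bounded := (bounded S).

Lemma bounded_cells s t l x : bounded (Board (mask (cells s)) :: Board (mask (cells t)) :: l) x ->
  bounded (Board (mask (cells (s ++ t))) :: l) x.
Proof.
move=> h; rewrite cells_cat mask_cat.
apply: bounded_lor; first exact/vsep_mask/last_cells.
apply: bounded_perm (perm_swap _ _ _) _.
by apply: bounded_shift; apply: bounded_perm (perm_swap _ _ _) h.
Qed.

Definition rect_bound (n : nat) (x : Z) := bounded [:: Board (mask (cells (rect m n)))] x.

Lemma rect_bound_add n1 n2 x1 x2 : rect_bound n1 x1 -> rect_bound n2 x2 ->
  rect_bound (n1 + n2) (x1 + x2).
Proof.
move=> h1 h2; rewrite /rect_bound /rect nseqD; apply: bounded_cells.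
exact: bounded_cat h1 h2.
Qed.

Lemma rect_bound0 : rect_bound 0 0.
Proof. exact: bounded_barren. Qed.

Lemma rect_bound_mul q n x : rect_bound n x -> rect_bound (q * n) (Z.of_nat q * x).
Proof.
move=> h; elim: q => [|q IH]; first exact: rect_bound0.
by have := rect_bound_add h IH; rewrite mulSn Nat2Z.inj_succ Z.mul_succ_l Z.add_comm.
Qed.

(** Divide [n] by [a]: each of the [q] boards of width [a] contributes at most [- c], and the fewer
    than [a] remaining columns cost at most [d] each, which a large [q] outweighs. *)
Lemma rect_bound_eventually a c d : (0 < c)%coqZ -> (0 <= d)%coqZ ->
  rect_bound a (- c) -> rect_bound 1 d ->
  exists N0, forall n, N0 <= n -> rect_bound n (- 1).
Proof.
move=> c0 d0 ha h1; case: a ha => [|a] ha.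
  exists 0 => n _.
  apply: (@bounded_le _ _ (Z.of_nat n * d + Z.of_nat (n * Z.to_nat d).+1 * (- c))%coqZ); last first.
    have -> : Z.of_nat (n * Z.to_nat d).+1 = (Z.of_nat n * d + 1)%coqZ by nia.
    have : (0 <= Z.of_nat n * d)%coqZ by nia.
    move: (Z.of_nat n * d)%coqZ => D; nia.
  have := rect_bound_add (rect_bound_mul n h1) (rect_bound_mul (n * Z.to_nat d).+1 ha).
  by rewrite muln0 addn0 muln1.
(* With [a] for the width, this makes the quotient at least [a * d + 1], so the total is at most
   [- (a * d + 1) + a * d]. *)
exists (a.+1 * (a.+1 * Z.to_nat d).+1) => n hn.
set q := n %/ a.+1; set r := n %% a.+1.
have hr : r < a.+1 by rewrite ltn_mod.
have hq : (a.+1 * Z.to_nat d).+1 <= q by rewrite /q leq_divRL // mulnC.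
apply: (@bounded_le _ _ (Z.of_nat q * (- c) + Z.of_nat r * d)%coqZ).
  have := rect_bound_add (rect_bound_mul q ha) (rect_bound_mul r h1).
  by rewrite muln1 -divn_eq.
have qd : (Z.of_nat a.+1 * d + 1 <= Z.of_nat q)%coqZ by nia.
have rd : (Z.of_nat r * d <= Z.of_nat a.+1 * d)%coqZ by apply: Z.mul_le_mono_nonneg_r => //; lia.
nia.
Qed.

Fixpoint tk_neg (t : tk) : tk :=
  match t with TN z => TN (- z) | TS l r => TS (tk_neg r) (tk_neg l) end.

(** The imitation strategy: each move in one of the two trees is answered by its counterpart in the
    other, so [t - t] is zero. *)
Lemma snd_win_tk_neg p t : snd_win (cmove S) p (trees [:: t; tk_neg t]).
Proof.
elim: t => [z|l IHl r IHr].
  by apply: (@nums_snd_win _ _ _ [:: z; - z]%coqZ); rewrite /sgn zsum_cons /=; case: (p); lia.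
split=> m' mv; case: (pmove_consP mv) => [[c [g /= hg ->] ->]|[l2 mv2 ->]] {mv}.
  case: p IHl IHr hg => IHl IHr /= [] // <-.
    by apply: FstWin IHr; apply/pmove_tail/pmove_cons; eexists; [left|].
  by apply: FstWin IHl; apply/pmove_tail/pmove_cons; eexists; [left|].
case: (pmove_consP mv2) => [[c [g /= hg ->] ->]|[? /pmove_nil]] //.
case: p IHl IHr hg {mv2} => IHl IHr /= [] // <-.
  by apply: FstWin IHl; apply: pmove_cons; eexists; [left|].
by apply: FstWin IHr; apply: pmove_cons; eexists; [left|].
Qed.

(** The first hypothesis says [b - t <= 0]. Add it to the bound for [t + l] and cancel [t - t]. *)
Lemma bounded_subst b t l x : bounded (Board b :: trees [:: tk_neg t]) 0 ->
  bounded (Tree (tree t) :: l) x -> bounded (Board b :: l) x.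
Proof.
move=> h1 h2; apply: (@snd_win_cut _ _ _ _ (trees [:: t; tk_neg t])); last exact: snd_win_tk_neg.
have := bounded_cat h1 h2; rewrite Z.add_0_l /bounded.
apply: snd_win_perm; rewrite /= -!catA /=; apply: perm_skip.
apply: Permutation_trans (perm_swap _ _ _) _.
refine (Permutation_trans (Permutation_app_comm (trees [:: t; tk_neg t]) (l ++ nums prec [:: - x]%coqZ)) _).
rewrite -[List.app _ _]/(_ ++ _) -catA; exact: Permutation_refl.
Qed.

Lemma bounded_subst_nseq b t k x : bounded (Board b :: trees [:: tk_neg t]) 0 ->
  bounded (trees (nseq k t)) x -> bounded (nseq k (Board b)) x.
Proof.
move=> h; suff main j : bounded (trees (nseq k t) ++ nseq j (Board b)) x ->
    bounded (nseq (k + j) (Board b)) x.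
  by move=> h'; rewrite -[k]addn0; apply: main; rewrite cats0.
elim: k j => [//|k IH] j /(bounded_subst h) h'.
rewrite addSnnS; apply: IH; apply: bounded_perm h'.
exact: Permutation_middle.
Qed.

Lemma rect_bound_nseq k n x : bounded (nseq k (Board (mask (cells (rect m n))))) x ->
  rect_bound (k * n) x.
Proof.
suff main j : bounded (Board (mask (cells (rect m (j * n)))) :: nseq k (Board (mask (cells (rect m n))))) x ->
    rect_bound ((k + j) * n) x.
  move=> h; rewrite -[k]addn0; apply: main; rewrite mul0n -[x]Z.add_0_l.
  by apply: (@bounded_cat _ [:: _]) h; apply: bounded_barren.
elim: k j => [//|k IH] j h.
rewrite addSnnS; apply: IH; rewrite mulSn /rect nseqD.
by apply: bounded_cells; apply: bounded_perm h; apply: perm_swap.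
Qed.

End Rectangles.

Definition has_entry (es : seq entry) (e : N) (ts : seq tk) (x : Z) : bool :=
  has (fun en => [&& N.eqb (en_board en) e, tks_eqb (en_trees en) ts & Z.eqb (en_bound en) x]) es.

Lemma has_entry_bounded S es e ts x : check S es -> has_entry es e ts x ->
  bounded S (Board e :: trees ts) x.
Proof.
move=> ok; rewrite /has_entry => h.
suff hin : List.In (Entry e ts x) es by apply: check_sound ok hin.
elim: es {ok} h => //= -[e' ts' x'] es IH /orP[/and3P[/N.eqb_eq /= -> /tks_eqbP -> /Z.eqb_eq ->]|/IH]; by [left | right].
Qed.

Lemma bounded_trees S ts x : bounded S (Board 0 :: trees ts) x -> bounded S (trees ts) x.
Proof.
move=> h; apply: (@snd_win_cut _ _ _ _ [:: Board 0]).
  by apply: snd_win_perm h; apply: Permutation_cons_append.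
by split=> l' mv; case: (pmove_consP mv) => [[c [k []]]|[? /pmove_nil]].
Qed.

(** A bound of minus one unit, rather than 0, lets Hepzibah win as first player too. *)
Definition thick (m N0 : nat) := forall n, N0 <= n -> rect_bound m n (- 1).

Lemma thick_cold m es a c d : check (N.of_nat m.+1) es ->
  has_entry es (mask (cells (rect m a))) [::] (- Z.pos c) ->
  has_entry es (mask (cells (rect m 1))) [::] (Z.of_nat d) -> exists N0, thick m N0.
Proof.
move=> ok h1 h2; apply: (@rect_bound_eventually m a (Z.pos c) (Z.of_nat d)); try lia.
  exact: (has_entry_bounded ok h1).
exact: (has_entry_bounded ok h2).
Qed.

(* [k] copies of the hot game [t], each of which bounds a board of width [a], are negative. *)
Lemma thick_hot m es a t k c d : check (N.of_nat m.+1) es ->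
  has_entry es (mask (cells (rect m a))) [:: tk_neg t] 0 ->
  has_entry es 0 (nseq k t) (- Z.pos c) ->
  has_entry es (mask (cells (rect m 1))) [::] (Z.of_nat d) -> exists N0, thick m N0.
Proof.
move=> ok h1 h2 h3; apply: (@rect_bound_eventually m (k * a) (Z.pos c) (Z.of_nat d)); try lia.
  apply: rect_bound_nseq; apply: (bounded_subst_nseq (t := t)).
    exact: (has_entry_bounded ok h1).
  exact/bounded_trees/(has_entry_bounded ok h2).
exact: (has_entry_bounded ok h3).
Qed.

Lemma thick_width m : m \in [:: 2; 3; 4; 5; 7; 9; 11] -> exists N0, thick m N0.
Proof.
rewrite !inE => /or4P[/eqP->|/eqP->|/eqP->|/or4P[/eqP->|/eqP->|/eqP->|/eqP->]].
(* The numbers after the table are the width of the negative board, the absolute value of its bound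
   and the bound of a single column, in units of 1/32. In the hot cases the width is followed by the
   game and the number of its copies, and the second bound is that of their sum. *)
- by refine (@thick_cold 2 table2 12 16 32 table2_ok _ _); vm_compute.
- by refine (@thick_cold 3 table3 4 48 32 table3_ok _ _); vm_compute.
- by refine (@thick_cold 4 table4 10 4 64 table4_ok _ _); vm_compute.
- by refine (@thick_cold 5 table5 2 16 64 table5_ok _ _); vm_compute.
- by refine (@thick_hot 7 table7 2 x7 2 32 96 table7_ok _ _ _); vm_compute.
- by refine (@thick_hot 9 table9 2 x9 2 16 128 table9_ok _ _ _); vm_compute.
- by refine (@thick_hot 11 table11 2 x11 4 16 160 table11_ok _ _ _); vm_compute.
Qed.

(** * Blocks *)

Section Blocks.

Variable m : nat.

Local Notation S := (N.of_nat m.+1).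

(* A block is a list of columns of height [m]. *)
Definition wf (s : seq (seq bool)) := all (fun c => size c == m) s.

(** Column [j], row [i]. The default [true] makes everything outside the block occupied. *)
Definition cell (s : seq (seq bool)) (j i : nat) : bool := nth true (nth [::] s j) i.

Definition set_cell (s : seq (seq bool)) (j i : nat) :=
  set_nth [::] s j (set_nth true (nth [::] s j) i true).

Definition second (p : player) (j i : nat) : nat * nat :=
  if p is Vera then (j, i.+1) else (j.+1, i).

Definition block_move (p : player) (s s' : seq (seq bool)) := exists j i,
  let: (j', i') := second p j i in
  [/\ ~~ cell s j i, ~~ cell s j' i' & s' = set_cell (set_cell s j i) j' i'].

Lemma cell_lt s j i : wf s -> ~~ cell s j i -> j < size s /\ i < m.
Proof.
move=> w; rewrite /cell; case: (ltnP j (size s)) => hj; last first.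
  by rewrite [nth [::] s j]nth_default // nth_nil.
move/all_nthP: w => /(_ [::] j hj)/eqP E.
by case: (ltnP i m) => // hi; rewrite nth_default // E.
Qed.

Lemma cell_set s j i j' i' : cell (set_cell s j i) j' i' = ((j' == j) && (i' == i)) || cell s j' i'.
Proof.
rewrite /cell /set_cell nth_set_nth /=; case: eqP => [->|] //=.
by rewrite nth_set_nth /=; case: eqP.
Qed.

Lemma wf_set s j i : wf s -> ~~ cell s j i -> wf (set_cell s j i) /\ size (set_cell s j i) = size s.
Proof.
move=> w /(cell_lt w)[hj hi]; rewrite size_set_nth.
have -> : maxn j.+1 (size s) = size s by apply/maxn_idPr.
split=> //; apply/(all_nthP [::]) => k; rewrite size_set_nth (maxn_idPr hj) => hk.
have h := all_nthP [::] w; rewrite nth_set_nth /=; case: (k =P j) => [_|_]; last exact: h.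
by rewrite size_set_nth (eqP (h j hj)); apply/eqP/maxn_idPr.
Qed.

(** The case [i = m] is included: it is the separator after the column, and [cell] reads as occupied
    there by its default. *)
Lemma nth_cells s j i : wf s -> i <= m -> nth true (cells s) (j * m.+1 + i) = cell s j i.
Proof.
elim: s j => [|c s IH] j /=; first by rewrite /cell !nth_nil.
case/andP=> /eqP hc w hi; rewrite /cells /= nth_cat size_rcons hc.
case: j => [|j].
  rewrite mul0n add0n ltnS hi nth_rcons hc /cell /=; move: hi; rewrite leq_eqVlt.
  by case/predU1P=> [->|->//]; rewrite ltnn eqxx nth_default ?hc.
rewrite mulSn -addnA ltnNge leq_addr /= addKn; exact: IH.
Qed.

Lemma testbit_cells s k : wf s ->
  N.testbit (mask (cells s)) (N.of_nat k) = ~~ cell s (k %/ m.+1) (k %% m.+1).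
Proof.
move=> w; rewrite testbit_mask Nat2N.id {1}(divn_eq k m.+1) nth_cells //.
by rewrite -ltnS ltn_mod.
Qed.

Lemma mask_set_cell s k : wf s -> ~~ cell s (k %/ m.+1) (k %% m.+1) ->
  mask (cells (set_cell s (k %/ m.+1) (k %% m.+1))) = N.clearbit (mask (cells s)) (N.of_nat k).
Proof.
move=> w h; have [w' _] := wf_set w h; apply: N.bits_inj => l; rewrite -(N2Nat.id l).
rewrite N.clearbit_eqb !testbit_cells // cell_set negb_or andbC; congr (_ && ~~ _).
apply/andP/idP => [[/eqP e1 /eqP e2]|/N.eqb_eq/Nat2N.inj -> //].
by rewrite (divn_eq (N.to_nat l) m.+1) e1 e2 -divn_eq N.eqb_refl.
Qed.

Definition snd_block s := snd_win (cmove S) Hepzibah [:: Board (mask (cells s))].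
Definition fst_block s := fst_win (cmove S) Hepzibah [:: Board (mask (cells s))].

Lemma divnD1 j i : i <= m -> (j * m.+1 + i) %/ m.+1 = j /\ (j * m.+1 + i) %% m.+1 = i.
Proof. by move=> h; rewrite divnMDl // divn_small // addn0 modnMDl modn_small. Qed.

Lemma cell_second p s j i j' i' : second p j i = (j', i') -> ~~ cell s j' i' ->
  ~~ cell (set_cell s j i) j' i'.
Proof.
move=> E h; rewrite cell_set negb_or h andbT.
by case: p E => [] [<- <-]; apply/negP=> /andP[/eqP ? /eqP ?]; lia.
Qed.

Lemma block_move_cmove p s s' : wf s -> block_move p s s' ->
  cmove S p (Board (mask (cells s))) (Board (mask (cells s'))) /\ wf s'.
Proof.
move=> w [j [i]]; case E: second => [j' i'] [h1 h2 ->].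
have [hj hi] := cell_lt w h1; have [hj' hi'] := cell_lt w h2.
have [e1 e2] := @divnD1 j i (ltnW hi); have [e1' e2'] := @divnD1 j' i' (ltnW hi').
have [w1 _] := wf_set w h1.
have h3 := cell_second E h2.
split; last exact: (wf_set w1 h3).1.
exists (N.of_nat (j * m.+1 + i)).
have -> : N.add (N.of_nat (j * m.+1 + i)) (stp S p) = N.of_nat (j' * m.+1 + i').
  by case: p E => [] [<- <-]; rewrite /stp; nia.
rewrite !testbit_cells // e1 e2 e1' e2'; split=> //; congr Board.
rewrite /clear2 -(mask_set_cell w) e1 e2 // -mask_set_cell // e1' e2' //.
Qed.

Lemma cmove_block_move s c : wf s -> cmove S Hepzibah (Board (mask (cells s))) c ->
  exists2 s', block_move Hepzibah s s' & c = Board (mask (cells s')).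
Proof.
move=> w [k]; rewrite -(N2Nat.id k) /stp.
set n := N.to_nat k; rewrite -Nat2N.inj_add !testbit_cells // => -[h1 h2 ->].
have e1 : (n + m.+1) %/ m.+1 = (n %/ m.+1).+1 by rewrite divnDr // divnn addn1.
have e2 : (n + m.+1) %% m.+1 = n %% m.+1 by rewrite modnDr.
have [w1 _] := wf_set w h1.
exists (set_cell (set_cell s (n %/ m.+1) (n %% m.+1)) (n %/ m.+1).+1 (n %% m.+1)).
  by exists (n %/ m.+1), (n %% m.+1); split=> //; move: h2; rewrite e1 e2.
rewrite /clear2 -mask_set_cell // -mask_set_cell //; last first.
  by rewrite cell_set negb_or h2 andbT e1 e2; apply/negP=> /andP[/eqP]; lia.
by rewrite e1 e2.
Qed.

Lemma snd_block_move s s' : wf s -> snd_block s -> block_move Vera s s' -> fst_block s'.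
Proof.
move=> w h /(block_move_cmove w)[mv _]; apply: (snd_winE h); exact: pmove_cons.
Qed.

Lemma fst_block_move s : wf s -> fst_block s ->
  exists2 s', block_move Hepzibah s s' & snd_block s'.
Proof.
move=> w h; inversion h as [l l' mv h' E]; move: mv h'.
move=> mv; case: (pmove_consP mv) => [[c mvc ->] h'|[? /pmove_nil]] //.
by have [s' mvs Ec] := cmove_block_move w mvc; exists s' => //; rewrite /snd_block -Ec.
Qed.

Lemma wf_rect n : wf (rect m n).
Proof. by rewrite /wf /rect all_nseq size_nseq eqxx orbT. Qed.

(** Both parts compare with the bound 0, reached weakly for the second player and strictly for the
    first; the added number 0 is then cancelled. *)
Lemma rect_bound_win n : rect_bound m n (- 1) -> snd_block (rect m n) /\ fst_block (rect m n).
Proof.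
move=> h; have z p : snd_win (cmove S) p (nums prec [:: 0%coqZ]).
  by apply: nums_snd_win; case: p.
split.
  by apply: (snd_win_cut _ (z _)); exact: (@bounded_le _ _ _ 0 h ltac:(lia)).
by apply: (fst_win_cut _ (z _)); exact: (@bounded_fst_win _ _ 0 _ h ltac:(lia)).
Qed.

End Blocks.

(** * The machine *)

Section Machine.

Variables (m W : nat).

Notation column := (m.-tuple bool).
Notation pebbles := {ffun 'I_m.+1 -> option bool}.
Notation block := ((W + W).-bseq column).

(* The pebbles are blanks on the tape whose true contents are kept in the state. [Grow] spreads
   them evenly, until the last one leaves the encoded board, so that they lie in one column;
   its counter is their distance modulo [W]. [Scan] moves them to the right and reads a block,
   [Back] moves them to the left and writes one. *)
Inductive task :=
| Grow of bool & 'I_m.+1 & 'I_W.+1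
| Scan of bool & 'I_(W + W).+1 & block
| Back of block.

Definition task_code (t : task) : (bool * 'I_m.+1 * 'I_W.+1) + (bool * 'I_(W + W).+1 * block + block) :=
  match t with
  | Grow e j k => inl (e, j, k)
  | Scan e w b => inr (inl (e, w, b))
  | Back b => inr (inr b)
  end.

Definition task_decode x : task :=
  match x with
  | inl (e, j, k) => Grow e j k
  | inr (inl (e, w, b)) => Scan e w b
  | inr (inr b) => Back b
  end.

Lemma task_codeK : cancel task_code task_decode. Proof. by case. Qed.

HB.instance Definition _ := Finite.copy task (can_type task_codeK).

(* A short input is read by [Read] and overwritten by [Write]. In a long one [Shift] deletes the
   leading bit by moving the rest to the left, and the other states carry out a [task]. *)
Inductive state :=
| Read of (m * W).+1.-bseq bool
| Skip
| Write of (m * W).+1.-bseq (option bool)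
| Shift of option bool
| Place of bool & 'I_m.+1 & pebbles
| Lift of task & 'I_m.+1 & pebbles
| Drop of task & 'I_m.+1 & pebbles
| WalkL of task & 'I_m.+1 & pebbles
| WalkR of task & 'I_m.+1 & pebbles
| Arrive of task & pebbles
| Decide of task & pebbles
| Restore of 'I_m.+1 & pebbles
| Leave of 'I_m.+1 & pebbles
| Done.

Definition state_code (q : state) :
  (m * W).+1.-bseq bool + (bool + ((m * W).+1.-bseq (option bool) + (option bool +
  (bool * 'I_m.+1 * pebbles + ('I_4 * task * 'I_m.+1 * pebbles + (bool * task * pebbles +
  bool * 'I_m.+1 * pebbles)))))) :=
  match q with
  | Read w => inl w
  | Skip => inr (inl false)
  | Done => inr (inl true)
  | Write w => inr (inr (inl w))
  | Shift c => inr (inr (inr (inl c)))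
  | Place e i v => inr (inr (inr (inr (inl (e, i, v)))))
  | Lift t i v => inr (inr (inr (inr (inr (inl (inord 0, t, i, v))))))
  | Drop t i v => inr (inr (inr (inr (inr (inl (inord 1, t, i, v))))))
  | WalkL t i v => inr (inr (inr (inr (inr (inl (inord 2, t, i, v))))))
  | WalkR t i v => inr (inr (inr (inr (inr (inl (inord 3, t, i, v))))))
  | Decide t v => inr (inr (inr (inr (inr (inr (inl (false, t, v)))))))
  | Arrive t v => inr (inr (inr (inr (inr (inr (inl (true, t, v)))))))
  | Restore i v => inr (inr (inr (inr (inr (inr (inr (false, i, v)))))))
  | Leave i v => inr (inr (inr (inr (inr (inr (inr (true, i, v)))))))
  end.

Definition state_decode x : state :=
  match x with
  | inl w => Read w
  | inr (inl b) => if b then Done else Skip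
  | inr (inr (inl w)) => Write w
  | inr (inr (inr (inl c))) => Shift c
  | inr (inr (inr (inr (inl (e, i, v))))) => Place e i v
  | inr (inr (inr (inr (inr (inl (k, t, i, v)))))) =>
      nth Lift [:: Lift; Drop; WalkL; WalkR] (nat_of_ord (k : 'I_4)) t i v
  | inr (inr (inr (inr (inr (inr (inl (b, t, v))))))) => if b then Arrive t v else Decide t v
  | inr (inr (inr (inr (inr (inr (inr (b, i, v))))))) => if b then Leave i v else Restore i v
  end.

Lemma state_codeK : cancel state_code state_decode.
Proof. by case=> //= *; rewrite inordK. Qed.

HB.instance Definition _ := Finite.copy state (can_type state_codeK).

Variables (small : seq bool -> seq bool) (fix_block : seq (seq bool) -> seq (seq bool)).

Definition put (v : pebbles) (i : 'I_m.+1) (b : option bool) : pebbles :=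
  [ffun l => if l == i then b else v l].

Definition get_column (v : pebbles) : column :=
  [tuple v (inord i) == Some true | i < m].

Definition put_column (v : pebbles) (c : column) : pebbles :=
  [ffun l : 'I_m.+1 => if l < m then Some (nth true c l) else v l].

(** One pass moves the pebbles from [lowest] to [highest] by one cell in direction [heading]. Only
    [Grow] uses pebble [m], the one that detects the end of the encoding. *)
Definition lowest (t : task) : nat := if t is Grow _ j _ then j else 0.
Definition highest (t : task) : nat := if t is Grow _ _ _ then m else m.-1.
Definition heading (t : task) : dir := if t is Back _ then DLeft else DRight.

(* The number of dominoes of the block is even, except in the first block when Hepzibah
   started. *)
Definition settled (e : bool) (b : seq (seq bool)) : bool := odd (sumn (map (count id) b))./2 == e.

(** The default values, for columns or blocks of the wrong size, only make the function total; see
    [map_to_block]. *)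
Definition to_block (s : seq (seq bool)) : block :=
  insub_bseq _ (map (fun c => insubd [tuple of nseq m true] c) s).

(** The list is reversed, because the pebbles stand on the last column of the block. A new column is
    first put into the contents held by the state; it reaches the tape when the pebbles are lifted
    or restored. *)
Definition write_back (b : seq column) (v : pebbles) : state :=
  match b with
  | [::] => Done
  | [:: c] => Restore (inord m.-1) (put_column v c)
  | c :: b' => Lift (Back (insub_bseq _ b')) (inord m.-1) (put_column v c)
  end.

(** What follows a complete pass. In [Grow], the pass with index [j] advances the pebbles [j], ...,
    [m], so the [m] passes of a sweep move pebble [l] by [l] cells and increase the common distance
    by one. If the last pebble then covers a blank, the distance is [n], and scanning starts with a
    block of width [W + n %% W]. *)
Definition decide (t : task) (v : pebbles) : state * option bool * dir :=
  match t with
  | Grow e j k =>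
    if j < m then (Lift (Grow e (inord j.+1) k) ord_max v, None, DStay)
    else if v ord_max is None then
      (Arrive (Scan e (inord (W + k)) [bseq]) v, None, DLeft)
    else (Lift (Grow e (inord 1) (inord (k.+1 %% W))) ord_max v, None, DStay)
  | Scan e w b =>
    let b' := rcons b (get_column v) in
    if size b' < w then (Lift (Scan e w (insub_bseq _ b')) (inord m.-1) v, None, DStay)
    else if settled e (map val b') then
      (Lift (Scan false (inord W) [bseq]) (inord m.-1) v, None, DStay)
    else (write_back (rev (to_block (fix_block (map val b')))) v, None, DStay)
  | Back b => (write_back b v, None, DStay)
  end.

(** A pass moves the pebbles one by one from the highest down to the lowest, after which the head
    returns to the highest. Every walk stops at the next blank, which is a pebble because the
    encoded board contains no blank. *)
Definition delta (q : state) (s : option bool) : state * option bool * dir :=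
  match q with
  | Read w =>
    match s with
    | Some b => (if size w < (m * W).+1 then Read (insub_bseq _ (rcons w b)) else Skip, s, DRight)
    (* The output lacks the leading bit of the input and is one cell shorter; the [None] erases the
       last cell of the input. *)
    | None => (if size w <= m * W then Write (insub_bseq _ (None :: rev (map some (small w))))
               else Shift None, None, DLeft)
    end
  | Skip => if s is Some _ then (Skip, s, DRight) else (Shift None, None, DLeft)
  | Write l =>
    match val l with
    | [::] => (Done, s, DStay)
    | [:: x] => (Done, x, DStay)
    | x :: l' => (Write (insub_bseq _ l'), x, DLeft)
    end
  | Shift c =>
    if s is Some _ then (Shift s, c, DLeft)
    (* At the blank to the left of the input, [c] is the leading bit, in which [false] stands for
       Hepzibah. *)
    else (Place (c == Some false) ord0 [ffun=> None], None, DRight)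
  | Place e i v =>
    if i < m then (Place e (inord i.+1) (put v i s), None, DRight)
    else (Decide (Grow e ord_max (inord 1)) (put v i s), None, DStay)
  | Lift t i v => (Drop t i v, v i, heading t)
  | Drop t i v =>
    if lowest t < i then (WalkL t (inord i.-1) (put v i s), None, DLeft)
    else if i == highest t :> nat then (Decide t (put v i s), None, DStay)
    else (WalkR t (inord i.+1) (put v i s), None, DRight)
  | WalkL t i v => if s is Some _ then (q, s, DLeft) else (Lift t i v, None, DStay)
  | WalkR t i v =>
    if s is Some _ then (q, s, DRight)
    else if i == highest t :> nat then (Decide t v, None, DStay)
    else (WalkR t (inord i.+1) v, None, DRight)
  | Arrive t v => if s is Some _ then (q, s, DLeft) else (Decide t v, None, DStay)
  | Decide t v => decide t v
  | Restore i v =>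
    if i == ord0 then (Done, v i, DStay) else (Leave (inord i.-1) v, v i, DLeft)
  | Leave i v => if s is Some _ then (q, s, DLeft) else (Restore i v, None, DStay)
  | Done => (Done, s, DStay)
  end.

Definition machine : TM :=
  {| tm_state := state; tm_start := Read [bseq];
     tm_halt := fun q => if q is Done then true else false; tm_delta := delta |}.

(** * Runs of the machine and their length *)

Definition ext (tn : nat -> option bool) (x : int) : option bool :=
  if x is Posz k then tn k else None.

Definition upd (tn : nat -> option bool) (h : nat) (w : option bool) : nat -> option bool :=
  fun k => if k == h then w else tn k.

(** Head and contents are confined to the natural positions. Only the end of [Shift] leaves them, to
    look at cell -1. *)
Definition cfg (q : state) (tn : nat -> option bool) (h : nat) : config machine :=
  @Config machine q (ext tn) (Posz h).

Definition reach (t : nat) (c c' : config machine) :=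
  exists2 k, k <= t & iter k (@tm_step machine) c = c'.

Lemma reach0 c : reach 0 c c.
Proof. by exists 0. Qed.

Lemma reach_trans t1 t2 c1 c2 c3 : reach t1 c1 c2 -> reach t2 c2 c3 -> reach (t1 + t2) c1 c3.
Proof.
move=> [k1 h1 e1] [k2 h2 e2]; exists (k2 + k1); first by rewrite addnC leq_add.
by rewrite iterD e1.
Qed.

Lemma reach_leq t t' c c' : t <= t' -> reach t c c' -> reach t' c c'.
Proof. by move=> h [k hk e]; exists k => //; apply: leq_trans h. Qed.

Lemma updE tn h w : ext (upd tn h w) = (fun j => if j == Posz h then w else ext tn j).
Proof. by apply: functional_extensionality => -[k|k]. Qed.

Lemma upd_id tn h : upd tn h (tn h) = tn.
Proof. by apply: functional_extensionality => k; rewrite /upd; case: eqP => [->|]. Qed.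

Lemma stepE q tn h : ~~ @tm_halt machine q ->
  tm_step (cfg q tn h) =
  let: (q', w, d) := delta q (tn h) in
  @Config machine q' (ext (upd tn h w))
    (match d with
     | DLeft => (Posz h - 1)%R
     | DRight => (Posz h + 1)%R
     | DStay => Posz h end).
Proof.
move=> hq; rewrite /tm_step [cf_state _]/= (negbTE hq) [tm_delta _ _]/=.
by case: delta => [[q' w] d]; rewrite updE.
Qed.

Lemma reach_right q tn h q' w : ~~ @tm_halt machine q -> delta q (tn h) = (q', w, DRight) ->
  reach 1 (cfg q tn h) (cfg q' (upd tn h w) h.+1).
Proof.
by move=> hq E; exists 1 => //; rewrite [iter _ _ _]/= stepE // E /cfg -addn1.
Qed.

Lemma reach_left q tn h q' w : ~~ @tm_halt machine q -> delta q (tn h.+1) = (q', w, DLeft) ->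
  reach 1 (cfg q tn h.+1) (cfg q' (upd tn h.+1 w) h).
Proof.
move=> hq E; exists 1 => //; rewrite [iter _ _ _]/= stepE // E /cfg.
by congr Config; lia.
Qed.

Lemma reach_stay q tn h q' w : ~~ @tm_halt machine q -> delta q (tn h) = (q', w, DStay) ->
  reach 1 (cfg q tn h) (cfg q' (upd tn h w) h).
Proof. by move=> hq E; exists 1 => //; rewrite [iter _ _ _]/= stepE // E. Qed.

Lemma walk_left q tn h d : ~~ @tm_halt machine q ->
  (forall b, delta q (Some b) = (q, Some b, DLeft)) ->
  (forall x, h < x <= h + d -> tn x <> None) -> reach d (cfg q tn (h + d)) (cfg q tn h).
Proof.
move=> hq hd; elim: d => [|d IH] nb; first by rewrite addn0; apply: reach0.
rewrite addnS -add1n; apply: (@reach_trans _ _ _ (cfg q tn (h + d))); last first.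
  by apply: IH => x /andP[h1 h2]; apply: nb; rewrite h1 addnS leqW.
have := nb (h + d).+1; case E: (tn (h + d).+1) => [b|]; last by case => //; lia.
by move=> _; have := @reach_left q tn (h + d) q (tn (h + d).+1) hq; rewrite upd_id E; apply; apply: hd.
Qed.

Lemma walk_right q tn h d : ~~ @tm_halt machine q ->
  (forall b, delta q (Some b) = (q, Some b, DRight)) ->
  (forall x, h <= x < h + d -> tn x <> None) -> reach d (cfg q tn h) (cfg q tn (h + d)).
Proof.
move=> hq hd; elim: d h => [|d IH] h nb; first by rewrite addn0; apply: reach0.
rewrite addnS -addSn -add1n; apply: (@reach_trans _ _ _ (cfg q tn h.+1)); last first.
  by apply: IH => x /andP[h1 h2]; apply: nb; rewrite (ltnW h1) addnS -addSn.
have := nb h; case E: (tn h) => [b|]; last by case => //; lia.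
by move=> _; have := @reach_right q tn h q (tn h) hq; rewrite upd_id E; apply; apply: hd.
Qed.

End Machine.

Section Run.

Variables (m W : nat) (small : seq bool -> seq bool) (fix_block : seq (seq bool) -> seq (seq bool)).

Local Notation pebbles := {ffun 'I_m.+1 -> option bool}.
Local Notation column := (m.-tuple bool).
Local Notation cfg := (@cfg m W small fix_block).
Local Notation reach := (@reach m W small fix_block).
Local Notation machine := (machine m W small fix_block).
Local Notation delta := (@delta m W small fix_block).

Definition blank (T : nat -> option bool) (p : nat -> nat) (P : nat) : nat -> option bool :=
  fun k => if has (fun l => p l == k) (iota 0 P) then None else T k.

(** The invariant while pebbles are out: the tape is [blank T p P], and the state holds what is
    missing from [T]. *)
Definition held (v : pebbles) (T : nat -> option bool) (p : nat -> nat) (P : nat) :=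
  forall l, l < P -> v (inord l) = T (p l).

Lemma blankP T p P k :
  (exists2 l, l < P & p l = k) /\ blank T p P k = None \/
  (forall l, l < P -> p l <> k) /\ blank T p P k = T k.
Proof.
rewrite /blank; case: hasP => [[l]|h].
  by rewrite mem_iota => hl /eqP E; left; split=> //; exists l.
by right; split=> // l hl E; apply: h; exists l; rewrite ?mem_iota ?E.
Qed.

Lemma blank_pebble T p P l : l < P -> blank T p P (p l) = None.
Proof. by move=> hl; case: (blankP T p P (p l)) => [[]//|[/(_ l hl)]]. Qed.

Lemma blank_free T p P k : (forall l, l < P -> p l <> k) -> blank T p P k = T k.
Proof. by move=> h; case: (blankP T p P k) => [[[l hl /(h l hl)]]|[]]. Qed.

Lemma eq_blank T p p' P : (forall l, l < P -> p l = p' l) -> blank T p P = blank T p' P.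
Proof.
move=> h; apply: functional_extensionality => k; rewrite /blank.
by congr (if _ then _ else _); apply: eq_in_has => l; rewrite mem_iota => /h ->.
Qed.

Lemma eq_blank_content T T' p P : (forall k, (forall l, l < P -> p l <> k) -> T k = T' k) ->
  blank T p P = blank T' p P.
Proof.
move=> h; apply: functional_extensionality => k.
case: (blankP T p P k) => [[[l hl <-] ->]|[hk ->]]; first by rewrite blank_pebble.
by rewrite blank_free // h.
Qed.

Lemma stay_blank x x' tn h : ~~ @tm_halt machine x -> tn h = None ->
  delta x None = (x', None, DStay) -> reach 1 (cfg x tn h) (cfg x' tn h).
Proof.
move=> hx hn E; have := @reach_stay m W small fix_block x tn h x' (tn h) hx.
by rewrite upd_id hn; apply.
Qed.

Lemma right_blank x x' tn h : ~~ @tm_halt machine x -> tn h = None ->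
  delta x None = (x', None, DRight) -> reach 1 (cfg x tn h) (cfg x' tn h.+1).
Proof.
move=> hx hn E; have := @reach_right m W small fix_block x tn h x' (tn h) hx.
by rewrite upd_id hn; apply.
Qed.

Lemma left_blank x x' tn h : ~~ @tm_halt machine x -> tn h.+1 = None ->
  delta x None = (x', None, DLeft) -> reach 1 (cfg x tn h.+1) (cfg x' tn h).
Proof.
move=> hx hn E; have := @reach_left m W small fix_block x tn h x' (tn h.+1) hx.
by rewrite upd_id hn; apply.
Qed.

(** * One pass over the pebbles *)

Section Pass.

Variables (T : nat -> option bool) (N : nat) (t : task m W).
Hypothesis nonblank : forall k, k < N -> T k <> None.

Local Notation low := (lowest t).
Local Notation top := (highest t).
Local Notation P := (highest t).+1.

(* [p] and [p'] are the positions of the pebbles before and after the pass. *)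
Variables (p p' : nat -> nat).
Hypothesis low_top : low <= top.
Hypothesis top_m : top <= m.
Hypothesis before : forall l l', l < l' -> l' < P -> p l < p l'.
Hypothesis during : forall l l', l < l' -> l' < P -> low <= l' -> p l < p' l'.
Hypothesis after : forall l l', l < l' -> l' < P -> low <= l -> p' l < p' l'.
Hypothesis unmoved : forall l, l < low -> p' l = p l.
Hypothesis moved : forall l, low <= l -> l < P ->
  if heading t is DLeft then p l = (p' l).+1 else p' l = (p l).+1.
Hypothesis p_N : forall l, l < P -> p l <= N.
Hypothesis p'_N : forall l, l < P -> p' l <= N.

(** The positions when the pebbles from [i] upwards have moved, since a pass proceeds from the
    highest pebble down. The hypotheses [before], [during] and [after] keep these positions
    increasing, so no pebble lands on another. *)
Let q i := fun l => if i <= l then p' l else p l.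

Lemma q_mono i l l' : low <= i -> l < l' -> l' < P -> q i l < q i l'.
Proof.
move=> hi ll' hl'; rewrite /q; case: (leqP i l) => h1; case: (leqP i l') => h2.
- exact: after ll' hl' (leq_trans hi h1).
- by lia.
- exact: during ll' hl' (leq_trans hi h2).
- exact: before.
Qed.

Lemma q_inj i l l' : low <= i -> l < P -> l' < P -> q i l = q i l' -> l = l'.
Proof.
move=> hi hl hl' E; case: (ltngtP l l') => // h.
  by have := q_mono hi h hl'; rewrite E ltnn.
by have := q_mono hi h hl; rewrite E ltnn.
Qed.

Lemma q_N i l : l < P -> q i l <= N.
Proof. by rewrite /q; case: (leqP i l) => _ h; [apply: p'_N | apply: p_N]. Qed.

(** The tape [tn] still shows the true content under the head. The step of [Drop] that blanks it
    depends on where the head goes next and is left to the callers. *)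
Lemma lift_drop i v : low <= i -> i < P -> held v T (q i.+1) P ->
  exists tn, [/\ reach 1 (cfg (Lift t (inord i) v) (blank T (q i.+1) P) (p i))
                         (cfg (Drop t (inord i) v) tn (p' i)),
                 tn (p' i) = T (p' i) & upd tn (p' i) None = blank T (q i) P] /\
    held (put v (inord i) (T (p' i))) T (q i) P.
Proof.
move=> hi hiP hv; set b := blank T (q i.+1) P; exists (upd b (p i) (T (p i))).
have qi : q i.+1 i = p i by rewrite /q ltnn.
have qi' : q i i = p' i by rewrite /q leqnn.
have qE l : l != i -> q i.+1 l = q i l by rewrite /q => ne; case: (leqP i.+1 l); case: (leqP i l) => //; lia.
have pp' : p' i <> p i by have := moved hi hiP; case: heading; lia.
have dv : delta (Lift t (inord i) v) (b (p i)) = (Drop t (inord i) v, T (p i), heading t).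
  by rewrite /= hv ?qi.
have free l : l < P -> l != i -> q i.+1 l <> p' i.
  by move=> hl ne; rewrite qE // -qi' => /(q_inj hi hl hiP) E; rewrite E eqxx in ne.
split; first split.
- have := moved hi hiP; case E: (heading t) dv => dv hm.
  + by rewrite hm in dv *; apply: reach_left.
  + by rewrite hm; apply: reach_right.
  + by case: (t) E.
- rewrite /upd; case: eqP => [/pp'//|_]; apply: blank_free => l hl.
  by have [->|ne] := eqVneq l i; [rewrite qi; lia | apply: free].
- apply: functional_extensionality => k; rewrite /upd.
  case: eqP => [->|nk']; first by rewrite -qi' blank_pebble.
  case: eqP => [->|nk].
    rewrite blank_free // => l hl; have [->|ne] := eqVneq l i; first by rewrite qi'.
    rewrite -qE // -qi => /(q_inj (leqW hi) hl hiP) E; by rewrite E eqxx in ne.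
  case: (blankP T (q i) P k) => [[[l hl El] ->]|[h ->]].
    have ne : l != i by apply/eqP=> E; apply: nk'; rewrite -El E.
    by rewrite -El -qE // /b blank_pebble.
  rewrite /b blank_free // => l hl; have [->|ne] := eqVneq l i; first by rewrite qi; lia.
  by rewrite qE //; apply: h.
- move=> l hl; rewrite /put ffunE.
  have [->|ne] := eqVneq l i; first by rewrite eqxx qi'.
  have -> : (inord l == inord i :> 'I_m.+1) = false.
    apply/eqP => /(congr1 val) /=; rewrite !inordK; [|lia|lia]; exact/eqP.
  by rewrite hv // qE.
Qed.

Lemma halt_state (x : @state m W) : (if x is Done then false else true) ->
  ~~ @tm_halt machine x.
Proof. by case: x. Qed.

Lemma between j i x : low <= j -> i.+1 < P -> q j i < x < q j i.+1 ->
  blank T (q j) P x <> None.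
Proof.
move=> hj hi /andP[h1 h2]; rewrite blank_free => [|k hk].
  by apply: nonblank; apply: leq_trans h2 (q_N _ hi).
have [ki|ki] := leqP k i.
  have [->|ne] := eqVneq k i; first by lia.
  have := @q_mono j k i hj ltac:(lia) (ltnW hi); lia.
have [->|ne] := eqVneq k i.+1; first by lia.
have := @q_mono j i.+1 k hj ltac:(lia) hk; lia.
Qed.

Lemma pass_down d v : low + d <= top ->
  held v T (q (low + d).+1) P ->
  exists v' tn, [/\ reach ((N + 3) * d + 1)
        (cfg (Lift t (inord (low + d)) v) (blank T (q (low + d).+1) P) (p (low + d)))
        (cfg (Drop t (inord low) v') tn (p' low)),
     tn (p' low) = T (p' low), upd tn (p' low) None = blank T (q low) P &
     held (put v' (inord low) (T (p' low))) T (q low) P].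
Proof.
elim: d v => [|d IH] v; rewrite ?addn0 ?addnS => hd hv.
  have [tn [[h1 h2 h3] h4]] := lift_drop (leqnn low) low_top hv.
  by exists v, tn; rewrite muln0.
set i := (low + d).+1 in hd hv *.
have hi : low <= i by rewrite /i; lia.
have [tn [[h1 h2 h3] h4]] := lift_drop hi hd hv.
have [v' [tn' [g1 g2 g3 g4]]] := IH _ (ltnW hd) h4.
exists v', tn'; split=> //.
have qi1 : q i (low + d) = p (low + d) by rewrite /q /i ltnn.
have lt : p (low + d) < p' i by apply: during.
have Ep : p' i = (p' i).-1.+1 by lia.
apply: (@reach_leq _ _ _ _ (1 + (1 + (((p' i).-1 - p (low + d)) + (1 + ((N + 3) * d + 1)))))).
  by have := @p'_N i hd; rewrite mulnS; lia.
apply: (reach_trans h1); set v1 := put _ _ _ in h4 g1.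
apply: (@reach_trans _ _ _ _ _ _ _ (cfg (WalkL t (inord (low + d)) v1) (blank T (q i) P) (p' i).-1)).
  rewrite -h3 {1 2}Ep; apply: reach_left; first exact: halt_state.
  by rewrite -Ep h2 /= inordK /i; [rewrite ifT //=; lia | lia].
apply: (@reach_trans _ _ _ _ _ _ _ (cfg (WalkL t (inord (low + d)) v1) (blank T (q i) P) (p (low + d)))).
  have ED : (p' i).-1 = p (low + d) + ((p' i).-1 - p (low + d)) by lia.
  rewrite {2}ED.
  apply: walk_left; [exact: halt_state | by [] |].
  move=> x; rewrite -ED.
  by move=> hx; apply: (between (j := i) (i := low + d)) => //; rewrite qi1 /q leqnn -/i; lia.
apply: reach_trans g1.
have nb : blank T (q i) P (p (low + d)) = None by rewrite -qi1 blank_pebble //; move: hd; rewrite /i; lia.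
by apply: stay_blank => //; exact: halt_state.
Qed.

Lemma pass_up d i v : i + d = top -> low <= i ->
  reach ((N + 3) * d + 1)
    (cfg (if i == top then Decide t v else WalkR t (inord i.+1) v) (blank T (q low) P)
         (if i == top then p' i else (p' i).+1))
    (cfg (Decide t v) (blank T (q low) P) (p' top)).
Proof.
elim: d i => [|d IH] i hd hi.
  by have -> : i = top by [lia]; rewrite eqxx; apply: reach_leq (reach0 _).
have -> : (i == top) = false by lia.
have ht : i.+1 < P by lia.
have lt : p' i < p' i.+1 by apply: after.
have qE l : low <= l -> q low l = p' l by rewrite /q => ->.
apply: (@reach_leq _ _ _ _ ((p' i.+1 - (p' i).+1) + (1 + ((N + 3) * d + 1)))).
  by have := p'_N ht; rewrite mulnS; lia.
apply: (@reach_trans _ _ _ _ _ _ _ (cfg (WalkR t (inord i.+1) v) (blank T (q low) P) (p' i.+1))).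
  have ED : p' i.+1 = (p' i).+1 + (p' i.+1 - (p' i).+1) by lia.
  rewrite {2}ED.
  apply: walk_right; [exact: halt_state | by [] |].
  by move=> x; rewrite -ED => hx; apply: (between (i := i)) => //; rewrite !qE //; lia.
apply: reach_trans (IH i.+1 ltac:(lia) ltac:(lia)).
have nb : blank T (q low) P (p' i.+1) = None by rewrite -qE ?blank_pebble //; lia.
have Ei : (inord i.+1 : 'I_m.+1) = i.+1 :> nat by rewrite inordK //; lia.
case: (eqVneq i.+1 top) => E.
  by apply: stay_blank => //=; rewrite Ei E eqxx.
by apply: right_blank => //=; rewrite Ei (negbTE E).
Qed.

(** Each of the at most [m + 1] pebbles is visited on the way down and on the way up, and a visit
    costs a walk of at most [N] cells and a few steps. *)
Lemma pass v : held v T p P ->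
  exists v', held v' T p' P /\
    reach ((N + 3) * (2 * m + 2)) (cfg (Lift t (inord top) v) (blank T p P) (p top))
                                  (cfg (Decide t v') (blank T p' P) (p' top)).
Proof.
move=> hv; have Etop : low + (top - low) = top by lia.
have E1 : blank T p P = blank T (q top.+1) P.
  by apply: eq_blank => l hl; rewrite /q ifN // -ltnNge.
have E2 : blank T (q low) P = blank T p' P.
  by apply: eq_blank => l hl; rewrite /q; case: leqP => // h; rewrite unmoved.
have [|v' [tn [h1 h2 h3 h4]]] := @pass_down (top - low) v ltac:(lia).
  by rewrite Etop => l hl; rewrite hv // /q ifN // -ltnNge.
rewrite Etop in h1; set v1 := put _ _ _ in h4.
exists v1; split.
  by move=> l hl; rewrite h4 // /q; case: leqP => // h; rewrite unmoved.
apply: (@reach_leq _ _ _ _ (((N + 3) * (top - low) + 1) + (1 + ((N + 3) * (top - low) + 1)))).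
  have : (N + 3) * (top - low) <= (N + 3) * m by rewrite leq_mul2l; apply/orP; right; lia.
  nia.
rewrite E1 -E2; apply: (reach_trans h1).
apply: reach_trans (pass_up v1 Etop (leqnn _)); rewrite -h3.
have Ei : (inord low : 'I_m.+1) = low :> nat by rewrite inordK //; lia.
case E: (low == top).
  by apply: reach_stay => //; rewrite h2 /= Ei ltnn E.
by apply: reach_right => //; rewrite h2 /= Ei ltnn E.
Qed.

End Pass.

(** * Short inputs: reading all and writing the answer *)

Local Notation capacity := (m * W).+1.

Definition on_tape (I : seq bool) (k : nat) : option bool :=
  if k < size I then Some (nth false I k) else None.

Lemma init_cfg I : tm_init machine I = cfg (@Read m W [bseq]) (on_tape I) 0.
Proof. by congr Config; apply: functional_extensionality => -[]. Qed.

Lemma halt_tape_output tn I h : tn = on_tape I ->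
  tape_output (cfg (Done m W) tn h) I.
Proof. by move=> ->; split=> [i hi|]; rewrite /= /on_tape ?hi // ltnn. Qed.

Lemma reading I h : h <= size I -> h <= capacity ->
  exists w : capacity.-bseq bool, [/\ val w = take h I, size w = h &
    reach h (cfg (@Read m W [bseq]) (on_tape I) 0) (cfg (@Read m W w) (on_tape I) h)].
Proof.
elim: h => [|h IH] h1 h2; first by exists [bseq]; rewrite take0; split=> //; apply: reach0.
have [w [e1 e2 r]] := IH (ltnW h1) (ltnW h2).
have Ew : val (insub_bseq capacity (rcons w (nth false I h))) = take h.+1 I.
  by rewrite /insub_bseq val_insubd size_rcons e2 h2 e1 (take_nth false).
exists (insub_bseq capacity (rcons w (nth false I h))); split=> //.
  by rewrite -[size _]/(size (val _)) Ew size_takel.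
rewrite -addn1; apply: (reach_trans r).
rewrite -{2}(upd_id (on_tape I) h); rewrite addn1; apply: reach_right => //.
by rewrite /on_tape h1 /= e2 h2.
Qed.

Lemma writing l (h : nat) tn (lb : capacity.-bseq (option bool)) : val lb = l -> size l = h.+1 ->
  exists h', reach h.+1 (cfg (@Write m W lb) tn h)
    (cfg (Done m W) (fun k => if k <= h then nth None (rev l) k else tn k) h').
Proof.
elim: l h tn lb => // x l IH h tn lb El [sz].
case: l IH El sz => [|y l] IH El sz.
  have h0 : h = 0 by [].
  subst h; exists 0; have <- : upd tn 0 x = (fun k => if k <= 0 then nth None (rev [:: x]) k else tn k).
    by apply: functional_extensionality => -[].
  by apply: reach_stay => //; rewrite /= El.
case: h sz => // h sz.
set lb1 : capacity.-bseq (option bool) := insub_bseq _ (y :: l).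
have El1 : val lb1 = y :: l.
  rewrite /lb1 /insub_bseq val_insubd ifT //.
  by have := size_bseq lb; rewrite -[size lb]/(size (val lb)) El /=; lia.
have [h' r] := IH h (upd tn h.+1 x) lb1 El1 sz.
exists h'; rewrite -add1n.
have -> : (fun k => if k <= h.+1 then nth None (rev (x :: y :: l)) k else tn k) =
          (fun k => if k <= h then nth None (rev (y :: l)) k else upd tn h.+1 x k).
  apply: functional_extensionality => k; rewrite rev_cons nth_rcons size_rev sz /upd.
  by case: (ltngtP k h.+1) => h1; [rewrite -ltnS h1 | rewrite leqNgt (ltnW h1) | rewrite h1 ltnn].
apply: reach_trans r; apply: reach_left => //.
by rewrite /= El.
Qed.

Lemma run_small f I : (size I).+1 <= m * W -> size (small (f :: I)) = size I ->
  exists2 t, t <= 3 * (m * W) + 3 & tm_runs machine (f :: I) t (small (f :: I)).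
Proof.
move=> hI hs; set J := f :: I; rewrite -/J in hs.
have [w [e1 e2 r1]] := @reading J (size J) (leqnn _) (leq_trans hI (leqnSn _)).
rewrite take_size in e1.
set l := None :: rev (map some (small J)).
have sl : size l = (size I).+1 by rewrite /l /= size_rev size_map hs.
set lb : capacity.-bseq (option bool) := insub_bseq _ l.
have Elb : val lb = l by rewrite /lb /insub_bseq val_insubd ifT // sl; lia.
have [h' r2] := @writing l (size I) (on_tape J) lb Elb sl.
have r12 : reach 1 (cfg (@Read m W w) (on_tape J) (size J)) (cfg (@Write m W lb) (on_tape J) (size I)).
  apply: left_blank => //; first by rewrite /on_tape ltnn.
  by rewrite /= e2 ifT // -[w in small w]/(val w) e1.
have [t ht Et] := reach_trans r1 (reach_trans r12 r2).
exists t; first by apply: leq_trans ht _; rewrite /J /=; lia.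
rewrite /tm_runs init_cfg Et; split=> //; apply: halt_tape_output.
apply: functional_extensionality => k; rewrite /on_tape hs /= /l rev_cons revK nth_rcons size_map hs.
case: (ltngtP k (size I)) => h; first by rewrite (nth_map false) ?hs.
  by rewrite ltnS leqNgt h.
by [].
Qed.

(** * Long inputs: deleting the leading bit *)

Section Large.

Variables (f : bool) (I : seq bool).
Hypothesis large : m * W <= size I.
Local Notation J := (f :: I).

Lemma to_shift :
  reach (size J + 2) (cfg (@Read m W [bseq]) (on_tape J) 0) (cfg (Shift m W None) (on_tape J) (size I)).
Proof.
have [w [e1 e2 r1]] := @reading J capacity large (leqnn _).
case: (eqVneq (size I) (m * W)) => E.
  apply: (@reach_leq _ _ _ _ (capacity + 1)); first by rewrite /= E; lia.
  apply: (reach_trans r1); rewrite -E; apply: left_blank => //.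
    by rewrite /on_tape /= ltnn.
  by rewrite /= e2 ltnn.
have lt : m * W < size I by lia.
apply: (@reach_leq _ _ _ _ (capacity + (1 + ((size J - capacity.+1) + 1)))); first by rewrite /=; lia.
apply: (reach_trans r1).
apply: (@reach_trans _ _ _ _ _ _ _ (cfg (Skip m W) (on_tape J) capacity.+1)).
  rewrite -{2}(upd_id (on_tape J) capacity); apply: reach_right => //.
  rewrite /on_tape ifT; last by rewrite /=; lia.
  by rewrite [delta _ _]/= e2 ltnn.
apply: (@reach_trans _ _ _ _ _ _ _ (cfg (Skip m W) (on_tape J) (size J))).
  have ED : size J = capacity.+1 + (size J - capacity.+1) by rewrite /=; lia.
  rewrite {2}ED; apply: walk_right => // x; rewrite -ED => /andP[_ hx].
  by rewrite /on_tape hx.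
by apply: left_blank => //; rewrite /on_tape ltnn.
Qed.

(* The contents of the cells after [h] have been moved one cell to the left. *)
Definition shifted (h : nat) (k : nat) : option bool := on_tape J (if h < k then k.+1 else k).

Lemma shifting h : h <= size I ->
  reach (h + 2) (cfg (Shift m W (on_tape J h.+1)) (shifted h) h)
    (cfg (Place W (~~ f) ord0 [ffun=> None]) (on_tape I) 0).
Proof.
have next k : upd (shifted k) k (on_tape J k.+1) = (fun l => on_tape J (if k <= l then l.+1 else l)).
  apply: functional_extensionality => l; rewrite /upd /shifted.
  by case: (ltngtP k l) => // ->.
elim: h => [|h IH] hI; last first.
  rewrite addSn -add1n; apply: reach_trans (IH (ltnW hI)).
  have -> : shifted h = upd (shifted h.+1) h.+1 (on_tape J h.+2).
    by rewrite next; apply: functional_extensionality => l; rewrite /shifted.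
  apply: reach_left => //=.
  by rewrite /shifted ltnn /on_tape /= ltnS hI.
(* The last two steps pass through cell -1, which [cfg] cannot express, so they are computed
   directly. *)
exists 2 => //; rewrite [iter _ _ _]/= stepE // /shifted ltnn.
rewrite [on_tape J 0]/= [delta _ _]/=.
rewrite /tm_step /= -/(shifted 0) next; congr Config.
  by rewrite /on_tape /=; congr (Place _ _ _ _); case: f.
by apply: functional_extensionality => -[[|k]|[|k]].
Qed.

Lemma to_place :
  reach (2 * size I + 6) (cfg (@Read m W [bseq]) (on_tape J) 0)
    (cfg (Place W (~~ f) ord0 [ffun=> None]) (on_tape I) 0).
Proof.
apply: (@reach_leq _ _ _ _ ((size J + 2) + (size I + 2))); first by rewrite /=; lia.
apply: (reach_trans to_shift); have := shifting (leqnn (size I)).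
have -> : shifted (size I) = on_tape J.
  apply: functional_extensionality => k; rewrite /shifted; case: ltnP => // h.
  by rewrite /on_tape /= !ifN //; lia.
by rewrite {1}/on_tape /= ltnn.
Qed.

End Large.

(** * Finding the width and the columns *)

Hypothesis m_gt1 : 1 < m.
Hypothesis W_gt1 : 1 < W.

Variable n : nat.
Hypothesis W_le_n : W <= n.

Local Notation N := (m * n).
Local Notation at_column c := (fun l => l * n + c).

(* The row-major encoding of a list of [n] columns. *)
Definition content (cs : seq (seq bool)) (k : nat) : option bool :=
  if k < m * n then Some (cell cs (k %% n) (k %/ n)) else None.

Definition pass_time := (N + 3) * (2 * m + 2).

Lemma content_lt cs k : k < N -> content cs k <> None.
Proof. by rewrite /content => ->. Qed.

Lemma content_at cs l c : l < m -> c < n -> content cs (l * n + c) = Some (cell cs c l).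
Proof.
move=> hl hc; have n0 : 0 < n by apply: leq_ltn_trans hc.
rewrite /content ifT; last by nia.
by rewrite modnMDl modn_small // divnMDl // divn_small // addn0.
Qed.

Section Fixed.

Variable cs : seq (seq bool).

Local Notation T := (content cs).

Lemma place e i v : i <= m -> held v T id i ->
  exists v', held v' T id m.+1 /\
    reach (m - i + 1) (cfg (Place W e (inord i) v) (blank T id i) i)
                      (cfg (Decide (Grow e ord_max (inord 1)) v') (blank T id m.+1) m).
Proof.
move Ed: (m - i) => d; elim: d i v Ed => [|d IH] i v Ed hi hv.
all: have Ei : (inord i : 'I_m.+1) = i :> nat by rewrite inordK //; lia.
all: have r : blank T id i i = T i by apply: blank_free; lia.
all: have w : upd (blank T id i) i None = blank T id i.+1.
1,3: apply: functional_extensionality => k; rewrite /upd; case: eqP => [->|nk];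
  [by rewrite -[X in blank _ _ _ X]/(id i) blank_pebble|];
  case: (blankP T id i k) => [[[l hl <-] ->]|[h ->]];
  [by rewrite blank_pebble //; lia | by rewrite blank_free // => l hl; have := h l; rewrite /=; lia].
all: have hv' : held (put v (inord i) (T i)) T id i.+1.
1,3: move=> l hl; rewrite /put ffunE -val_eqE /= !inordK; [|lia|lia];
  by case: eqP => [->//|ne]; apply: hv; lia.
  have Em : i = m by lia.
  subst i; exists (put v (inord m) (T m)); split=> //.
  rewrite -w; apply: reach_leq (leq_addl _ _) _; apply: reach_stay => //.
  by rewrite r /= Ei ltnn.
have E1 : m - i.+1 = d by lia.
have E2 : i.+1 <= m by lia.
have [v' [h1 h2]] := IH i.+1 _ E1 E2 hv'.
exists v'; split=> //; rewrite addSn -add1n; apply: reach_trans h2.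
rewrite -w; apply: reach_right => //.
by rewrite r /= Ei ifT //; lia.
Qed.

(** Within a sweep that starts at distance [kk], pebble [l] has advanced by [minn l j] after the
    first [j] passes. *)
Lemma grow_pass e (j kk : nat) (k : 'I_W.+1) v : 0 < kk < n -> 0 < j <= m ->
  held v T (fun l => l * kk + minn l j.-1) m.+1 ->
  exists v', held v' T (fun l => l * kk + minn l j) m.+1 /\
    reach pass_time
      (cfg (Lift (Grow e (inord j) k) ord_max v) (blank T (fun l => l * kk + minn l j.-1) m.+1)
           (m * kk + j.-1))
      (cfg (Decide (Grow e (inord j) k) v') (blank T (fun l => l * kk + minn l j) m.+1)
           (m * kk + j)).
Proof.
move=> hk hj hv.
have Ej : (inord j : 'I_m.+1) = j :> nat by rewrite inordK //; lia.
have Em : ord_max = inord m :> 'I_m.+1 by apply: val_inj; rewrite /= inordK.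
have mono l l' : l < l' -> l * kk + kk <= l' * kk by move=> h; rewrite -mulSnr leq_mul2r h orbT.
have bd l : l <= m -> l * kk + l <= N.
  by move=> h; rewrite -mulnSr; apply: leq_mul => //; case/andP: hk.
have [] := @pass T N (Grow e (inord j) k) (@content_lt cs)
   (fun l => l * kk + minn l j.-1) (fun l => l * kk + minn l j) _ _ _ _ _ _ _ _ _ v hv.
- by rewrite /= Ej; lia.
- by [].
- by move=> l l' h _; have := mono _ _ h; lia.
- by move=> l l' h _ _; have := mono _ _ h; lia.
- by move=> l l' h _ _; have := mono _ _ h; lia.
- by rewrite /= Ej => l h; lia.
- by rewrite /= Ej => l h1 h2; lia.
- by move=> l h; have := bd l h; lia.
- by move=> l h; have := bd l h; lia.
move=> v' [h1 h2]; exists v'; split=> //; move: h2; rewrite /= -Em.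
by have -> : minn m j.-1 = j.-1 by [lia]; have -> : minn m j = j by [lia].
Qed.

Lemma grow_sweep e (j kk : nat) (k : 'I_W.+1) v : 0 < kk < n -> 0 < j <= m ->
  held v T (fun l => l * kk + minn l j.-1) m.+1 ->
  exists v', held v' T (fun l => l * kk.+1) m.+1 /\
    reach ((m - j).+1 * pass_time.+1)
      (cfg (Lift (Grow e (inord j) k) ord_max v) (blank T (fun l => l * kk + minn l j.-1) m.+1)
           (m * kk + j.-1))
      (cfg (Decide (Grow e ord_max k) v') (blank T (fun l => l * kk.+1) m.+1) (m * kk.+1)).
Proof.
move Ed: (m - j) => d; elim: d j v Ed => [|d IH] j v Ed hk hj hv;
  have [v1 [h1 r1]] := grow_pass e k hk hj hv.
  have Ej : j = m by lia.
  have eqp l : l < m.+1 -> l * kk + minn l j = l * kk.+1 by rewrite mulnSr; lia.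
  exists v1; split; first by move=> l hl; rewrite h1 // eqp.
  rewrite mul1n; apply: reach_leq (leqnSn _) _.
  rewrite -(@eq_blank T (fun l => l * kk + minn l j) (fun l => l * kk.+1) m.+1 eqp).
  have -> : m * kk.+1 = m * kk + j by rewrite mulnSr; lia.
  have <- : inord j = ord_max :> 'I_m.+1 by apply: val_inj; rewrite /= inordK; lia.
  by move: r1; rewrite [X in Lift _ X _](_ : _ = inord j) //; apply: val_inj; rewrite /= inordK; lia.
have E1 : m - j.+1 = d by lia.
have E2 : 0 < j.+1 <= m by lia.
have [v2 [h2 r2]] := IH j.+1 v1 E1 hk E2 h1.
exists v2; split=> //.
apply: (@reach_leq _ _ _ _ (pass_time + (1 + d.+1 * pass_time.+1))); first by rewrite mulSn; lia.
apply: (reach_trans r1); apply: reach_trans r2.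
apply: stay_blank => //.
  have -> : m * kk + j = m * kk + minn m j by lia.
  by rewrite (@blank_pebble _ (fun l => l * kk + minn l j)).
rewrite /= inordK; last by lia.
by rewrite ifT //; lia.
Qed.

Lemma grow e (d kk : nat) v : 0 < kk -> kk + d = n ->
  held v T (fun l => l * kk) m.+1 ->
  exists v', held v' T (fun l => l * n) m.+1 /\
    reach (d * (m * pass_time.+1).+1)
      (cfg (Decide (Grow e ord_max (inord (kk %% W))) v) (blank T (fun l => l * kk) m.+1) (m * kk))
      (cfg (Decide (Grow e ord_max (inord (n %% W))) v') (blank T (fun l => l * n) m.+1) (m * n)).
Proof.
elim: d kk v => [|d IH] kk v hk Ed hv.
  by rewrite addn0 in Ed; subst kk; exists v; split=> //; apply: reach0.
have p0 l : l * kk = l * kk + minn l 1.-1 by rewrite minn0 addn0.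
have hv' : held v T (fun l => l * kk + minn l 1.-1) m.+1 by move=> l hl; rewrite hv // -p0.
have [] := @grow_sweep e 1 kk (inord (kk.+1 %% W)) v _ _ hv'; [by lia | by lia |].
move=> v1 [h1 r1].
have E1 : kk.+1 + d = n by lia.
have [v2 [h2 r2]] := IH kk.+1 v1 isT E1 h1.
exists v2; split=> //.
rewrite mulSn; apply: reach_trans r2; rewrite -add1n.
have -> : (m * pass_time.+1 = (m - 1).+1 * pass_time.+1) by congr (_ * _); lia.
apply: reach_trans r1.
have Eb : blank T (fun l => l * kk + minn l 1.-1) m.+1 = blank T (fun l => l * kk) m.+1.
  by apply: eq_blank => l _; rewrite -p0.
rewrite Eb addn0; apply: stay_blank => //; first by rewrite (@blank_pebble _ (fun l => l * kk)).
have Em : ord_max = inord m :> 'I_m.+1 by apply: val_inj; rewrite /= inordK.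
(* Here [kk < n], so the last pebble, at [m * kk], covers a cell of the board, and another sweep
   begins. *)
rewrite /= ltnn {1}Em hv // /content ifT; last by rewrite ltn_pmul2l; lia.
have Ek : (inord (kk %% W) : 'I_W.+1) = kk %% W :> nat by rewrite inordK // ltnS ltnW // ltn_mod; lia.
have E : (kk %% W).+1 %% W = kk.+1 %% W by rewrite -addn1 modnDml addn1.
by rewrite Ek E.
Qed.

End Fixed.

(** * Reading and rewriting blocks of columns *)

Lemma column_pass cs t c c' v : lowest t = 0 -> highest t = m.-1 -> c < n -> c' < n ->
  (if heading (t : task m W) is DLeft then c = c'.+1 else c' = c.+1) ->
  held v (content cs) (at_column c) m ->
  exists v', held v' (content cs) (at_column c') m /\
    reach pass_time
      (cfg (Lift t (inord m.-1) v) (blank (content cs) (at_column c) m) (m.-1 * n + c))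
      (cfg (Decide t v') (blank (content cs) (at_column c') m) (m.-1 * n + c')).
Proof.
move=> lt ht hc hc' cc hv.
have Em : m.-1.+1 = m by lia.
have mono l l' : l < l' -> l * n + n <= l' * n by move=> h; rewrite -mulSnr leq_mul2r h orbT.
have bd l : l < m -> l * n + n <= N by move=> h; rewrite -mulSnr leq_mul2r h orbT.
have cc' : c <= c'.+1 by move: cc; case: heading; lia.
have := @pass (content cs) N t (@content_lt cs)
   (at_column c) (at_column c') _ _ _ _ _ _ _ _ _ v.
rewrite ht Em lt; apply => //.
- by lia.
- by move=> l l' h _; have := mono _ _ h; lia.
- by move=> l l' h _ _; have := mono _ _ h; lia.
- by move=> l l' h _ _; have := mono _ _ h; lia.
- by move=> l h1 h2; move: cc; case: heading; lia.
- by move=> l h; have := bd l h; lia.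
- by move=> l h; have := bd l h; lia.
Qed.

Definition columns (cs : seq (seq bool)) := wf m cs /\ size cs = n.

Lemma get_columnE cs c (v : pebbles) : columns cs -> c < n -> held v (content cs) (at_column c) m ->
  val (get_column v) = nth [::] cs c.
Proof.
move=> [w sz] hc hv; have hs : size (nth [::] cs c) = m.
  by apply/eqP; move/all_nthP: w; apply; rewrite sz.
apply: (@eq_from_nth _ true); first by rewrite size_tuple hs.
move=> i; rewrite size_tuple => hi.
by rewrite -(tnth_nth _ _ (Ordinal hi)) tnth_mktuple /= hv // content_at.
Qed.

Lemma val_insub_rcons (b : (W + W).-bseq column) x :
  size b < W + W -> val (insub_bseq (W + W) (rcons b x)) = rcons b x.
Proof. by move=> h; rewrite /insub_bseq val_insubd size_rcons h. Qed.

Lemma scan_block cs pre cur post e w (b : (W + W).-bseq column) (v : pebbles) :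
  columns cs -> cs = pre ++ cur ++ post -> size cur = w -> w <= W + W -> size b < w ->
  map val (bseqval b) = take (size b) cur ->
  held v (content cs) (at_column (size pre + size b)) m ->
  exists b' v', [/\ map val (bseqval b') = take w.-1 cur,
    size b' = w.-1,
    held v' (content cs) (at_column (size pre + w.-1)) m &
    reach ((w - (size b).+1) * pass_time.+1)
      (cfg (Decide (Scan e (inord w) b) v)
         (blank (content cs) (at_column (size pre + size b)) m) (m.-1 * n + (size pre + size b)))
      (cfg (Decide (Scan e (inord w) b') v')
         (blank (content cs) (at_column (size pre + w.-1)) m) (m.-1 * n + (size pre + w.-1)))].
Proof.
move=> hcs Ecs Ew hw; move Ed: (w - (size b).+1) => d.
elim: d b v Ed => [|d IH] b v Ed hb Eb hv.
  have Es : size b = w.-1 by lia.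
  by exists b, v; rewrite -Es; split=> //; apply: reach0.
have szc : size pre + size cur <= n by move: hcs.2; rewrite Ecs !size_cat; lia.
have hc : size pre + size b < n by lia.
have Eg := get_columnE hcs hc hv.
set b1 : (W + W).-bseq column := insub_bseq _ (rcons b (get_column v)).
have Eb1 : val b1 = rcons b (get_column v) by rewrite /b1 val_insub_rcons //; lia.
have sb1 : size b1 = (size b).+1 by rewrite -[size b1]/(size (val b1)) Eb1 size_rcons.
have Ecol : nth [::] cs (size pre + size b) = nth [::] cur (size b).
  by rewrite Ecs nth_cat ltnNge leq_addr addKn nth_cat ifT //; lia.
have hc1 : size pre + size b1 < n by lia.
have cc : size pre + size b1 = (size pre + size b).+1 by lia.
have [v1 [h1 r1]] := @column_pass cs (Scan e (inord w) b1) (size pre + size b)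
  (size pre + size b1) v erefl erefl hc hc1 cc hv.
have E1 : w - (size b1).+1 = d by lia.
have E2 : size b1 < w by lia.
have E3 : map val (bseqval b1) = take (size b1) cur.
  by rewrite Eb1 map_rcons Eb Eg Ecol size_rcons (take_nth [::]) //; lia.
have [b' [v' [h2 h3 h4 r2]]] := IH b1 v1 E1 E2 E3 h1.
exists b', v'; split=> //; rewrite mulSn -add1n -addnA.
apply: reach_trans (reach_trans r1 r2).
apply: stay_blank => //.
  by rewrite (@blank_pebble _ (at_column (size pre + size b))) //; lia.
by rewrite /= size_rcons inordK ?ifT //; lia.
Qed.

Lemma rcons_block cs pre cur post w (b : (W + W).-bseq column) (v : pebbles) :
  columns cs -> cs = pre ++ cur ++ post -> size cur = w -> 0 < w -> size b = w.-1 ->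
  map val (bseqval b) = take w.-1 cur ->
  held v (content cs) (at_column (size pre + w.-1)) m ->
  map val (rcons b (get_column v)) = cur.
Proof.
move=> hcs Ecs Ew w0 sb Eb hv.
have szc : size pre + size cur <= n by move: hcs.2; rewrite Ecs !size_cat; lia.
have hc : size pre + w.-1 < n by lia.
rewrite map_rcons Eb (get_columnE hcs hc hv) Ecs nth_cat ltnNge leq_addr addKn nth_cat ifT; last by lia.
by rewrite -take_nth ?take_oversize //; lia.
Qed.

Lemma scan_settled cs pre cur post e w (v : pebbles) : columns cs -> cs = pre ++ cur ++ post ->
  size cur = w -> 0 < w -> w <= W + W -> 0 < size post -> settled e cur ->
  held v (content cs) (at_column (size pre)) m ->
  exists v', held v' (content cs) (at_column (size pre + w)) m /\
    reach (w * pass_time.+1)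
      (cfg (Decide (Scan e (inord w) [bseq]) v)
         (blank (content cs) (at_column (size pre)) m) (m.-1 * n + size pre))
      (cfg (Decide (Scan false (inord W) [bseq]) v')
         (blank (content cs) (at_column (size pre + w)) m) (m.-1 * n + (size pre + w))).
Proof.
move=> hcs Ecs Ew w0 hw p0 st hv.
have szc : size pre + (size cur + size post) = n by move: hcs.2; rewrite Ecs !size_cat; lia.
have := @scan_block cs pre cur post e w [bseq] v hcs Ecs Ew hw w0.
rewrite addn0 take0 => /(_ erefl hv) [b [v1 [Eb sb h1 r1]]].
have Ecur := rcons_block hcs Ecs Ew w0 sb Eb h1.
have hc : size pre + w.-1 < n by lia.
have hc' : size pre + w < n by lia.
have cc : size pre + w = (size pre + w.-1).+1 by lia.
have [v2 [h2 r2]] := @column_pass cs (Scan false (inord W) [bseq]) (size pre + w.-1)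
  (size pre + w) v1 erefl erefl hc hc' cc h1.
exists v2; split=> //; apply: (@reach_leq _ _ _ _ ((w - 1) * pass_time.+1 + (1 + pass_time))).
  by case: (w) w0 => // w' _; rewrite subn1 mulSn; lia.
apply: (reach_trans r1); apply: reach_trans r2; apply: stay_blank => //.
  by rewrite (@blank_pebble _ (at_column (size pre + w.-1))) //; lia.
by rewrite /= size_rcons inordK ?sb; [rewrite ifN ?Ecur ?st //; lia | lia].
Qed.

Lemma scan_unsettled cs pre cur post e w (v : pebbles) : columns cs -> cs = pre ++ cur ++ post ->
  size cur = w -> 0 < w -> w <= W + W -> ~~ settled e cur ->
  held v (content cs) (at_column (size pre)) m ->
  exists v', held v' (content cs) (at_column (size pre + w.-1)) m /\
    reach (w * pass_time.+1)
      (cfg (Decide (Scan e (inord w) [bseq]) v)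
         (blank (content cs) (at_column (size pre)) m) (m.-1 * n + size pre))
      (cfg (write_back W (rev (to_block m W (fix_block cur))) v')
         (blank (content cs) (at_column (size pre + w.-1)) m) (m.-1 * n + (size pre + w.-1))).
Proof.
move=> hcs Ecs Ew w0 hw st hv.
have := @scan_block cs pre cur post e w [bseq] v hcs Ecs Ew hw w0.
rewrite addn0 take0 => /(_ erefl hv) [b [v1 [Eb sb h1 r1]]].
have Ecur := rcons_block hcs Ecs Ew w0 sb Eb h1.
exists v1; split=> //; apply: (@reach_leq _ _ _ _ ((w - 1) * pass_time.+1 + 1)).
  by case: (w) w0 => // w' _; rewrite subn1 mulSn; lia.
apply: (reach_trans r1); apply: stay_blank => //.
  by rewrite (@blank_pebble _ (at_column (size pre + w.-1))) //; lia.
by rewrite /= size_rcons inordK ?sb; [rewrite ifN ?Ecur ?(negbTE st) //; lia | lia].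
Qed.

(* All the blocks but the last are settled; [w] is the width of the first one. *)
Fixpoint scanned (e : bool) (w : nat) (bs : seq (seq (seq bool))) (bad : seq (seq bool)) : Prop :=
  match bs with
  | [::] => size bad = w /\ ~~ settled e bad
  | b :: bs' => [/\ size b = w, settled e b & scanned false W bs' bad]
  end.

Lemma scan_blocks cs bs pre bad post e w (v : pebbles) : columns cs ->
  cs = pre ++ flatten bs ++ bad ++ post -> 0 < w <= W + W -> scanned e w bs bad ->
  held v (content cs) (at_column (size pre)) m ->
  exists v', held v' (content cs) (at_column (size pre + size (flatten bs) + (size bad).-1)) m /\
    reach ((size (flatten bs) + size bad) * pass_time.+1)
      (cfg (Decide (Scan e (inord w) [bseq]) v)
         (blank (content cs) (at_column (size pre)) m) (m.-1 * n + size pre))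
      (cfg (write_back W (rev (to_block m W (fix_block bad))) v')
         (blank (content cs) (at_column (size pre + size (flatten bs) + (size bad).-1)) m)
         (m.-1 * n + (size pre + size (flatten bs) + (size bad).-1))).
Proof.
move=> hcs; elim: bs pre e w v => [|b bs IH] pre e w v Ecs /andP[w0 hw] /=.
  case=> sz st hv; rewrite addn0 add0n.
  by have := @scan_unsettled cs pre bad post e w v hcs Ecs sz w0 hw st hv; rewrite -sz.
case=> sz st hs hv.
have bad0 : 0 < size bad.
  elim: bs false {IH Ecs} (W) hs (ltnW W_gt1) => [|? ? IHb] e' w' /=; first by case=> ->.
  by case=> _ _ /IHb h _; apply: h; lia.
have hp : 0 < size (flatten bs ++ bad ++ post) by rewrite !size_cat; lia.
have Ecs' : cs = pre ++ b ++ (flatten bs ++ bad ++ post) by rewrite Ecs /= -!catA.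
have [v1 [h1 r1]] := @scan_settled cs pre b _ e w v hcs Ecs' sz w0 hw hp st hv.
have Ecs2 : cs = (pre ++ b) ++ flatten bs ++ bad ++ post by rewrite Ecs' -!catA.
have hW : 0 < W <= W + W by lia.
have := IH (pre ++ b) false W v1 Ecs2 hW hs; rewrite size_cat sz => /(_ h1) [v2 [h2 r2]].
exists v2; rewrite size_cat sz [size pre + (w + _)]addnA; split=> //.
apply: (@reach_leq _ _ _ _ (w * pass_time.+1 + (size (flatten bs) + size bad) * pass_time.+1)).
  by rewrite -mulnDl addnA.
exact: reach_trans r1 r2.
Qed.

Lemma restore cs c i (v : pebbles) : c < n -> i < m -> held v (content cs) (at_column c) m ->
  reach (i.+1 * (N + 3)) (cfg (Restore W (inord i) v) (blank (content cs) (at_column c) i.+1) (i * n + c))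
        (cfg (Done m W) (content cs) c).
Proof.
move=> hc; elim: i => [|i IH] hi hv; set T := content cs in hv *.
all: set x := (_ * n + c).
  have vi : v (inord 0) = T x by rewrite hv.
  have w : upd (blank T (at_column c) 1) x (T x) = T.
    apply: functional_extensionality => k; rewrite /upd; case: eqP => [->//|ne].
    by apply: blank_free => l; rewrite ltnS leqn0 => /eqP -> E; apply: ne; rewrite -E.
  apply: (@reach_leq _ _ _ _ 1); first by lia.
  rewrite -{2}w -vi /x; apply: reach_stay => //=.
  by rewrite -val_eqE /= inordK.
have vi : v (inord i.+1) = T x by rewrite hv.
have mono : i * n + c < x by rewrite /x mulSn; lia.
have xN : x < N by rewrite /x; nia.
have w : upd (blank T (at_column c) i.+2) x (T x) = blank T (at_column c) i.+1.
  apply: functional_extensionality => k; rewrite /upd; case: eqP => [->|ne].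
    by rewrite blank_free // => l hl E; move: mono; rewrite -E; nia.
  case: (blankP T (at_column c) i.+1 k) => [[[l hl El] ->]|[h ->]].
    by rewrite -El (@blank_pebble _ (at_column c)) // ltnW.
  rewrite blank_free // => l; rewrite ltnS leq_eqVlt => /predU1P[->|/h//].
  by move/esym.
apply: (@reach_leq _ _ _ _ (1 + ((x.-1 - (i * n + c)) + (1 + i.+1 * (N + 3))))).
  by rewrite mulSn; lia.
have Ex : x = x.-1.+1 by lia.
apply: (@reach_trans _ _ _ _ _ _ _ (cfg (Leave W (inord i) v) (blank T (at_column c) i.+1) x.-1)).
  have := @reach_left m W small fix_block (Restore W (inord i.+1) v) (blank T (at_column c) i.+2) x.-1
    (Leave W (inord i) v) (T x) isT; rewrite -Ex w; apply.
  by rewrite /= -val_eqE /= inordK ?vi //; lia.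
apply: (@reach_trans _ _ _ _ _ _ _ (cfg (Leave W (inord i) v) (blank T (at_column c) i.+1) (i * n + c))).
  have ED : x.-1 = (i * n + c) + (x.-1 - (i * n + c)) by lia.
  rewrite {2}ED; apply: walk_left => // y; rewrite -ED => hy.
  rewrite blank_free => [|l hl El]; first by apply: content_lt; lia.
  by move: hy; rewrite -El; nia.
apply: reach_trans (IH (ltnW hi) hv); apply: stay_blank => //.
by rewrite (@blank_pebble _ (at_column c)).
Qed.

Lemma columns_set cs c (x : column) : columns cs -> c < n -> columns (set_nth [::] cs c x).
Proof.
case=> w sz hc; split; last by rewrite size_set_nth sz; apply/maxn_idPr.
apply/(all_nthP [::]) => k; rewrite size_set_nth sz (maxn_idPr hc) => hk.
rewrite nth_set_nth /=; case: (k =P c) => _; first by rewrite size_tuple.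
by move/all_nthP: w; apply; rewrite sz.
Qed.

(** All cells of column [c] are under pebbles, so replacing the column leaves the tape as it is and
    changes only what the state holds. *)
Lemma put_columnP cs c (x : column) (v : pebbles) : columns cs -> c < n ->
  held v (content cs) (at_column c) m ->
  blank (content cs) (at_column c) m = blank (content (set_nth [::] cs c x)) (at_column c) m /\
  held (put_column v x) (content (set_nth [::] cs c x)) (at_column c) m.
Proof.
move=> hcs hc hv; split.
  apply: eq_blank_content => k hk; rewrite /content; case: ltnP => // kN.
  rewrite /cell nth_set_nth /=; case: eqP => // E; case: (hk (k %/ n)).
    by rewrite ltn_divLR //; lia.
  by rewrite -E -divn_eq.
move=> l hl; rewrite content_at // /put_column ffunE inordK; last by lia.
by rewrite hl /cell nth_set_nth /= eqxx.
Qed.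

Fixpoint put_columns (cs : seq (seq bool)) (c : nat) (b : seq (seq bool)) : seq (seq bool) :=
  if b is x :: b' then put_columns (set_nth [::] cs c x) c.-1 b' else cs.

Lemma write_backP cs c (b : seq column) (v : pebbles) : columns cs -> c < n ->
  0 < size b <= c.+1 -> size b <= W + W -> held v (content cs) (at_column c) m ->
  exists h, reach (size b * (pass_time.+1) + m * (N + 3))
    (cfg (write_back W b v) (blank (content cs) (at_column c) m) (m.-1 * n + c))
    (cfg (Done m W) (content (put_columns cs c (map val b))) h).
Proof.
elim: b cs c v => // x b IH cs c v hcs hc /= hb hW hv.
have [e1 h1] := put_columnP x hcs hc hv; rewrite e1.
have Em : m.-1.+1 = m by lia.
case: b IH hb hW => [|y b] IH hb hW.
  exists c; apply: (@reach_leq _ _ _ _ (m * (N + 3))); first by lia.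
  by have := @restore _ c m.-1 _ hc _ h1; rewrite Em; apply; lia.
have hcs1 := columns_set x hcs hc.
set b1 : (W + W).-bseq column := insub_bseq _ (y :: b).
have Eb1 : val b1 = y :: b by rewrite /b1 /insub_bseq val_insubd ifT //; move: hW => /=; lia.
have hc' : c.-1 < n by lia.
have cc : c = c.-1.+1 by move: hb => /=; lia.
have [v2 [h2 r2]] := @column_pass _ (Back b1) c c.-1 _ erefl erefl hc hc' cc h1.
have hb' : 0 < size (y :: b) <= c.-1.+1 by move: hb => /=; lia.
have [h r] := IH _ c.-1 v2 hcs1 hc' hb' (ltnW hW) h2.
exists h; apply: (@reach_leq _ _ _ _ (pass_time + (1 + (size (y :: b) * pass_time.+1 + m * (N + 3))))).
  by rewrite [(_.+1 * pass_time.+1)]mulSn; lia.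
apply: (reach_trans r2); apply: reach_trans r; apply: stay_blank => //.
  by rewrite (@blank_pebble _ (at_column c.-1)) //; lia.
by rewrite [delta _ _]/= Eb1.
Qed.

Lemma set_nth_cat (T : Type) (x0 x y : T) (a t : seq T) :
  set_nth x0 (a ++ y :: t) (size a) x = a ++ x :: t.
Proof. by elim: a => //= z a ->. Qed.

Lemma put_columns_cat pre b b' post : size b = size b' ->
  put_columns (pre ++ b ++ post) (size pre + size b).-1 (rev b') = pre ++ b' ++ post.
Proof.
elim/last_ind: b' b post => [|b' x IH] b post; first by case: b.
elim/last_ind: b => [|b y _]; first by rewrite size_rcons.
rewrite !size_rcons => -[sz]; rewrite rev_rcons /= addnS /=.
have -> : set_nth [::] (pre ++ rcons b y ++ post) (size pre + size b) x = pre ++ b ++ x :: post.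
  by rewrite -cats1 -catA /= catA -size_cat set_nth_cat -catA.
by rewrite IH // -cats1 -catA.
Qed.

Definition encode (cs : seq (seq bool)) : seq bool :=
  mkseq (fun k => cell cs (k %% n) (k %/ n)) N.

Lemma on_tape_encode cs : on_tape (encode cs) = content cs.
Proof.
apply: functional_extensionality => k; rewrite /on_tape /content size_mkseq.
by case: ltnP => // h; rewrite nth_mkseq.
Qed.

Lemma size_bad e w bs bad : scanned e w bs bad -> 0 < w <= W + W -> 0 < size bad <= W + W.
Proof.
elim: bs e w => [|b bs IH] e w /=; first by case=> ->.
by case=> _ _ /IH h _; apply: h; lia.
Qed.

Lemma map_to_block s : wf m s -> size s <= W + W -> map val (bseqval (to_block m W s)) = s.
Proof.
move=> w sz; rewrite /to_block /insub_bseq val_insubd size_map sz -map_comp.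
elim: s w {sz} => //= c s IH /andP[hc w]; rewrite IH //.
by rewrite val_insubd hc.
Qed.

Lemma arrive cs e v : held v (content cs) (fun l => l * n) m.+1 ->
  reach (n + 2)
    (cfg (Decide (Grow e ord_max (inord (n %% W))) v) (blank (content cs) (fun l => l * n) m.+1) N)
    (cfg (Decide (Scan e (inord (W + n %% W)) [bseq]) v) (blank (content cs) (at_column 0) m)
      (m.-1 * n + 0)).
Proof.
move=> hv; set T := content cs in hv *.
(* The last pebble lies at [m * n], just behind the board, where the tape is blank anyway; it can be
   forgotten. *)
have E0 : blank T (fun l => l * n) m.+1 = blank T (at_column 0) m.
  apply: functional_extensionality => k.
  case: (blankP T (at_column 0) m k) => [[[l hl <-] ->]|[h ->]].
    by rewrite addn0 (@blank_pebble _ (fun l => l * n)) // ltnW.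
  case: (blankP T (fun l => l * n) m.+1 k) => [[[l hl El] ->]|[_ ->]] //.
  move: hl; rewrite ltnS leq_eqVlt => /predU1P[El'|/h]; last by rewrite addn0.
  by rewrite -El El' /T /content ltnn.
have Nn : N = m.-1 * n + 0 + n by rewrite addn0 -mulSnr prednK // ltnW.
have N1 : N = N.-1.+1 by lia.
have Em : ord_max = inord m :> 'I_m.+1 by apply: val_inj; rewrite /= inordK.
apply: (@reach_leq _ _ _ _ (1 + (n.-1 + 1))); first by lia.
pose q : state m W := Arrive (Scan e (inord (W + n %% W)) [bseq]) v.
apply: (@reach_trans _ _ _ _ _ _ _ (cfg q (blank T (at_column 0) m) N.-1)).
  rewrite -E0 {1}N1; apply: left_blank => //; rewrite -?N1.
    by rewrite (@blank_pebble _ (fun l => l * n) m.+1 m).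
  rewrite /= ltnn [in X in v X]Em hv // /T /content ltnn /q.
  by rewrite inordK // ltnS ltnW // ltn_mod; lia.
apply: (@reach_trans _ _ _ _ _ _ _ (cfg q (blank T (at_column 0) m) (m.-1 * n + 0))).
  have ED : N.-1 = m.-1 * n + 0 + n.-1 by lia.
  rewrite ED; apply: walk_left => // x hx; rewrite blank_free => [|l hl El].
    by apply: content_lt; lia.
  have : l <= m.-1 by lia.
  by rewrite leq_eqVlt => /predU1P[El'|hl']; [lia | nia].
by apply: stay_blank => //; rewrite (@blank_pebble _ (at_column 0)) //; lia.
Qed.

(** The summands are the costs of deleting the bit, placing the pebbles, growing their distance,
    returning to column 0, scanning, writing the block back and restoring the last column. *)
Definition run_time :=
  2 * N + 6 + (m + 1 + (n * (m * pass_time.+1).+1 + (n + 2 + (n * pass_time.+1 +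
  ((W + W) * pass_time.+1 + m * (N + 3)))))).

Lemma run_large f cs bs bad nb post : columns cs -> cs = flatten bs ++ bad ++ post ->
  scanned (~~ f) (W + n %% W) bs bad -> fix_block bad = nb -> wf m nb -> size bad = size nb ->
  exists2 t, t <= run_time & tm_runs machine (f :: encode cs) t (encode (flatten bs ++ nb ++ post)).
Proof.
move=> hcs Ecs hs Ef wn sn; set e := ~~ f.
have n0 : 0 < n by lia.
have hw : 0 < W + n %% W <= W + W by have : n %% W < W; [rewrite ltn_mod; lia | lia].
have /andP[b0 bW] := size_bad hs hw.
have szc : size (flatten bs) + (size bad + size post) = n by move: hcs.2; rewrite Ecs !size_cat.
have large : m * W <= size (encode cs) by rewrite size_mkseq leq_mul2l W_le_n orbT.
have r1 := @to_place f (encode cs) large.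
rewrite on_tape_encode size_mkseq in r1.
have v0 : held ([ffun=> None] : pebbles) (content cs) id 0 by [].
have [v1 [h1 r2]] := @place cs e 0 _ isT v0.
have E1 : blank (content cs) id 0 = content cs by apply: functional_extensionality.
have E2 : inord 0 = ord0 :> 'I_m.+1 by apply: val_inj; rewrite /= inordK.
rewrite E1 E2 subn0 in r2.
have hv1 : held v1 (content cs) (fun l => l * 1) m.+1 by move=> l hl; rewrite h1 // muln1.
have n1 : 1 + n.-1 = n by lia.
have [v2 [h2 r3]] := @grow cs e n.-1 1 v1 isT n1 hv1.
have E3 : blank (content cs) id m.+1 = blank (content cs) (fun l => l * 1) m.+1.
  by apply: eq_blank => l _; rewrite muln1.
rewrite -E3 muln1 modn_small // in r3.
have r4 := @arrive cs e v2 h2.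
have hv2 : held v2 (content cs) (at_column (@size (seq bool) [::])) m.
  by move=> l hl; rewrite h2 ?addn0 // ltnW.
have [v3 [h3 r5]] := @scan_blocks cs bs [::] bad post e
  (W + n %% W) v2 hcs Ecs hw hs hv2.
rewrite Ef add0n in h3 r5.
have Eb : map val (rev (to_block m W nb)) = rev nb by rewrite map_rev map_to_block // -sn.
have sb : size (rev (to_block m W nb)) = size bad by rewrite -(size_map val) Eb size_rev.
have hc : size (flatten bs) + (size bad).-1 < n by lia.
have hb : 0 < size (rev (to_block m W nb)) <= (size (flatten bs) + (size bad).-1).+1.
  by rewrite sb; lia.
have hbW : size (rev (to_block m W nb)) <= W + W by rewrite sb.
have [h r6] := @write_backP cs _ _ v3 hcs hc hb hbW h3.
have Ec : size (flatten bs) + (size bad).-1 = (size (flatten bs) + size bad).-1 by lia.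
rewrite Eb sb [in put_columns _ _ _]Ec Ecs put_columns_cat // -Ecs in r6.
have [t ht Et] := reach_trans r1 (reach_trans r2 (reach_trans r3 (reach_trans r4 (reach_trans r5 r6)))).
exists t.
  apply: leq_trans ht _; rewrite /run_time !leq_add ?leq_mul //; lia.
rewrite /tm_runs init_cfg Et; split=> //; apply: halt_tape_output.
by rewrite on_tape_encode.
Qed.

End Run.

(** For fixed [m] and [W] a pass takes linear time, and there are linearly many passes. *)
Lemma run_time_bound m W : exists c, forall n, W <= n -> run_time m W n <= c * n.+1 ^ 2.
Proof.
pose a := (m + 3) * (2 * m + 2).
exists (2 * m + 6 + (m + 1) + (m * a.+1).+1 + 2 + 3 * a.+1 + m * (m + 3)) => n hW.
set x := n.+1; have hx : 0 < x by [].
have hp : pass_time m n <= a * x by rewrite /pass_time /a mulnAC leq_mul2r; apply/orP; right; rewrite /x; nia.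
have hp1 : (pass_time m n).+1 <= a.+1 * x by rewrite mulSn; lia.
have hxx : x <= x ^ 2 by rewrite -mulnn leq_pmulr.
have hxx1 : 1 <= x ^ 2 by rewrite expn_gt0.
have nx k : k <= x -> k * (pass_time m n).+1 <= a.+1 * x ^ 2.
  by move=> hk; rewrite -mulnn mulnCA leq_mul.
rewrite /run_time !mulnDl.
have e1 : 2 * (m * n) + 6 <= 2 * m * x ^ 2 + 6 * x ^ 2.
  by apply: leq_add; [rewrite mulnA leq_mul2l; lia | lia].
have e2 : m + 1 <= m * x ^ 2 + 1 * x ^ 2 by apply: leq_add; rewrite ?leq_pmulr.
have e3 : n * (m * (pass_time m n).+1).+1 <= (m * a.+1).+1 * x ^ 2.
  rewrite mulnS mulSn; apply: leq_add; first by rewrite /x in hxx *; lia.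
  by rewrite mulnCA -mulnA leq_mul2l nx ?orbT // /x.
have e4 : n + 2 <= 2 * x ^ 2 by rewrite /x -mulnn; nia.
have e5 : n * (pass_time m n).+1 <= a.+1 * x ^ 2 by apply: nx; rewrite /x.
have e6 : (W + W) * (pass_time m n).+1 <= 2 * (a.+1 * x ^ 2).
  by rewrite mulnDl; have := nx W; rewrite /x; lia.
have e7 : m * (m * n + 3) <= m * (m + 3) * x ^ 2.
  rewrite -mulnA leq_mul2l mulnDl; apply/orP; right; apply: leq_add.
    by rewrite leq_mul2l; apply/orP; right; rewrite /x in hxx *; lia.
  by rewrite leq_pmulr.
lia.
Qed.

(** * The strategy *)

Section Cells.

Variable m : nat.

Lemma eq_cells s s' : wf m s -> wf m s' -> size s = size s' ->
  (forall j i, j < size s -> i < m -> cell s j i = cell s' j i) -> s = s'.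
Proof.
move=> w w' sz h; apply: (@eq_from_nth _ [::]) => // j hj.
have sc : size (nth [::] s j) = m by apply/eqP/(all_nthP [::] w).
have sc' : size (nth [::] s' j) = m by apply/eqP/(all_nthP [::] w'); rewrite -sz.
by apply: (@eq_from_nth _ true); rewrite sc // => i hi; apply: h.
Qed.

Lemma set_cell_cat s1 s2 j i : set_cell (s1 ++ s2) j i =
  if j < size s1 then set_cell s1 j i ++ s2 else s1 ++ set_cell s2 (j - size s1) i.
Proof.
rewrite /set_cell nth_cat; case: ltnP => h.
  elim: s1 j h => // c s1 IH [|j] //= h; congr cons.
  exact: IH.
by elim: s1 j h => [|c s1 IH] [|j] //= h; congr cons; apply: IH.
Qed.

Lemma cell_cat s1 s2 j i :
  cell (s1 ++ s2) j i = if j < size s1 then cell s1 j i else cell s2 (j - size s1) i.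
Proof. by rewrite /cell nth_cat; case: ltnP. Qed.

Lemma block_moveW p s s' : wf m s -> block_move p s s' -> wf m s' /\ size s' = size s.
Proof.
move=> w [j [i]]; case E: second => [j' i'] [h1 h2 ->].
have [w1 e1] := wf_set w h1.
have h3 := cell_second E h2.
by have [w2 e2] := wf_set w1 h3; rewrite e2.
Qed.

Lemma block_move_catl p s1 s2 s' : block_move p s1 s' -> wf m s1 ->
  block_move p (s1 ++ s2) (s' ++ s2).
Proof.
move=> [j [i]] h w; exists j, i; move: h; case: second => j' i' [h1 h2 ->].
have [hj _] := cell_lt w h1; have [hj' _] := cell_lt w h2.
have [_ sz] := wf_set w h1.
by rewrite !cell_cat hj hj' set_cell_cat hj set_cell_cat sz hj'.
Qed.

Lemma block_move_catr p s1 s2 s' : block_move p s2 s' -> block_move p (s1 ++ s2) (s1 ++ s').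
Proof.
move=> [j [i h]]; exists (size s1 + j), i.
have -> : second p (size s1 + j) i = (size s1 + (second p j i).1, (second p j i).2).
  by case: p {h} => //=; rewrite addnS.
move: h; case: second => j' i' [h1 h2 ->] /=.
have E k : (size s1 + k < size s1) = false by rewrite ltnNge leq_addr.
by rewrite 2!cell_cat set_cell_cat !E set_cell_cat E !addKn h1 h2.
Qed.

(** A vertical domino lies in one column, so no move of Vera touches two blocks. This fails for
    Hepzibah, whose strategy simply never crosses. *)
Lemma vera_block_move_cat s1 s2 s' : wf m s1 -> block_move Vera (s1 ++ s2) s' ->
  (exists2 s1', block_move Vera s1 s1' & s' = s1' ++ s2) \/
  (exists2 s2', block_move Vera s2 s2' & s' = s1 ++ s2').
Proof.
move=> w [j [i /= [h1 h2 ->]]]; move: h1 h2; rewrite !cell_cat set_cell_cat.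
case: ifP => hj h1 h2.
  left; exists (set_cell (set_cell s1 j i) j i.+1); first by exists j, i.
  by rewrite set_cell_cat (wf_set w h1).2 hj.
right; exists (set_cell (set_cell s2 (j - size s1) i) (j - size s1) i.+1); first by exists (j - size s1), i.
by rewrite set_cell_cat hj.
Qed.

Definition filled (s : seq (seq bool)) := sumn (map (count id) s).

Lemma filled_set s j i : wf m s -> ~~ cell s j i -> filled (set_cell s j i) = (filled s).+1.
Proof.
move=> w h; have [hj hi] := cell_lt w h.
rewrite /filled /set_cell.
have -> : map (count id) (set_nth [::] s j (set_nth true (nth [::] s j) i true)) =
   set_nth 0 (map (count id) s) j (count id (set_nth true (nth [::] s j) i true)).
  by elim: (s) (j) hj => // c s' IH [|j'] //= hj'; rewrite IH.
have sc : size (nth [::] s j) = m by apply/eqP/(all_nthP [::] w).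
have E0 : nth true (nth [::] s j) i = false by exact: negbTE h.
rewrite sumn_set_nth count_set_nth (nth_map [::]) // size_map hj sc hi E0 /=.
have : count id (nth [::] s j) <= sumn (map (count id) s).
  elim: (s) (j) hj => // c s' IH [|j'] /= hj'; first by lia.
  by have := IH j' hj'; lia.
lia.
Qed.

Lemma filled_move p s s' : wf m s -> block_move p s s' -> filled s' = (filled s).+2.
Proof.
move=> w [j [i]]; case E: second => [j' i'] [h1 h2 ->].
have [w1 _] := wf_set w h1.
have h3 := cell_second E h2.
by rewrite !filled_set.
Qed.

(** A move fills two cells and thus changes the parity of the number of dominoes. *)
Lemma settled_move e p s s' : wf m s -> block_move p s s' -> settled e s' = ~~ settled e s.
Proof.
move=> w h; rewrite /settled -/(filled s') (filled_move w h) /= -/(filled s).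
by case: odd; case: e.
Qed.

End Cells.

Section Strategy.

Variables (m W : nat) (fix_block : seq (seq bool) -> seq (seq bool)).

Hypothesis fix_blockP : forall b, wf m b -> fst_block m b ->
  block_move Hepzibah b (fix_block b) /\ snd_block m (fix_block b).

(* Vera has just been answered in every block of [quiet]; in [active] she has a move to be
   answered in exactly one block. *)
Fixpoint quiet (e : bool) (w : nat) (bs : seq (seq (seq bool))) : Prop :=
  if bs is b :: bs' then
    [/\ wf m b, size b = w, settled e b, snd_block m b & quiet false W bs']
  else True.

Fixpoint active (e : bool) (w : nat) (bs : seq (seq (seq bool))) : Prop :=
  if bs is b :: bs' then
    [/\ wf m b, size b = w &
      [/\ ~~ settled e b, fst_block m b & quiet false W bs'] \/
      [/\ settled e b, snd_block m b & active false W bs']]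
  else False.

Lemma quiet_move e w bs s' : quiet e w bs -> block_move Vera (flatten bs) s' ->
  exists2 bs', flatten bs' = s' & active e w bs'.
Proof.
elim: bs e w s' => [|b bs IH] e w s' /=.
  by move=> _ [j [i /= []]]; rewrite /cell !nth_nil.
case=> wb sz st hb hbs /(vera_block_move_cat wb)[[b' mv ->]|[s2 mv ->]].
  have [wb' sz'] := block_moveW wb mv.
  exists (b' :: bs) => //=; split; rewrite ?sz' //; left; split=> //.
    by rewrite (settled_move _ wb mv) st.
  exact: snd_block_move wb hb mv.
have [bs' <- h] := IH _ _ _ hbs mv.
by exists (b :: bs') => //=; split=> //; right.
Qed.

Lemma active_move e w bs : active e w bs ->
  exists bs0 bad post, let s' := flatten bs0 ++ fix_block bad ++ post in
    [/\ flatten bs = flatten bs0 ++ bad ++ post, scanned W e w bs0 bad,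
        wf m (fix_block bad) /\ size bad = size (fix_block bad),
        block_move Hepzibah (flatten bs) s' &
        exists2 bs', flatten bs' = s' & quiet e w bs'].
Proof.
elim: bs e w => //= b bs IH e w [wb sz [[st hb hbs]|[st hb hbs]]].
  have [mv hb'] := fix_blockP wb hb.
  have [wb' sz'] := block_moveW wb mv.
  exists [::], b, (flatten bs); split=> //=; first exact: (block_move_catl _ mv wb).
  exists (fix_block b :: bs) => //=; split; rewrite ?sz' //.
  by rewrite (settled_move _ wb mv) st.
have [bs0 [bad [post [e1 h1 h2 h3 [bs' e2 h4]]]]] := IH _ _ hbs.
exists (b :: bs0), bad, post; rewrite /= -!catA; split=> //.
- by rewrite e1.
- exact: block_move_catr.
- by exists (b :: bs'); rewrite //= e2.
Qed.

End Strategy.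

(** * Boards as lists of columns, and their encoding *)

Section Boards.

Variables (m n : nat).

Definition cols (B : board m n) : seq (seq bool) :=
  [seq [seq ((i, j) \in B) | i <- enum 'I_m] | j <- enum 'I_n].

Lemma columns_cols B : columns m n (cols B).
Proof.
split; last by rewrite size_map size_enum_ord.
by apply/allP => c /mapP[j _ ->]; rewrite size_map size_enum_ord.
Qed.

Lemma cell_cols B (x : 'I_m * 'I_n) : cell (cols B) x.2 x.1 = (x \in B).
Proof.
case: x => i j; rewrite /cell /= (nth_map j) ?size_enum_ord // (nth_map i) ?size_enum_ord //.
by rewrite !nth_ord_enum.
Qed.

Definition board_of (s : seq (seq bool)) : board m n := [set x : 'I_m * 'I_n | cell s x.2 x.1].

Lemma board_ofK s : columns m n s -> cols (board_of s) = s.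
Proof.
move=> [w sz]; have [w' sz'] := columns_cols (board_of s).
apply: (@eq_cells m) => //; rewrite ?sz' // => j i hj hi.
by rewrite -[j]/(nat_of_ord (Ordinal hj)) -[i]/(nat_of_ord (Ordinal hi))
  -[Ordinal hj]/((Ordinal hi, Ordinal hj).2) -[Ordinal hi in LHS]/((Ordinal hi, Ordinal hj).1)
  cell_cols inE.
Qed.

Lemma cols_inj : injective cols.
Proof. by move=> B B' E; apply/setP => x; rewrite -!cell_cols E. Qed.

Lemma cols_setU (B : board m n) (x : 'I_m * 'I_n) : x \notin B -> cols (x |: B) = set_cell (cols B) x.2 x.1.
Proof.
rewrite -cell_cols => h; have [w1 s1] := columns_cols (x |: B).
have [w2 s2] := columns_cols B; have [w3 s3] := wf_set w2 h.
apply: (@eq_cells m) => //; rewrite ?s3 ?s1 ?s2 // => j i hj hi.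
rewrite cell_set.
have := cell_cols (x |: B) (Ordinal hi, Ordinal hj); rewrite /= => ->.
have := cell_cols B (Ordinal hi, Ordinal hj); rewrite /= => ->.
by case: x {h w3 s3 w1 s1} => x1 x2; rewrite !inE xpair_eqE -!val_eqE /= andbC.
Qed.

Lemma move_block_move p B B' : move p B B' <-> block_move p (cols B) (cols B').
Proof.
split.
  move=> [a [b [hp ha hb ->]]].
  have nab : a \notin b |: B.
    rewrite !inE negb_or ha andbT; apply/eqP => E; subst b.
    by case: p hp => -[_]; lia.
  exists (a.2 : nat), (a.1 : nat).
  have -> : second p a.2 a.1 = (b.2 : nat, b.1 : nat).
    by case: p hp => -[/= <- ->].
  rewrite !cell_cols setUCA !cols_setU //.
  by rewrite !inE negb_or hb andbT; apply: contraNneq nab => ->; rewrite !inE eqxx.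
move=> [j [i]]; case E: second => [j' i'] [h1 h2 e].
have [w sz] := columns_cols B.
have := cell_lt w h1; rewrite sz => -[hj hi]; have := cell_lt w h2; rewrite sz => -[hj' hi'].
pose a := (Ordinal hi, Ordinal hj); pose b := (Ordinal hi', Ordinal hj').
have ha : a \notin B by rewrite -cell_cols.
have hb : b \notin B by rewrite -cell_cols.
have ab : b != a.
  apply/eqP => -[e1 e2]; by case: p E => -[]; lia.
exists a, b; split=> //.
  by case: p E => -[e1 e2]; split=> /=; rewrite -?e1 -?e2 //; apply: val_inj.
apply: cols_inj; rewrite e setUCA !cols_setU //.
by rewrite !inE negb_or ab hb.
Qed.

Lemma move_card p (B B' : board m n) : move p B B' -> #|~: B'| < #|~: B|.
Proof.
move=> [a [b [_ ha _ ->]]]; apply: proper_card; apply/properP; split.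
  by rewrite setCS; apply/subsetP => x h; rewrite !inE h !orbT.
by exists a; rewrite !inE ?eqxx.
Qed.

Lemma iota_rows (T : Type) (g : nat -> nat -> T) k :
  mkseq (fun l => g (l %% n) (l %/ n)) (k * n) =
  flatten [seq [seq g j i | j <- iota 0 n] | i <- iota 0 k].
Proof.
elim: k => // k IH; rewrite mulSnr /mkseq -addn1 !iotaD !map_cat flatten_cat.
rewrite -IH /= cats0 add0n; congr (_ ++ _).
rewrite -[k * n]addn0 iotaDl -map_comp; apply/eq_in_map => j; rewrite mem_iota => /andP[_ hj] /=.
have hj' : j < n by [].
by rewrite modnMDl modn_small // divnMDl ?divn_small ?addn0 //; lia.
Qed.

Lemma encode_boardE (B : board m n) : encode_board B = encode m n (cols B).
Proof.
rewrite /encode (iota_rows (cell (cols B)) m) /encode_board -!val_enum_ord -map_comp.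
congr flatten; apply: eq_map => i /=; rewrite -map_comp; apply: eq_map => j /=.
by rewrite -(cell_cols B (i, j)).
Qed.

Lemma size_encode_board (B : board m n) : size (encode_board B) = m * n.
Proof. by rewrite encode_boardE size_mkseq. Qed.

Definition decode_board (I : seq bool) : board m n := [set x : 'I_m * 'I_n | nth false I (x.1 * n + x.2)].

Lemma encode_boardK (B : board m n) : decode_board (encode_board B) = B.
Proof.
apply/setP => x; rewrite inE encode_boardE nth_mkseq; last first.
  by case: x => -[i hi] [j hj] /=; nia.
by rewrite modnMDl modn_small // divnMDl ?divn_small ?addn0 ?cell_cols //; case: x.2 => /=; lia.
Qed.

Lemma wins_determined p (B : board m n) : wins p B -> ~ (forall B', move p B B' -> wins (opp p) B').
Proof.
elim=> {}p {}B B' mv _ IH /(_ B' mv) w.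
inversion w as [p' B1 B2 mv2 h]; subst; apply: (IH B2) => // B3 mv3.
by apply: h; rewrite oppK.
Qed.

Lemma strat_win_wins M f p bound (B : board m n) : strat_win M f p bound B -> wins p B.
Proof. by elim=> {}B B' t _ _ mv _ IH; apply: Wins mv IH. Qed.

End Boards.

(** * The winning strategies on narrow and wide boards *)

Section Players.

Variable m : nat.

(** Chosen without computation. The machine uses it only for inputs of bounded length, so it amounts
    to a finite table. *)
Definition answer n (p : player) (B : board m n) : board m n :=
  epsilon (inhabits B) (fun B' => move p B B' /\ forall B'', move (opp p) B' B'' -> wins p B'').

(** The input does not say whose turn it is. On narrow boards the machine plays for the player who
    can force a win, and [n] and [f] determine who that is. *)
Definition winner n (f : player) : player :=
  if excluded_middle_informative (wins f (set0 : board m n)) then f else opp f.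

Definition of_bit (b : bool) : player := if b then Vera else Hepzibah.

Definition small_answer n (f : bool) (I : seq bool) : seq bool :=
  encode_board (answer (winner n (of_bit f)) (decode_board m n I)).

(* [I] is the bit of the first player followed by an encoded board. *)
Definition small (I : seq bool) : seq bool :=
  small_answer (size (behead I) %/ m) (head false I) (behead I).

Definition fix_block (b : seq (seq bool)) : seq (seq bool) :=
  epsilon (inhabits b) (fun b' => block_move Hepzibah b b' /\ snd_block m b').

Lemma answerP n p (B : board m n) : wins p B ->
  move p B (answer p B) /\ forall B'', move (opp p) (answer p B) B'' -> wins p B''.
Proof.
move=> w; inversion w as [p' B1 B2 mv h]; subst.
pose P (B' : board m n) := move p B B' /\ forall B'', move (opp p) B' B'' -> wins p B''.
by apply: (epsilon_spec (inhabits B) P); exists B2.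
Qed.

Lemma fix_blockP b : wf m b -> fst_block m b ->
  block_move Hepzibah b (fix_block b) /\ snd_block m (fix_block b).
Proof.
move=> wb hb; have [b' h1 h2] := fst_block_move wb hb.
pose P b' := block_move Hepzibah b b' /\ snd_block m b'.
by apply: (epsilon_spec (inhabits b) P); exists b'.
Qed.

Lemma smallE n f (B : board m n) : 0 < m ->
  small (player_bit f :: encode_board B) = encode_board (answer (winner n f) B).
Proof.
move=> m0; rewrite /small /= size_encode_board mulKn // /small_answer encode_boardK.
by case: f.
Qed.

Variables (W c : nat).
Hypothesis m_gt1 : 1 < m.
Hypothesis W_gt1 : 1 < W.
Hypothesis run_time_c : forall n, W <= n -> run_time m W n <= c * n.+1 ^ 2.

Local Notation M := (machine m W small fix_block).
Local Notation bound n := ((c + 3 * (m * W) + 3) * n.+1 ^ 2).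

Lemma small_strategy n f (B : board m n) : n < W -> wins (winner n f) B ->
  strat_win M f (winner n f) (bound n) B.
Proof.
move=> nW; have [k] := ubnP #|~: B|; elim: k B => // k IH B hB w.
have [mv h] := answerP w.
have sz : (size (encode_board B)).+1 <= m * W by rewrite size_encode_board; nia.
have sm := smallE f B (ltnW m_gt1).
have [] := @run_small m W small fix_block (player_bit f) (encode_board B) sz.
  by rewrite sm !size_encode_board.
move=> t ht; rewrite sm => ht'.
apply: (StratWin _ ht' mv) => [|B'' mv'].
  by apply: leq_trans ht _; have := expn_gt0 n.+1 2; nia.
apply: IH (h _ mv'); apply: leq_trans (move_card mv') _.
by have := move_card mv; lia.
Qed.

Lemma large_strategy n f (B : board m n) bs : W <= n -> flatten bs = cols B ->
  active m W (~~ player_bit f) (W + n %% W) bs -> strat_win M f Hepzibah (bound n) B.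
Proof.
move=> Wn; have [k] := ubnP #|~: B|; elim: k B bs => // k IH B bs hB Eb hbs.
have [bs0 [bad [post [e1 h1 [wn sn] h3 [bs' e2 hq]]]]] := active_move fix_blockP hbs.
have [wB sB] := columns_cols B.
have hcs : columns m n (flatten bs0 ++ fix_block bad ++ post).
  rewrite -Eb in wB sB; have [w s] := block_moveW wB h3; split=> //; exact: etrans s sB.
have [t ht hr] := @run_large m W small fix_block m_gt1 W_gt1 n Wn (player_bit f) (cols B) bs0 bad
  _ post (columns_cols B) (etrans (esym Eb) e1) h1 erefl wn sn.
set B' := board_of m n (flatten bs0 ++ fix_block bad ++ post).
have EB' : cols B' = flatten bs0 ++ fix_block bad ++ post by apply: board_ofK.
have mv : move Hepzibah B B' by apply/move_block_move; rewrite EB' -Eb.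
rewrite -EB' -!encode_boardE in hr.
apply: (StratWin _ hr mv) => [|B'' /[dup] mv' /move_block_move].
  by apply: leq_trans ht _; apply: leq_trans (run_time_c Wn) _; rewrite leq_mul2r; lia.
rewrite EB' -e2 => /(quiet_move hq)[bs'' E'' h''].
apply: IH E'' h''; apply: leq_trans (move_card mv') _.
by have := move_card mv; lia.
Qed.

Lemma cols0 n : cols (set0 : board m n) = rect m n.
Proof.
have [w s] := columns_cols (set0 : board m n).
apply: (eq_cells w (wf_rect m n)); first by rewrite s size_nseq.
move=> j i hj hi; rewrite s in hj.
have := cell_cols (set0 : board m n) (Ordinal hi, Ordinal hj); rewrite /= inE => ->.
by rewrite /cell /rect !nth_nseq hj nth_nseq hi.
Qed.

Hypothesis thickW : thick m W.

(** The remainder is put into the first block, so that every width is at least [W] and at most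
    [2 * W]. *)
Definition empty_blocks n := rect m (W + n %% W) :: nseq (n %/ W).-1 (rect m W).

Lemma flatten_empty n : W <= n -> flatten (empty_blocks n) = cols (set0 : board m n).
Proof.
move=> Wn; rewrite cols0 /= /rect.
have -> : flatten (nseq (n %/ W).-1 (nseq W (nseq m false))) = nseq ((n %/ W).-1 * W) (nseq m false).
  by elim: (n %/ W).-1 => //= k ->; rewrite mulSn nseqD.
rewrite -nseqD; congr nseq; have := divn_eq n W.
have : 0 < n %/ W by rewrite divn_gt0 //; lia.
by case: (n %/ W) => //= q _; rewrite mulSn; lia.
Qed.

Lemma settled_rect e n : settled e (rect m n) = (e == false).
Proof.
rewrite /settled.
have -> : sumn (map (count id) (rect m n)) = 0.
  have E : count id (nseq m false) = 0 by elim: m.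
  by rewrite /rect; elim: n => //= n ->; rewrite E.
by case: e.
Qed.

Lemma quiet_empty k : quiet m W false W (nseq k (rect m W)).
Proof.
elim: k => //= k IH; split=> //; first exact: wf_rect.
- by rewrite size_nseq.
- by rewrite settled_rect.
- exact: (rect_bound_win (thickW (leqnn W))).1.
Qed.

Lemma quiet_start n : quiet m W false (W + n %% W) (empty_blocks n).
Proof.
split; [exact: wf_rect | by rewrite size_nseq | by rewrite settled_rect | | exact: quiet_empty].
exact: (rect_bound_win (thickW (leq_addr _ _))).1.
Qed.

(** If Hepzibah starts, the first block counts as the one that awaits an answer. The flag [true]
    reverses its parity, so the machine finds this block like any other. *)
Lemma active_start n : active m W true (W + n %% W) (empty_blocks n).
Proof.
split; [exact: wf_rect | by rewrite size_nseq | left; split].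
- by rewrite settled_rect.
- exact: (rect_bound_win (thickW (leq_addr _ _))).2.
- exact: quiet_empty.
Qed.

Lemma machine_wins n f :
  (wins f (set0 : board m n) -> strat_win M f f (bound n) (set0 : board m n)) /\
  ((forall B' : board m n, move f set0 B' -> wins (opp f) B') ->
     forall B' : board m n, move f set0 B' -> strat_win M f (opp f) (bound n) B').
Proof.
case: (ltnP n W) => nW.
  have E := small_strategy (f := f) nW; move: E; rewrite /winner.
  case: excluded_middle_informative => [w|w] E; split=> //.
  - by move=> _; apply: E.
  - by move/(wins_determined w).
  - by move=> h B' mv; apply: E; apply: h.
have fe := flatten_empty nW.
case: f => /=.
  have s B' : move Vera (set0 : board m n) B' -> strat_win M Vera Hepzibah (bound n) B'.
    move/move_block_move; rewrite -fe => /(quiet_move (quiet_start n))[bs E h].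
    exact: (@large_strategy n Vera B' bs nW E h).
  (* On a wide board Hepzibah wins in any case, so a forced win of Vera contradicts her strategy. *)
  split=> [w|_ //]; case: (wins_determined w) => B' /s; exact: strat_win_wins.
have s := @large_strategy n Hepzibah set0 _ nW fe (active_start n).
by split=> // h; case: (wins_determined (strat_win_wins s)).
Qed.

End Players.

Theorem theorem1 :
  forall m : nat, m \in [:: 2; 3; 4; 5; 7; 9; 11] ->
  exists (M : TM) (c k : nat),
    forall (n : nat) (f : player),
      let bound := c * n.+1 ^ k in
      (* the first player f can force a win on the empty board *)
      (wins f (set0 : board m n) ->
         strat_win M f f bound (set0 : board m n)) /\
      (* the second player (opp f) can force a win on the empty board *)
      ((forall B' : board m n, move f set0 B' -> wins (opp f) B') ->
         forall B' : board m n, move f set0 B' -> strat_win M f (opp f) bound B').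
Proof.
move=> m m_in; have [N0 hN0] := thick_width m_in.
have m_gt1 : 1 < m by move: m m_in {N0 hN0}; apply/allP.
(* With [1 < W] the counter of [Grow], which starts at 1, is the initial distance of the pebbles
   modulo [W]. *)
pose W := maxn N0 2; have W_gt1 : 1 < W by rewrite /W leq_max orbT.
have thickW : thick m W by move=> n hn; apply: hN0; apply: leq_trans hn; apply: leq_maxl.
have [c hc] := run_time_bound m W.
exists (machine m W (@small m) (@fix_block m)), (c + 3 * (m * W) + 3), 2 => n f.
exact: machine_wins.
Qed.
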